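(* Let $k$ be a field of characteristic $0$, let $p(t)$ be the Hilbert polynomial of some closed subscheme of $\mathbb{P}^n=\mathbb{P}^n_k$, and let $r,p,N$ and $q(t)$ be as in the context. The subscheme of $\mathbf{Gr}_p^N$ representing the Hilbert functor $\underline{\mathbf{Hilb}}^n_{p(t)}$ can be defined by an ideal generated by homogeneous elements of degree $q(r+1)+1$ in the ring $k[\Delta]$ of the Plücker coordinates.
   Context: The Gotzmann number $r$ of $p(t)$ is the number of summands in the unique expression $p(t)=\sum_{i=1}^{r}\binom{t+a_i-i+1}{a_i}$ with $a_1\ge\dots\ge a_r\ge 0$. Put $N(t)=\binom{n+t}{n}$, $q(t)=N(t)-p(t)$, $N=N(r)$, $p=p(r)$. The Hilbert functor $\underline{\mathbf{Hilb}}^n_{p(t)}$ sends a noetherian $k$-algebra $A$ to the set of closed subschemes $X\subset\mathbb{P}^n_A$ flat over $\operatorname{Spec}A$ whose fibers have Hilbert polynomial $p(t)$. The Grassmannian $\mathbf{Gr}_p^N$ represents the functor sending $A$ to the set of submodules $L\subseteq A^N$ with $A^N/L$ locally free of rank $p$. Identifying $A^N$ with $H^0(\mathcal{O}_{\mathbb{P}^n_A}(r))$ via the basis of monomials of degree $r$, the Hilbert functor embeds in the Grassmann functor by $X\mapsto H^0(\mathcal{I}_X(r))$, and it is represented by a closed subscheme of $\mathbf{Gr}_p^N$ through this embedding. $k[\Delta]$ is the homogeneous coordinate ring of $\mathbf{Gr}_p^N$ in its Plücker embedding in $\mathbb{P}^E$, $E+1=\binom{N}{p}$ (polynomial ring in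 the Plücker variables modulo the Plücker relations), graded with the Plücker coordinates in degree $1$. *)

(* Defs.v *)
From HB Require Import structures.
From mathcomp Require Import all_boot all_order all_algebra.
From mathcomp Require Import mpoly.

Set Implicit Arguments.
Unset Strict Implicit.
Unset Printing Implicit Defensive.

Import GRing.Theory.

Local Open Scope ring_scope.

(* Submodules and ideals are Prop-valued predicates, compared extensionally. *)

Definition is_submod (R : comNzRingType) (M : lmodType R) (W : M -> Prop) :=
  [/\ W 0, forall x y, W x -> W y -> W (x + y)
    & forall a x, W x -> W (a *: x)].

Definition span (R : comNzRingType) (M : lmodType R) (S : M -> Prop) (x : M) :=
  exists d (c : 'I_d -> R) (s : 'I_d -> M),
    (forall i, S (s i)) /\ x = \sum_i c i *: s i.

Definition is_ideal (R : comNzRingType) (I : R -> Prop) :=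
  @is_submod R R^o I.

Definition ideal_gen (R : comNzRingType) (S : R -> Prop) : R -> Prop :=
  @span R R^o S.

Definition prime_ideal (R : comNzRingType) (P : R -> Prop) :=
  [/\ is_ideal P, ~ P 1 & forall x y, P (x * y) -> P x \/ P y].

Definition noetherian (R : comNzRingType) :=
  forall I : R -> Prop, is_ideal I ->
    exists s : seq R, forall x, I x <-> ideal_gen (fun y => y \in s) x.

(* phi : A -> B exhibits B as the localization A_f. *)
Definition is_localization (A B : comNzRingType) (f : A) (phi : A -> B) :=
  [/\ exists g, g * phi f = 1,
      forall b, exists m a, b * phi f ^+ m = phi a
    & forall a, phi a = 0 -> exists m, f ^+ m * a = 0].

(* phi : A -> K exhibits the field K as the residue field at the point ker phi
   of Spec A; every point arises in this way. *)
Definition is_residue_field (A : comNzRingType) (K : fieldType)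
    (phi : A -> K) :=
  forall x, exists a b, phi b != 0 /\ x = phi a / phi b.

(* The sum of the m i (x) y i vanishes in the tensor product over A of M / W and
   N, that is, it is killed by every A-bilinear map out of (M / W) x N. *)
Definition tensor_zero (A : comNzRingType) (M N : lmodType A) (W : M -> Prop)
    (d : nat) (m : 'I_d -> M) (y : 'I_d -> N) :=
  forall (T : lmodType A) (b : M -> N -> T),
    (forall v, linear (b v)) -> (forall z, linear (b ^~ z)) ->
    (forall w z, W w -> b w z = 0) ->
    \sum_i b (m i) (y i) = 0.

(* M / W is a flat A-module: tensoring with it preserves injectivity. *)
Definition flat_quot (A : comNzRingType) (M : lmodType A) (W : M -> Prop) :=
  forall (N' N : lmodType A) (u : {linear N' -> N}), injective u ->
  forall d (m : 'I_d -> M) (y : 'I_d -> N'),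
    tensor_zero W m (u \o y) -> tensor_zero W m y.

(* A closed subscheme X of P^n_A is given by its saturated homogeneous ideal
   I = \bigoplus_d H^0(I_X(d)) in A[x_0, .., x_n]. *)

Definition saturation (A : comNzRingType) n (J : {mpoly A[n.+1]} -> Prop)
    (f : {mpoly A[n.+1]}) :=
  forall i, exists m, J ('X_i ^+ m * f).

Definition closed_subscheme (A : comNzRingType) n
    (I : {mpoly A[n.+1]} -> Prop) :=
  [/\ is_ideal I, forall f d, I f -> I (pihomog mdeg d f)
    & forall f, saturation I f -> I f].

Definition same_subscheme (A : comNzRingType) n
    (I I' : {mpoly A[n.+1]} -> Prop) :=
  forall f, I f <-> I' f.

Definition ideal_image (A B : comNzRingType) (phi : A -> B) n
    (I : {mpoly A[n]} -> Prop) : {mpoly B[n]} -> Prop :=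
  ideal_gen (fun g => exists2 f, I f & g = map_mpoly phi f).

Definition subscheme_pullback (A B : comNzRingType) (phi : A -> B) n
    (I : {mpoly A[n.+1]} -> Prop) : {mpoly B[n.+1]} -> Prop :=
  saturation (ideal_image phi I).

(* The coordinate ring of X on the chart x_i <> 0, the degree 0 part of
   (A[x] / I)_{x_i}, is A[x] / (I, x_i - 1). *)
Definition chart_ideal (A : comNzRingType) n (I : {mpoly A[n.+1]} -> Prop)
    (i : 'I_n.+1) : {mpoly A[n.+1]} -> Prop :=
  ideal_gen (fun f => I f \/ f = 'X_i - 1).

Definition flat_subscheme (A : comNzRingType) n
    (I : {mpoly A[n.+1]} -> Prop) :=
  forall i, @flat_quot A {mpoly A[n.+1]} (chart_ideal I i).

(* dim_K (K[x] / I)_d = h *)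
Definition hilbert_fun_at (K : fieldType) n (I : {mpoly K[n]} -> Prop)
    (d h : nat) :=
  exists e : 'I_h -> {mpoly K[n]},
    (forall j, e j \is d.-homog) /\
    (forall f, f \is d.-homog ->
      exists! c : 'rV[K]_h, I (f - \sum_j c 0 j *: e j)).

(* I need not be saturated: saturating changes only finitely many degrees. *)
Definition hilbert_poly (K : fieldType) n (I : {mpoly K[n]} -> Prop)
    (P : {poly rat}) :=
  exists d0, forall d, (d0 <= d)%N ->
    exists2 h : nat, hilbert_fun_at I d h & P.[d%:R] = h%:R.

(* The value at A of the Hilbert functor. *)
Definition Hilb n (P : {poly rat}) (A : comNzRingType)
    (I : {mpoly A[n.+1]} -> Prop) :=
  [/\ closed_subscheme I, flat_subscheme I
    & forall (K : fieldType) (phi : {rmorphism A -> K}),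
        is_residue_field phi -> hilbert_poly (ideal_image phi I) P].

(* binom(t + c, a) as a polynomial in t *)
Definition binom_poly (c : int) (a : nat) : {poly rat} :=
  (a`!%:R)^-1 *: \prod_(j < a) ('X + (c - j%:Z)%:~R%:P).

(* With the summands numbered from 0, the i-th one is binom(t + a_i - i, a_i). *)
Definition gotzmann_number (P : {poly rat}) (r : nat) :=
  exists a : seq nat,
    [/\ size a = r, sorted geq a
      & P = \sum_(i < r) binom_poly ((nth 0%N a i)%:Z - i%:Z) (nth 0%N a i)].

(* N(t) - P(t) *)
Definition compl_poly n (P : {poly rat}) : {poly rat} :=
  binom_poly n%:Z n - P.

Definition monomials n r : {set 'X_{1..n < r.+1}} :=
  [set m : 'X_{1..n < r.+1} | mdeg m == r].

Lemma card_monomials n r : #|monomials n.+1 r| = 'C(n + r, n).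
Proof.
rewrite -bin_sub ?leq_addr // addKn addnC -size_basis cardE -(size_map val).
apply: perm_size; apply: uniq_perm => [||m].
- by rewrite map_inj_uniq ?enum_uniq //; apply: val_inj.
- exact: uniq_basis.
rewrite -basis_cover; apply/mapP/eqP => [[m' + ->]|mr].
  by rewrite mem_enum inE => /eqP.
have mlt : (mdeg m < r.+1)%N by rewrite mr.
by exists (BMultinom mlt); rewrite // mem_enum inE /= mr.
Qed.

(* The identification of A^N with the forms of degree r. *)
Definition form_of_row (A : comNzRingType) n r
    (v : 'rV[A]_#|monomials n r|) : {mpoly A[n]} :=
  \sum_i v 0 i *: 'X_[bmnm (enum_val i)].

(* H^0(I_X(r)) as a submodule of A^N *)
Definition H0 (A : comNzRingType) n r (I : {mpoly A[n.+1]} -> Prop)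
    (v : 'rV[A]_#|monomials n.+1 r|) :=
  I (form_of_row v).

Definition submod_pullback (A B : comNzRingType) (phi : A -> B) N
    (L : 'rV[A]_N -> Prop) : 'rV[B]_N -> Prop :=
  span (fun w => exists2 v, L v & w = map_mx phi v).

(* v |-> v *m C induces an isomorphism from A^N / L to A^p. *)
Definition presents_quot (A : comNzRingType) N p (L : 'rV[A]_N -> Prop)
    (C : 'M[A]_(N, p)) :=
  (forall w : 'rV[A]_p, exists v, v *m C = w) /\ (forall v, v *m C = 0 <-> L v).

(* The value at A of the Grassmann functor: A^N / L is locally free of rank p. *)
Definition Gr N p (A : comNzRingType) (L : 'rV[A]_N -> Prop) :=
  is_submod L /\
  forall P : A -> Prop, prime_ideal P -> exists f, ~ P f /\
    exists (B : comNzRingType) (phi : {rmorphism A -> B}) (C : 'M[B]_(N, p)),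
      is_localization f phi /\ presents_quot (submod_pullback phi L) C.

Definition plucker_ix N p : {set p.-tuple 'I_N} :=
  [set t : p.-tuple 'I_N | sorted ltn (map val t)].

Lemma card_plucker_ix N p : #|plucker_ix N p| = 'C(N, p).
Proof. exact: card_ltn_sorted_tuples. Qed.

(* k[Delta] is the quotient of this ring by the Plucker relations below. *)
Notation plucker_poly k N p := {mpoly k[#|plucker_ix N p|]}.

(* The Plucker variable of an arbitrary p-tuple of indices: the signed variable
   of its increasing rearrangement, or 0 if two of the indices coincide. *)
Definition plucker_var (k : fieldType) N p (u : 'I_p -> 'I_N) :
    plucker_poly k N p :=
  \sum_i (\det (\matrix_(a < p, b < p) (u a == tnth (enum_val i) b)%:R : 'M[k]_p))
    *: 'X_i.

(* The quadratic Plucker relations, in exchange form. *)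
Definition plucker_relation (k : fieldType) N p
    (g : plucker_poly k N p) :=
  exists (u v : 'I_p -> 'I_N) (a : 'I_p),
    g = plucker_var k u * plucker_var k v
        - \sum_(l < p) plucker_var k [eta u with a |-> v l]
                       * plucker_var k [eta v with l |-> u a].

(* The ideal generated by G in k[Delta], as an ideal of the polynomial ring
   containing the Plucker relations. *)
Definition plucker_ideal_gen (k : fieldType) N p
    (G : plucker_poly k N p -> Prop) :=
  ideal_gen (fun g => plucker_relation g \/ G g).

Definition plucker_coords (A : comNzRingType) N p (C : 'M[A]_(N, p))
    (i : 'I_#|plucker_ix N p|) : A :=
  \det (rowsub (tnth (enum_val i)) C).

(* The A-points of the closed subscheme of Gr defined by a homogeneous ideal J of
   k[Delta]. The Plucker coordinates are defined where A^N / L is trivialized,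
   up to a unit. *)
Definition Gr_closed (k : fieldType) N p (J : plucker_poly k N p -> Prop)
    (A : comAlgType k) (L : 'rV[A]_N -> Prop) :=
  Gr p L /\
  forall (f : A) (B : comNzRingType) (phi : {rmorphism A -> B})
      (C : 'M[B]_(N, p)),
    is_localization f phi -> presents_quot (submod_pullback phi L) C ->
    forall g, J g ->
      (map_mpoly (phi \o in_alg A) g).@[plucker_coords C] = 0.

(* X |-> H^0(I_X(r)) is an isomorphism from the Hilbert functor onto the functor
   of points, on noetherian k-algebras, of the closed subscheme of Gr defined by
   J. *)
Definition represents_Hilb (k : fieldType) n r p (P : {poly rat})
    (J : plucker_poly k #|monomials n.+1 r| p -> Prop) :=
  [/\ forall (A : comAlgType k) (I : {mpoly A[n.+1]} -> Prop),
        noetherian A -> Hilb P I -> Gr_closed J (H0 (r := r) I),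
      forall (A : comAlgType k) (I I' : {mpoly A[n.+1]} -> Prop),
        noetherian A -> Hilb P I -> Hilb P I' ->
        (forall v, H0 (r := r) I v <-> H0 (r := r) I' v) ->
        same_subscheme I I',
      forall (A : comAlgType k) (L : 'rV[A]_#|monomials n.+1 r| -> Prop),
        noetherian A -> Gr_closed J L ->
        exists2 I : {mpoly A[n.+1]} -> Prop,
          Hilb P I & forall v, H0 (r := r) I v <-> L v
    & forall (A B : comAlgType k) (phi : {lrmorphism A -> B})
             (I : {mpoly A[n.+1]} -> Prop),
        noetherian A -> noetherian B -> Hilb P I ->
        forall v, H0 (r := r) (subscheme_pullback phi I) v <->
                  submod_pullback phi (H0 (r := r) I) v].

(* Main.v *)
From HB Require Import structures.
Require Import Defs.
From Stdlib Require Import Classical ClassicalEpsilon FunctionalExtensionality.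
From mathcomp Require Import all_boot all_order all_algebra.
From mathcomp Require Import fingroup perm.
From mathcomp Require Import ring_quotient generic_quotient fraction zify ring.
From mathcomp Require Import mpoly.
Require Import Defs.
Set Implicit Arguments.
Unset Strict Implicit.
Unset Printing Implicit Defensive.

Import GRing.Theory.

(* Write q = q(r+1). A point L of the Grassmannian comes from a closed subscheme
   with Hilbert polynomial P iff the forms of degree r+1 modulo the submodule S_1 L
   generated by L are locally free of rank P(r+1). By Macaulay's bound S_1 L has
   rank at least q at every point, so the condition is that the (q+1)-minors of a
   matrix of generators of S_1 L vanish. On Plucker coordinates, L is generated by the
   vectors theta_{s,t} = D_t e_s - sum_l D_{t[l:=s]} e_{t_l}, which are linear in the
   coordinates D, so those minors of the x_i theta_{s,t} are forms of degree q+1.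

   Where the minors vanish, Gotzmann's persistence theorem makes all S_d L, d >= r,
   locally free of the right rank. The proofs of Macaulay's bound, persistence and
   regularity are by restriction to a generic hyperplane h (Green's theorem); the
   higher syzygies are handled by the exactness of the Koszul complex at one spot,
   which passes from J + (h) to J. Over a noetherian ring everything is
   checked at the points of the spectrum, with denominators instead of localizations. *)

(** Two obstacles shape the argument. Over a ring with nilpotents the ranks of the fibres do not
    control freeness, so the vanishing of Tor_1 with the residue field is carried from degree to
    degree along with the ranks ([mod_prop]), and a determinant form of Nakayama's lemma turns both
    into freeness. In the other direction, flatness and the Hilbert polynomial speak only of large
    degrees, and the fibres of a saturated ideal need not be saturated. Going down to degree r
    ([descend]) therefore works with the saturation T of the fibre and shows, one degree at a time,
    that nothing was added. Characteristic 0 serves three purposes: the fields are infinite, so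
    generic hyperplanes exist without extending the residue field; Koszul exactness comes from
    Euler's formula, with division by the degree; alternating families are obtained by halving. *)

(** * Macaulay representations *)

(* The value at d of the polynomial with Gotzmann expansion a, which for
   size a <= d is the d-th Macaulay representation of an integer. Passing from a
   to dec_seq a is restriction to a hyperplane. *)
Fixpoint mac (d : nat) (a : seq nat) : nat :=
  if a is x :: a' then 'C(d + x, x) + mac d.-1 a' else 0.

Definition dec_seq (a : seq nat) : seq nat := [seq x.-1 | x <- a & 0 < x].

Fixpoint lexs (a b : seq nat) : bool :=
  match a, b with
  | _, [::] => false
  | [::], _ => true
  | x :: a', y :: b' => (x < y) || (x == y) && lexs a' b'
  end.

Lemma lexs_total a b : [\/ lexs a b, a = b | lexs b a].
Proof.
elim: a b => [|x a IH] [|y b] //=; [by constructor 2|by constructor 1|by constructor 3|].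
case: (ltngtP x y) => [lt|gt|->] /=; [by constructor 1|by constructor 3|].
by case: (IH b) => [?|->|?]; [constructor 1|constructor 2|constructor 3].
Qed.

Lemma lexs_rcons a z b : lexs (rcons a z) b -> lexs a b.
Proof.
elim: a b => [|x a IH] [|y b] //=.
by case: (ltngtP x y) => //= _ /IH.
Qed.

Lemma size_dec_seq a : size (dec_seq a) <= size a.
Proof. by rewrite size_map size_filter count_size. Qed.

Lemma geq_all a x : sorted geq (x :: a) -> all (geq x) a.
Proof.
rewrite /sorted => h; apply: (order_path_min _ h) => y z t /= h1 h2.
exact: leq_trans h2 h1.
Qed.

Lemma sorted_dec_seq a : sorted geq a -> sorted geq (dec_seq a).
Proof.
move=> sa; rewrite /dec_seq (sorted_map); apply: sub_sorted (sorted_filter _ _ sa).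
  by move=> x y /=; lia.
by move=> x y z /= h1 h2; exact: leq_trans h2 h1.
Qed.

Lemma sorted_geq_behead x a : sorted geq (x :: a) -> sorted geq a.
Proof. exact: path_sorted. Qed.

Lemma dec_seq0 a : sorted geq (0 :: a) -> dec_seq (0 :: a) = [::].
Proof.
move=> /geq_all h; rewrite /dec_seq /= ; elim: a h => //= x a IH.
by rewrite /geq /= leqn0 => /andP[/eqP->] /= /IH.
Qed.

(** By Pascal's rule C(d + x + 1, x + 1) - C(d + x, x) = C(d + x, x + 1), and by induction the tail,
    whose head is at most x, stays below that. *)
Lemma mac_lt_bin d x a : sorted geq (x :: a) -> size (x :: a) <= d ->
  mac d (x :: a) < 'C(d + x.+1, x.+1).
Proof.
elim: a d x => [|y a IH] [//|d] x sa sz.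
  by rewrite /= addn0 addnS binS -{1}[_ (_ + _) x]add0n ltn_add2r bin_gt0; lia.
have yx : y <= x by have /geq_all /andP[] := sa.
have := IH d y (sorted_geq_behead sa) sz.
rewrite [mac d.+1 _]/= -/(mac d (y :: a)) => h.
rewrite addnS binS addnC ltn_add2r.
apply: leq_trans h _.
rewrite -(bin_sub (leq_addl _ _)) -[leqRHS]bin_sub; last by lia.
have -> : d + y.+1 - y.+1 = d by lia.
have -> : d.+1 + x - x.+1 = d by lia.
by apply: leq_bin2l; lia.
Qed.

(** The lexicographic order does not mention d. This is how a comparison of two expansions in one
    degree is carried to another, as long as they are short enough. *)
Lemma mac_lexs d a b : sorted geq a -> size a <= d -> lexs a b ->
  mac d a < mac d b.
Proof.
elim: a d b => [|x a IH] d [|y b] //.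
  by move=> _ _ _ /=; rewrite ltn_addr // bin_gt0 leq_addl.
move=> sa sz /=; case: (ltngtP x y) => //= [xy _|<- l].
  apply: (@leq_trans 'C(d + y, y)); last exact: leq_addr.
  apply: leq_trans (mac_lt_bin sa sz) _.
  rewrite -(bin_sub (leq_addl _ _)) -[leqRHS](bin_sub (leq_addl _ _)) !addnK.
  by apply: leq_bin2l; lia.
by rewrite ltn_add2l; apply: IH (sorted_geq_behead sa) _ l; move: sz => /=; lia.
Qed.

Lemma mac_notlexs d a b : sorted geq a -> size a <= d -> ~~ lexs b a ->
  mac d a <= mac d b.
Proof.
move=> sa sz; case: (lexs_total a b) => [l|-> //|-> //] _.
exact: ltnW (mac_lexs sa sz l).
Qed.

(** The greedy algorithm: remove the largest binomial that fits; by Pascal's rule the remainder is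
    small enough to be expanded in degree d - 1 with entries not exceeding the one just used. *)
Lemma mac_rep_lt d x c : c < 'C(d + x, x) ->
  exists a, [/\ sorted geq a, size a <= d, all (gtn x) a & mac d a = c].
Proof.
elim: d x c => [|d IHd] x c; first by rewrite add0n binn ltnS leqn0 => /eqP->; exists [::].
elim: x => [|x IHx]; first by rewrite addn0 bin0 ltnS leqn0 => /eqP->; exists [::].
case: (ltnP c 'C(d.+1 + x, x)) => [/IHx [a [? ? h ?]] _|cge].
  by exists a; split=> //; apply: sub_all h => y /=; lia.
rewrite addnS binS => clt.
have [|a [sa sz al me]] := IHd x.+1 (c - 'C(d.+1 + x, x)).
  by rewrite addnS -addSn; lia.
exists (x :: a); split=> //=; last by rewrite me; lia.
  by rewrite path_min_sorted //; apply: sub_all al => y /=; rewrite /geq /=; lia.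
by rewrite leqnn /=; apply: sub_all al => y /=; lia.
Qed.

Lemma mac_rep d c : 0 < d ->
  exists a, [/\ sorted geq a, size a <= d & mac d a = c].
Proof.
case: d => // d _; have [|a [? ? _ ?]] := @mac_rep_lt d.+1 c c; last by exists a.
rewrite -bin_sub ?leq_addl // addnK.
apply: (@leq_trans 'C(c.+1, c)); first by rewrite binSn.
rewrite -{1}bin_sub // subSnn bin1 addSn.
have : c.+1 <= (d + c).+1 by lia.
by elim: d => [|d IH] h; [rewrite bin1|rewrite addSn binS; lia].
Qed.

(** Pascal's rule summand by summand. An entry 0 contributes the constant 1, whose difference is 0,
    which is why [dec_seq] drops it. *)
Lemma mac_diff d a : sorted geq a -> size a <= d.+1 ->
  mac d.+1 a = mac d a + mac d.+1 (dec_seq a).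
Proof.
elim: a d => [|x a IH] d sa sz //.
case: x sa sz => [|x] sa sz.
  have E (s : seq nat) d' : all (geq 0) s -> mac d' s = size s.
    elim: s d' => //= y s IHs d' /andP[]; rewrite /geq /= leqn0 => /eqP-> /IHs->.
    by rewrite bin0.
  by rewrite dec_seq0 // addn0 !E //= geq_all.
rewrite -[dec_seq (x.+1 :: a)]/(x :: dec_seq a).
rewrite -[mac d.+1 (x.+1 :: a)]/('C(d.+1 + x.+1, x.+1) + mac d a).
rewrite -[mac d.+1 (x :: _)]/('C(d.+1 + x, x) + mac d (dec_seq a)).
rewrite -[mac d (x.+1 :: a)]/('C(d + x.+1, x.+1) + mac d.-1 a).
have -> : mac d a = mac d.-1 a + mac d (dec_seq a).
  case: d sz => [|d] sz; first by case: a sz {IH sa}.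
  by apply: IH; [exact: sorted_geq_behead sa|].
have -> : 'C(d.+1 + x.+1, x.+1) = 'C(d + x.+1, x.+1) + 'C(d.+1 + x, x).
  by rewrite addSn binS addnS addSn.
lia.
Qed.

Lemma mac_succ_lt d a b : sorted geq a -> sorted geq b -> size a <= d ->
  size b <= d -> mac d a < mac d b -> mac d.+1 a < mac d.+1 b.
Proof.
move=> sa sb za zb lt; apply: mac_lexs => //; first lia.
case: (lexs_total a b) => // [e|l]; first by rewrite e ltnn in lt.
by have := mac_lexs sb zb l; lia.
Qed.

Lemma mac_succ_le d a b : sorted geq a -> sorted geq b -> size a <= d ->
  size b <= d.+1 -> mac d b <= mac d a -> mac d.+1 b <= mac d.+1 a.
Proof.
move=> sa sb za zb le; apply: mac_notlexs => //.
by apply/negP => /(mac_lexs sa za); lia.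
Qed.

Lemma lexs_dec_seq a b : sorted geq a -> sorted geq b ->
  lexs (dec_seq a) (dec_seq b) -> lexs a b.
Proof.
have nlex s : lexs s [::] = false by case: s.
elim: a b => [|[|x] a IH] [|[|y] b] // sa sb; rewrite ?(dec_seq0 sb) ?nlex //.
rewrite /= ltnS eqSS => /orP[->//|/andP[-> h]] /=; rewrite IH ?orbT //.
- exact: sorted_geq_behead sa.
- exact: sorted_geq_behead sb.
Qed.

Lemma mac_dec_le d a b : sorted geq a -> sorted geq b -> size a <= d ->
  size b <= d -> mac d a <= mac d b -> mac d (dec_seq a) <= mac d (dec_seq b).
Proof.
move=> sa sb za zb le; apply: mac_notlexs; first exact: sorted_dec_seq.
  exact: leq_trans (size_dec_seq _) za.
apply/negP => /(lexs_dec_seq sb sa) /(mac_lexs sb zb); lia.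
Qed.

(** The arithmetic of Green's induction: a, b and e stand for the codimensions of L, of its generic
    section and of the colon ideal. By [mac_diff] the last hypothesis says
    [mac d b <= mac d (dec_seq e)]. If b exceeded [dec_seq a], then [mac d e] would be below
    [mac d a], so [dec_seq e] would be bounded by [dec_seq a], which is lexicographically below
    b. *)
Lemma mac_green d a b e : sorted geq a -> sorted geq b -> sorted geq e ->
  size a <= d.+1 -> size b <= d.+1 -> size e <= d ->
  mac d.+1 b + mac d e = mac d.+1 a ->
  mac d.+1 b <= mac d.+1 (dec_seq b) + mac d (dec_seq e) ->
  mac d.+1 b <= mac d.+1 (dec_seq a).
Proof.
move=> sa sb se za zb ze eqc; rewrite (mac_diff sb zb) addnC leq_add2l => le.
have sDa := sorted_dec_seq sa.
rewrite leqNgt; apply/negP; rewrite addnC -(mac_diff sb zb) => lt.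
have lab : lexs (dec_seq a) b.
  case: (lexs_total (dec_seq a) b) => // [e'|l]; first by rewrite e' ltnn in lt.
  by have := mac_lexs sb zb l; lia.
have lte : mac d e < mac d a by have := mac_diff sa za; lia.
(* [a] may have d + 1 entries, one too many for degree d. Its last binomial counts 1 there, so
   dropping the last entry keeps the bound on e, which is strict for [a]. *)
suff [a' [sa' za' la' le']] : exists a', [/\ sorted geq a', size a' <= d,
    lexs (dec_seq a') b & mac d e <= mac d a'].
  have h1 := mac_dec_le se sa' ze za' le'.
  have h2 := mac_lexs (sorted_dec_seq sa') (leq_trans (size_dec_seq _) za') la'.
  lia.
case: (leqP (size a) d) => [zad|gtd]; first by exists a; split=> //; lia.
have : size a = d.+1 by lia.
case/lastP: a sa za eqc sDa lt lab lte gtd => // a z.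
rewrite size_rcons => sa _ _ _ _ lab lte _ [sz].
have saa : sorted geq a by move: sa; case: (a) => //= x s; rewrite rcons_path => /andP[].
exists a; split=> //; first lia.
  move: lab; rewrite /dec_seq filter_rcons; case: (0 < z) => //.
  by rewrite map_rcons => /lexs_rcons.
suff E : mac d (rcons a z) = (mac d a).+1 by lia.
rewrite -{}sz; clear; elim: a => [|x a IH] /=; first by rewrite binn.
by move: IH => /= ->; rewrite addnS.
Qed.

Local Open Scope ring_scope.

(** * Macaulay's bound, persistence and regularity over a field *)

Lemma pchar0_avoid (K : fieldType) (s : seq K) :
  [pchar K] =i pred0 -> exists x, x \notin s.
Proof.
move=> ch; apply: NNPP => h; pose t := [seq i%:R : K | i <- iota 0 (size s).+1].
have ut : uniq t.
  rewrite map_inj_in_uniq ?iota_uniq // => i j _ _ eij.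
  wlog ij : i j eij / (i <= j)%N.
    by move=> W; case: (leqP i j) => [/W->//|/ltnW/W->].
  have /eqP : (j - i)%:R = 0 :> K by rewrite natrB // eij subrr.
  by rewrite ((pcharf0P K).1 ch) subn_eq0 => ji; apply/eqP; rewrite eqn_leq ij.
have /uniq_leq_size : {subset t <= s}.
  by move=> x _; apply/negPn/negP => xs; apply: h; exists x.
by move=> /(_ ut); rewrite size_map size_iota ltnn.
Qed.

Lemma poly_roots_finite (K : fieldType) (f : {poly K}) :
  f != 0 -> exists s : seq K, forall t, t \notin s -> f.[t] != 0.
Proof.
have [n] := ubnP (size f); elim: n f => // n IH f szf f0.
case: (classic (exists x, root f x)) => [[x /factor_theorem [g fE]]|h].
  have g0 : g != 0 by apply: contraNneq f0 => g0; rewrite fE g0 mul0r.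
  have [|s hs] := IH g _ g0; first by move: szf; rewrite fE size_Mmonic ?monicXsubC // size_XsubC addn2.
  exists (x :: s) => t; rewrite inE negb_or => /andP[tx ts].
  by rewrite fE hornerM mulf_neq0 ?hs // hornerXsubC subr_eq0.
by exists [::] => t _; apply/negP => ft; apply: h; exists t.
Qed.

(* A stand-in for Zariski-open sets: on every line through a point of U,
   all but finitely many points lie in U. *)
Definition line_open (K : fieldType) (V : lmodType K) (U : V -> Prop) :=
  forall u v, U u -> exists s : seq K, forall t, t \notin s -> U (u + t *: (v - u)).

(** The line through a point of U and a point of W meets each set in all but finitely many of its
    points, and a field of characteristic 0 is infinite. *)
Lemma line_open_meet (K : fieldType) (V : lmodType K) (U W : V -> Prop) :
  [pchar K] =i pred0 -> line_open U -> line_open W ->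
  (exists u, U u) -> (exists w, W w) -> exists x, U x /\ W x.
Proof.
move=> ch oU oW [u Uu] [w Ww].
have [s hs] := oU u w Uu; have [s' hs'] := oW w u Ww.
have [x] := pchar0_avoid (s ++ [seq 1 - y | y <- s']) ch.
rewrite mem_cat negb_or => /andP[/hs h1 xs'].
exists (u + x *: (w - u)); split=> //.
have /hs' : 1 - x \notin s'.
  by apply: contraNN xs' => h; rewrite -[x](subKr 1); apply: map_f.
congr W; rewrite scalerBl scale1r -[u - w]opprB scalerN opprK addrA.
by congr (_ + _); rewrite opprB addrC subrK.
Qed.

Lemma mxrank_witness (K : fieldType) (a b k : nat) (A : 'M[K]_(a, b)) :
  (k <= \rank A)%N -> exists P Q, P *m A *m Q = 1%:M :> 'M_k.
Proof.
move=> kA; exists ((pid_mx k : 'M_(k, a)) *m invmx (col_ebase A)).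
exists (invmx (row_ebase A) *m (pid_mx k : 'M_(b, k))).
rewrite -{2}[A]mulmx_ebase !mulmxA mulmxKV ?col_ebase_unit //.
rewrite -[_ *m row_ebase A *m _]mulmxA mulmxV ?row_ebase_unit // mulmx1.
rewrite !mul_pid_mx -pid_mx_1; congr (pid_mx _).
have := rank_leq_row A; have := rank_leq_col A; lia.
Qed.

Lemma mxrank_witness_le (K : fieldType) (a b k : nat) (A : 'M[K]_(a, b)) P Q :
  P *m A *m Q = 1%:M :> 'M_k -> (k <= \rank A)%N.
Proof.
move=> e; have := mxrankM_maxl (P *m A) Q; rewrite e mxrank1 => h.
exact: leq_trans h (mxrankM_maxr _ _).
Qed.

(** If [P *m M u *m Q = 1], the determinant of [P *m M *m Q] along the line is a polynomial in t
    with value 1 at t = 0. *)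
Lemma line_open_rank (K : fieldType) (V : lmodType K) (a b k : nat)
    (M : V -> 'M[K]_(a, b)) :
  (forall u v t, M (u + t *: (v - u)) = M u + t *: (M v - M u)) ->
  line_open (fun v => (k <= \rank (M v))%N).
Proof.
move=> Maff u v ku; have [P [Q PQ]] := mxrank_witness ku.
pose F : 'M[{poly K}]_k := 1%:M + 'X *: map_mx polyC (P *m (M v - M u) *m Q).
have FE t : (\det F).[t] = \det (P *m M (u + t *: (v - u)) *m Q).
  rewrite -[LHS]/(horner_eval t (\det F)) -det_map_mx; congr (\det _).
  rewrite Maff mulmxDr mulmxDl PQ -scalemxAr -scalemxAl; apply/matrixP => i j.
  by rewrite !mxE rmorphD rmorphM rmorph_nat /= /horner_eval hornerX hornerC.
have F0 : \det F != 0.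
  apply/eqP => F0; have := FE 0; rewrite F0 horner0 scale0r addr0 PQ det1.
  by move/eqP; rewrite eq_sym oner_eq0.
have [s hs] := poly_roots_finite F0; exists s => t /hs; rewrite FE => d0.
have U : P *m M (u + t *: (v - u)) *m Q \in unitmx by rewrite unitmxE unitfE.
apply: (@mxrank_witness_le _ _ _ _ _ P (Q *m invmx (P *m M (u + t *: (v - u)) *m Q))).
by rewrite mulmxA mulmxV.
Qed.

Lemma mxrank_adds (K : fieldType) (q q' n : nat) (L : 'M[K]_(q, n)) (B : 'M_(q', n)) :
  \rank (L + B)%MS = (\rank L + \rank (B *m cokermx L))%N.
Proof.
have h := mxrank_mul_ker B (cokermx L); have h' := mxrank_sum_cap L B.
have e : (kermx (cokermx L) :=: L)%MS.
  apply/eqmxP/andP; split; first by rewrite submxE mulmx_ker.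
  by apply/sub_kermxP/mulmx_coker.
have := (cap_eqmx (eqmx_refl B) e).1; rewrite [(B :&: L)%MS]capmxC => h2.
lia.
Qed.

Definition codim (K : fieldType) q n (L : 'M[K]_(q, n)) : nat := n - \rank L.

Lemma codimE (K : fieldType) q n (L : 'M[K]_(q, n)) : (codim L + \rank L)%N = n.
Proof. by rewrite subnK // rank_leq_col. Qed.

Lemma codimS (K : fieldType) q q' n (L : 'M[K]_(q, n)) (L' : 'M[K]_(q', n)) :
  (L <= L')%MS -> (codim L' <= codim L)%N.
Proof. by move=> /mxrankS; rewrite /codim; lia. Qed.

Lemma codim_eq (K : fieldType) q q' n (L : 'M[K]_(q, n)) (L' : 'M[K]_(q', n)) :
  (L <= L')%MS -> (codim L <= codim L')%N -> (L' <= L)%MS.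
Proof.
move=> s c; have := mxrank_leqif_sup s => /leqifP.
by case: (L' <= L)%MS => //; have := codimE L; have := codimE L'; lia.
Qed.

Lemma codim0 (K : fieldType) q n (L : 'M[K]_(q, n)) :
  codim L = 0%N -> forall q' (v : 'M_(q', n)), (v <= L)%MS.
Proof.
move=> c q' v; apply: submx_full; rewrite /row_full eqn_leq rank_leq_col.
by have := codimE L; lia.
Qed.

(** The kernel consists of the vectors that B maps into L, the colon L : B. Multiplication by B
    embeds the quotient by it into the quotient by L, with cokernel the quotient by L + B. *)
Lemma codim_adds (K : fieldType) q q' n (L : 'M[K]_(q, n)) (B : 'M_(q', n)) :
  codim L = (codim (L + B)%MS + codim (kermx (B *m cokermx L)))%N.
Proof.
have := codimE L; have := codimE (L + B)%MS; have := codimE (kermx (B *m cokermx L)).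
rewrite mxrank_adds mxrank_ker; have := rank_leq_row (B *m cokermx L).
by have := rank_leq_col (L + B)%MS; rewrite mxrank_adds; lia.
Qed.

Lemma sub_colonP (K : fieldType) q q' n m (v : 'M[K]_(m, q')) (L : 'M[K]_(q, n)) (B : 'M_(q', n)) :
  (v <= kermx (B *m cokermx L))%MS = (v *m B <= L)%MS.
Proof. by rewrite [RHS]submxE -mulmxA; apply/sub_kermxP/eqP. Qed.

(** * Green's hyperplane theorem and Macaulay's bound *)

Section Graded.
Variables (K : fieldType) (m : nat) (N : nat -> nat).
Variable X : forall d, 'I_m -> 'M[K]_(N d, N d.+1).
Hypothesis ch : [pchar K] =i pred0.
Hypothesis XC : forall d i j, X d i *m X d.+1 j = X d j *m X d.+1 i.
Hypothesis Xgen : forall d (v : 'rV_(N d.+1)), exists g, v = \sum_i g i *m X d i.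

Definition mu d (h : 'rV[K]_m) : 'M[K]_(N d, N d.+1) := \sum_i h 0 i *: X d i.

Lemma muC d i h : mu d h *m X d.+1 i = X d i *m mu d.+1 h.
Proof.
rewrite mulmx_suml mulmx_sumr; apply: eq_bigr => j _.
by rewrite -scalemxAl -scalemxAr XC.
Qed.

Lemma muMC d h h' : mu d h *m mu d.+1 h' = mu d h' *m mu d.+1 h.
Proof.
rewrite [in LHS]/mu mulmx_suml [mu d h']/mu mulmx_suml.
rewrite (eq_bigr (fun i => \sum_j (h 0 i * h' 0 j) *: (X d i *m X d.+1 j))); last first.
  by move=> i _; rewrite mulmx_sumr; apply: eq_bigr => j _; rewrite -scalemxAl -scalemxAr scalerA.
rewrite exchange_big /=; apply: eq_bigr => j _; rewrite mulmx_sumr; apply: eq_bigr => i _.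
by rewrite -scalemxAl -scalemxAr scalerA XC mulrC.
Qed.

Lemma mu_aff d u v t : mu d (u + t *: (v - u)) = mu d u + t *: (mu d v - mu d u).
Proof.
rewrite /mu -sumrB scaler_sumr -big_split; apply: eq_bigr => i _ /=.
by rewrite !mxE scalerDl -scalerBl scalerA.
Qed.

Lemma mu_delta d i : mu d (delta_mx 0 i) = X d i.
Proof.
rewrite /mu (bigD1 i) //= mxE !eqxx scale1r big1 ?addr0 // => j ji.
by rewrite mxE (negPf ji) andbF scale0r.
Qed.

Lemma mu0 d : mu d 0 = 0.
Proof. by rewrite /mu big1 // => i _; rewrite mxE scale0r. Qed.

Definition S1 d q (L : 'M[K]_(q, N d)) : 'M[K]_(N d.+1) := (\sum_i <<L *m X d i>>)%MS.

Lemma S1_sub d q q' (L : 'M_(q, N d)) (M : 'M_(q', N d.+1)) :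
  reflect (forall i, (L *m X d i <= M)%MS) (S1 L <= M)%MS.
Proof.
apply: (iffP sumsmx_subP) => h i; last by move=> _; rewrite genmxE.
by have := h i isT; rewrite genmxE.
Qed.

Lemma S1_mem d q (L : 'M_(q, N d)) (v : 'rV_(N d.+1)) : (v <= S1 L)%MS ->
  exists g, (forall i, (g i <= L)%MS) /\ v = \sum_i g i *m X d i.
Proof.
case/sub_sumsmxP=> u ->; have h i : exists D, u i *m <<L *m X d i>>%MS = D *m L *m X d i.
  have /submxP[D ->] : (u i *m <<L *m X d i>>%MS <= L *m X d i)%MS.
    by apply: submx_trans (submxMl _ _) _; rewrite genmxE.
  by exists D; rewrite mulmxA.
have [D hD] := fin_all_exists h.
exists (fun i => D i *m L); split=> [i|]; first exact: submxMl.
by apply: eq_bigr => i _; rewrite hD.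
Qed.

Lemma mem_S1 d q (L : 'M_(q, N d)) (g : 'I_m -> 'rV_(N d)) :
  (forall i, (g i <= L)%MS) -> ((\sum_i g i *m X d i)%R <= S1 L)%MS.
Proof.
move=> h; apply: summx_sub => i _; apply: (submx_trans (submxMr (X d i) (h i))).
by have /S1_sub := submx_refl (S1 L).
Qed.

Lemma line_open_codim d q (L : 'M_(q, N d.+1)) c :
  line_open (fun h => (codim (L + mu d h)%MS <= c)%N).
Proof.
have H : line_open (fun h => (N d.+1 - c <= \rank (col_mx L (mu d h)))%N).
  apply: line_open_rank => u v t.
  by rewrite opp_col_mx add_col_mx scale_col_mx add_col_mx subrr scaler0 addr0 mu_aff.
have E h : (codim (L + mu d h)%MS <= c)%N = (N d.+1 - c <= \rank (col_mx L (mu d h)))%N.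
  by rewrite -addsmxE /codim leq_subCl.
move=> u v; rewrite E => /(H u v)[s hs]; exists s => t /hs.
by rewrite E.
Qed.

Lemma codim_min d q (L : 'M_(q, N d.+1)) :
  exists h, forall h', (codim (L + mu d h)%MS <= codim (L + mu d h')%MS)%N.
Proof.
suff H c h : (codim (L + mu d h)%MS <= c)%N ->
    exists h, forall h', (codim (L + mu d h)%MS <= codim (L + mu d h')%MS)%N.
  exact: (H _ 0 (leqnn _)).
elim: c h => [|c IH] h hc; first by exists h => h'; lia.
case: (classic (exists h', (codim (L + mu d h')%MS <= c)%N)) => [[h' /IH//]|nh].
by exists h => h'; case: (leqP (codim (L + mu d h')%MS) c) => [?|]; [case: nh; exists h'|lia].
Qed.

(** Otherwise L would contain the image of every variable, and these images span degree d + 1. *)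
Lemma codim_mu_lt d (L : 'M_(N d.+1)) : (0 < codim L)%N ->
  exists h, (codim (L + mu d h)%MS < codim L)%N.
Proof.
move=> c0; apply: NNPP => nh.
suff h i : (X d i <= L)%MS.
  suff : (1%:M <= L)%MS by move=> /mxrankS; rewrite mxrank1 => ?; move: c0; rewrite /codim; lia.
  apply/rV_subP => v _; have [g ->] := Xgen v.
  by apply: summx_sub => i _; apply: (submx_trans (submxMl _ _) (h i)).
rewrite -mu_delta; apply/negPn/negP => ni; apply: nh; exists (delta_mx 0 i).
rewrite ltnNge; apply/negP => le; move/negP: ni; apply.
exact: submx_trans (addsmxSr _ _) (codim_eq (addsmxSl _ _) le).
Qed.

(** Green's theorem, by induction on the degree and the codimension, for the h0 that minimizes the
    section. Induction bounds generic sections of L + (h0) and of the colon L : h0. For a common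
    generic h', the codimension of L + (h') splits along h0 into that of L + (h0, h') and that of a
    colon containing (L : h0) + (h'); minimality of h0 and [mac_green] conclude. *)
Lemma green d (L : 'M_(N d.+1)) a : sorted geq a -> (size a <= d.+1)%N ->
  codim L = mac d.+1 a -> exists h, (codim (L + mu d h)%MS <= mac d.+1 (dec_seq a))%N.
Proof.
elim: d L a => [|d IHd] L a sa za cL; have [h0 h0m] := codim_min L.
  exists h0; have [c0|c0] := posnP (codim L).
    by have := codimS (addsmxSl L (mu 0 h0)); lia.
  have [h1 h1lt] := codim_mu_lt c0; have := h0m h1; have := mac_diff sa za.
  by case: (a) za cL => [|x []] //= _; rewrite ?bin1 ?binn; lia.
have [c] := ubnP (codim L); elim: c L a sa za cL h0 h0m => // c IHc L a sa za cL h0 h0m lec.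
exists h0; have [c0|c0] := posnP (codim L).
  by have := codimS (addsmxSl L (mu d.+1 h0)); lia.
have [h1 h1lt] := codim_mu_lt c0; have := h0m h1.
pose e := codim (L + mu d.+1 h0)%MS; rewrite -/e => eh1.
have lte : (e < codim L)%N by lia.
have [b [sb zb be]] := @mac_rep d.+2 e isT.
have [f [sf zf fe]] := @mac_rep d.+1 (codim L - e) isT.
have [k km] := codim_min (L + mu d.+1 h0)%MS.
have [|h2 h2le] := IHc _ _ sb zb (esym be) k km; first by move: lte; rewrite /e; lia.
pose Lc := kermx (mu d.+1 h0 *m cokermx L).
have cLc : codim Lc = mac d.+1 f by have := codim_adds L (mu d.+1 h0); rewrite fe -/Lc -/e; lia.
have [h3 h3le] := IHd _ _ sf zf cLc.
have [h' [h'm [h'2 h'3]]] : exists x, (codim (L + mu d.+1 x)%MS <= e)%N /\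
   ((codim (L + mu d.+1 h0 + mu d.+1 x)%MS <= mac d.+2 (dec_seq b))%N /\
    (codim (Lc + mu d x)%MS <= mac d.+1 (dec_seq f))%N).
  apply: (line_open_meet ch); first exact: line_open_codim.
  - move=> u v [h1' h2']; have [s hs] := line_open_codim v h1'; have [s' hs'] := line_open_codim v h2'.
    by exists (s ++ s') => t; rewrite mem_cat negb_or => /andP[/hs ? /hs' ?].
  - by exists h0.
  apply: (line_open_meet ch); [exact: line_open_codim|exact: line_open_codim| |].
    by exists h2.
  by exists h3.
have := codim_adds (L + mu d.+1 h')%MS (mu d.+1 h0).
have := h0m h'; rewrite -/e.
set Z := kermx _; have /codimS : (Lc + mu d h' <= Z)%MS.
  rewrite addsmx_sub !sub_colonP muMC (submx_trans (submxMl _ _) (addsmxSr _ _)) andbT.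
  by apply: submx_trans (addsmxSl _ _); rewrite -sub_colonP.
have -> : codim (L + mu d.+1 h' + mu d.+1 h0)%MS = codim (L + mu d.+1 h0 + mu d.+1 h')%MS.
  by rewrite -!addsmxA (addsmxC (mu d.+1 h')).
move=> h4 h5 h6.
rewrite -/e -be; apply: (mac_green sa sb sf) => //; last lia.
by rewrite be fe -cL; lia.
Qed.

(** L lies in the colon of [S1 L] by h, so passing to the section by h lowers the codimension of
    [S1 L] by at most that of L. Green's theorem bounds the section by the lowered expansion of
    [S1 L]; by [mac_diff] this leaves [mac d b <= mac d a]. *)
Lemma macaulay d q (L : 'M_(q, N d)) a : sorted geq a -> (size a <= d)%N ->
  codim L = mac d a -> (codim (S1 L) <= mac d.+1 a)%N.
Proof.
move=> sa za cL; have [b [sb zb bc]] := @mac_rep d.+1 (codim (S1 L)) isT.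
have [h hle] := green sb zb (esym bc).
have := codim_adds (S1 L) (mu d h); set Z := kermx _.
have /codimS : (L <= Z)%MS.
  rewrite sub_colonP mulmx_sumr; apply: summx_sub => i _; rewrite -scalemxAr.
  by apply: scalemx_sub; have /S1_sub := submx_refl (S1 L).
move=> h1 h2; rewrite -bc; apply: mac_succ_le => //.
by have := mac_diff sb zb; lia.
Qed.

End Graded.

(** * Gotzmann's persistence and regularity theorems *)

Section Persistence.
Variables (K : fieldType) (m : nat) (N : nat -> nat).
Variable X : forall d, 'I_m -> 'M[K]_(N d, N d.+1).
Hypothesis ch : [pchar K] =i pred0.
Hypothesis XC : forall d i j, X d i *m X d.+1 j = X d j *m X d.+1 i.
Hypothesis Xgen : forall d (v : 'rV_(N d.+1)), exists g, v = \sum_i g i *m X d i.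
Hypothesis Xdom : forall d h (v : 'rV_(N d)), h != 0 -> v *m mu X d h = 0 -> v = 0.
Hypothesis Xkos : forall d (g : 'I_m -> 'rV_(N d.+1)),
  \sum_i g i *m X d.+1 i = 0 -> exists G : 'I_m -> 'I_m -> 'rV_(N d),
  (forall i j, G i j = - G j i) /\ forall i, g i = \sum_j G i j *m X d j.

Local Notation mu := (mu X).
Local Notation S1 := (S1 X).

Lemma two_neq0 : 2%:R != 0 :> K.
Proof. by rewrite ((pcharf0P K).1 ch). Qed.

Lemma eq_opp0 (V : lmodType K) (x : V) : x = - x -> x = 0.
Proof.
move=> e; have : 2%:R *: x = 0 by rewrite scaler_nat mulr2n {1}e addNr.
by move/eqP; rewrite scaler_eq0 (negPf two_neq0) => /eqP.
Qed.

Lemma alt_sum0 d (G : 'I_m -> 'I_m -> 'rV_(N d)) :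
  (forall i j, G i j = - G j i) ->
  \sum_i (\sum_j G i j *m X d j) *m X d.+1 i = 0.
Proof.
move=> alt; apply: eq_opp0.
transitivity (\sum_i \sum_j G i j *m X d j *m X d.+1 i).
  by apply: eq_bigr => i _; rewrite mulmx_suml.
rewrite exchange_big /= -sumrN; apply: eq_bigr => j _.
rewrite mulmx_suml -sumrN; apply: eq_bigr => i _.
by rewrite alt !mulNmx -!mulmxA XC.
Qed.

(** The ideal J + (h); in degree 0 there are no multiples of h to add. *)
Definition addh (J : forall d, 'M[K]_(N d)) h d : 'M[K]_(N d) :=
  match d with 0 => J 0%N | d'.+1 => (J d'.+1 + mu d' h)%MS end.

Lemma addh_sub J h d : (J d <= addh J h d)%MS.
Proof. by case: d => //= d; apply: addsmxSl. Qed.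

(** Exactness of the Koszul complex of J at one spot: Tor_1(J, K) vanishes in degree d + 2. *)
Definition koszul (J : forall d, 'M[K]_(N d)) d :=
  forall g : 'I_m -> 'rV_(N d.+1), (forall i, (g i <= J d.+1)%MS) ->
  \sum_i g i *m X d.+1 i = 0 -> exists G : 'I_m -> 'I_m -> 'rV_(N d),
  [/\ forall i j, (G i j <= J d)%MS, forall i j, G i j = - G j i
    & forall i, g i = \sum_j G i j *m X d j].

(** The components of G in J and in (h) are not unique and need not be alternating. Antisymmetrizing
    them with the factor 1/2 makes them so without changing G, and the h-parts collect into e. *)
Lemma koszul_lift (J : forall d, 'M[K]_(N d)) h d (g : 'I_m -> 'rV_(N d.+2)) : koszul (addh J h) d.+1 ->
  (forall i, (g i <= addh J h d.+2)%MS) -> \sum_i g i *m X d.+2 i = 0 ->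
  exists (G : 'I_m -> 'I_m -> 'rV_(N d.+1)) (e : 'I_m -> 'rV_(N d.+1)),
  [/\ forall i j, (G i j <= J d.+1)%MS, forall i j, G i j = - G j i
    & forall i, g i = \sum_j G i j *m X d.+1 j + e i *m mu d.+1 h].
Proof.
move=> kos gJ g0; have [G [GJ Galt gE]] := kos g gJ g0.
have hD (p : 'I_m * 'I_m) : exists u : 'rV_(N d.+1) * 'rV_(N d),
    G p.1 p.2 = u.1 *m J d.+1 + u.2 *m mu d h.
  by have /sub_addsmxP[u ->] := GJ p.1 p.2; exists u.
have {hD} [u uE] := fin_all_exists hD.
pose G' i j := 2%:R^-1 *: ((u (i, j)).1 - (u (j, i)).1) *m J d.+1.
pose s i j := 2%:R^-1 *: ((u (i, j)).2 - (u (j, i)).2).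
have GE i j : G i j = G' i j + s i j *m mu d h.
  rewrite /G' /s -!scalemxAl -scalerDr !mulmxBl addrACA -opprD -!(uE (_, _)) /=.
  by rewrite (Galt j i) opprK -mulr2n -scaler_nat scalerA mulVf ?scale1r // two_neq0.
exists G', (fun i => \sum_j s i j *m X d j); split=> [i j|i j|i].
- exact: submxMl.
- by rewrite /G' -mulNmx -scalerN opprB.
rewrite gE mulmx_suml -big_split; apply: eq_bigr => j _ /=.
by rewrite GE mulmxDl -!mulmxA muC.
Qed.

Lemma koszul_step (J : forall d, 'M[K]_(N d)) h d : h != 0 ->
  (forall v : 'rV_(N d.+1), (v *m mu d.+1 h <= J d.+2)%MS -> (v <= J d.+1)%MS) ->
  (forall i, (J d.+1 *m X d.+1 i <= J d.+2)%MS) ->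
  koszul (addh J h) d.+1 -> koszul J d.+1.
Proof.
move=> h0 inj JX kos g gJ g0.
have [|G [e [GJ Galt gE]]] := koszul_lift kos _ g0.
  by move=> i; apply: submx_trans (gJ i) (addh_sub _ _ _).
have eJ i : (e i <= J d.+1)%MS.
  apply: inj; have -> : e i *m mu d.+1 h = g i - \sum_j G i j *m X d.+1 j.
    by rewrite gE addrC addKr.
  apply: addmx_sub => //; rewrite eqmx_opp; apply: summx_sub => j _.
  exact: submx_trans (submxMr _ (GJ _ _)) (JX j).
have e0 : \sum_i e i *m X d.+1 i = 0.
  apply: (Xdom h0); rewrite mulmx_suml -[RHS]g0.
  have -> : \sum_i g i *m X d.+2 i = \sum_i ((\sum_j G i j *m X d.+1 j) *m X d.+2 i
      + e i *m mu d.+1 h *m X d.+2 i).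
    by apply: eq_bigr => i _; rewrite gE mulmxDl.
  rewrite big_split /= alt_sum0 // add0r; apply: eq_bigr => i _.
  by rewrite -!mulmxA muC.
(* The correction contributes [e i] times h minus [h 0 i] times the sum of the [e j *m X d.+1 j],
   and that sum is 0 by [e0]. *)
exists (fun i j => G i j + (h 0 j *: e i - h 0 i *: e j)); split=> [i j|i j|i].
- by rewrite addmx_sub // addmx_sub ?eqmx_opp // scalemx_sub.
- by rewrite Galt opprD opprB.
transitivity (\sum_j (G i j *m X d.+1 j + (e i *m (h 0 j *: X d.+1 j)
    - h 0 i *: (e j *m X d.+1 j)))); last first.
  by apply: eq_bigr => j _; rewrite mulmxDl mulmxBl -!scalemxAl -scalemxAr.
by rewrite gE big_split /= sumrB -mulmx_sumr -scaler_sumr e0 scaler0 subr0.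
Qed.

(** Write v h as a sum of g_i x_i with g_i in J, and v as a sum of f_i x_i. Then g_i - f_i h is a
    syzygy of J + (h), and its Koszul form gives e with (f_i + e_i) h in J. Injectivity one degree
    lower puts f_i + e_i in J, and v is the sum of the (f_i + e_i) x_i because h cancels. *)
Lemma inj_step (J : forall d, 'M[K]_(N d)) h d : h != 0 -> (J d.+2 <= S1 (J d.+1))%MS ->
  (J d.+3 <= S1 (J d.+2))%MS ->
  (forall i, (J d.+1 *m X d.+1 i <= J d.+2)%MS) ->
  (forall v : 'rV_(N d.+1), (v *m mu d.+1 h <= J d.+2)%MS -> (v <= J d.+1)%MS) ->
  koszul (addh J h) d.+1 ->
  forall v : 'rV_(N d.+2), (v *m mu d.+2 h <= J d.+3)%MS -> (v <= J d.+2)%MS.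
Proof.
move=> h0 J2 J3 JX inj kos v hv.
have [g [gJ gE]] := S1_mem (submx_trans hv J3).
have [f fE] := Xgen v.
pose g' i := g i - f i *m mu d.+1 h.
have g'0 : \sum_i g' i *m X d.+2 i = 0.
  transitivity (\sum_i (g i *m X d.+2 i - f i *m mu d.+1 h *m X d.+2 i)).
    by apply: eq_bigr => i _; rewrite mulmxBl.
  rewrite sumrB -gE {1}fE mulmx_suml; apply/eqP; rewrite subr_eq0; apply/eqP.
  by apply: eq_bigr => i _; rewrite -!mulmxA muC.
have [|G [e [GJ Galt g'E]]] := koszul_lift kos _ g'0.
  move=> i; rewrite addmx_sub ?eqmx_opp //; first exact: submx_trans (gJ i) (addh_sub _ _ _).
  exact: submx_trans (submxMl _ _) (addsmxSr _ _).
pose e' i := f i + e i.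
have e'E i : e' i *m mu d.+1 h = g i - \sum_j G i j *m X d.+1 j.
  rewrite mulmxDl; have := g'E i; rewrite /g' => /eqP.
  rewrite subr_eq => /eqP->; rewrite [RHS]addrC !addrA addNr add0r addrC. by [].
have eJ i : (e' i <= J d.+1)%MS.
  apply: inj; rewrite e'E addmx_sub // eqmx_opp; apply: summx_sub => j _.
  exact: submx_trans (submxMr _ (GJ _ _)) (JX j).
suff -> : v = \sum_i e' i *m X d.+1 i.
  by apply: summx_sub => i _; apply: submx_trans (submxMr _ (eJ i)) (JX i).
apply/eqP; rewrite -subr_eq0; apply/eqP; apply: (Xdom h0).
rewrite mulmxBl gE mulmx_suml.
rewrite -[RHS](alt_sum0 Galt) -sumrB; apply: eq_bigr => i _.
by rewrite -!mulmxA -(muC XC) mulmxA e'E mulmxBl subKr.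
Qed.

Lemma S1_subX d (J : 'M_(N d)) (J' : 'M_(N d.+1)) : (S1 J <= J')%MS ->
  forall i, (J *m X d i <= J')%MS.
Proof. by move/S1_sub. Qed.

Lemma codim_inj d h (J : 'M_(N d)) (J' : 'M_(N d.+1)) :
  (forall v : 'rV_(N d), (v *m mu d h <= J')%MS -> (v <= J)%MS) ->
  (S1 J <= J')%MS -> codim J' = (codim (J' + mu d h)%MS + codim J)%N.
Proof.
move=> inj SJ; rewrite (codim_adds J' (mu d h)); congr (_ + _)%N.
congr (_ - _)%N; apply: eqmx_rank; apply/andP; split.
 by apply/rV_subP => v; rewrite sub_colonP; apply: inj.
rewrite sub_colonP mulmx_sumr; apply: summx_sub => i _; rewrite -scalemxAr.
by apply/scalemx_sub/S1_subX.
Qed.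

Lemma S1_addh (J : forall d, 'M_(N d)) h d : (0 < d)%N -> (J d.+1 == S1 (J d))%MS ->
  (addh J h d.+1 == S1 (addh J h d))%MS.
Proof.
case: d => // d _ /andP[J1 J2]; apply/andP; split.
  rewrite /= addsmx_sub; apply/andP; split.
    apply: submx_trans J1 _; apply/S1_sub => i.
    have /S1_sub/(_ i) := submx_refl (S1 (J d.+1 + mu d h)%MS).
    by apply: submx_trans; apply/submxMr/addsmxSl.
  apply/rV_subP => v /submxP[u ->]; have [g ->] := Xgen u.
  rewrite mulmx_suml; apply: summx_sub => i _; rewrite -mulmxA -(muC XC) mulmxA.
  have /S1_sub/(_ i) := submx_refl (S1 (J d.+1 + mu d h)%MS).
  by apply: submx_trans; apply/submxMr/(submx_trans (submxMl _ _))/addsmxSr.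
apply/S1_sub => i; rewrite addsmxMr addsmx_sub; apply/andP; split.
  by apply: submx_trans (S1_subX J2 i) (addsmxSl _ _).
by rewrite (muC XC) (submx_trans (submxMl _ _)) ?addsmxSr.
Qed.

(** Green's theorem bounds the section J + (h) from above in degree r0, counting along h bounds it
    from below in degree r0 + 1, and Macaulay's bound for the section forces the values of
    [dec_seq a] in both. So induction applies to the section. Counting makes h injective modulo J in
    degree r0, and Koszul exactness of the section carries this upward ([inj_step]) and passes to J
    ([koszul_step]). *)
Theorem persistence a r0 (J : forall d, 'M_(N d)) :
  sorted geq a -> (size a <= r0)%N ->
  (forall d, (r0 <= d)%N -> (J d.+1 == S1 (J d))%MS) ->
  codim (J r0) = mac r0 a -> codim (J r0.+1) = mac r0.+1 a ->
  [/\ forall d, (r0 <= d)%N -> codim (J d) = mac d a,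
      forall d, (r0 <= d)%N -> koszul J d
    & exists h, forall d, (r0 <= d)%N ->
      (forall v : 'rV_(N d), (v *m mu d h <= J d.+1)%MS -> (v <= J d)%MS) /\
      codim (J d.+1 + mu d h)%MS = mac d.+1 (dec_seq a)].
Proof.
have [k] := ubnP (sumn a + size a)%N; elim: k a r0 J => // k IH a r0 J lek sa za JS c0 c1.
case: a sa za c0 c1 lek => [|x a'] sa za c0 c1 lek.
  have full d : (r0 <= d)%N -> codim (J d) = 0%N.
    elim: d => [|d IHd]; first by case: (r0) c0.
    rewrite leq_eqVlt => /predU1P[<-//|]; rewrite ltnS => rd.
    have /andP[_ h] := JS _ rd; apply/eqP; rewrite -leqn0.
    apply: leq_trans (codimS h) _.
    by apply: (macaulay ch XC Xgen (a := [::])) => //; rewrite IHd //; case: (d).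
  split=> [d rd|d rd g gJ /Xkos[G [Galt gE]]|].
  - by rewrite full //; case: (d).
  - by exists G; split=> // i j; apply/codim0/full.
  exists 0 => d rd; split=> [v _|]; first exact/codim0/full.
  have /codimS : (J d.+1 <= J d.+1 + mu d 0)%MS by apply: addsmxSl.
  by rewrite full; [rewrite leqn0 => /eqP->|lia].
case: r0 za JS c0 c1 => // r1 za JS c0 c1; move: sa za c0 c1 lek.
move: {-1}(x :: a') (erefl (x :: a')) => a aE sa za c0 c1 lek.
have [h hle] := green ch XC Xgen sa za c0.
pose J' := addh J h.
have J'S d : (r1 < d)%N -> (J' d.+1 == S1 (J' d))%MS.
  by move=> rd; apply: S1_addh; [lia|exact: JS].
have JX d : (r1 < d)%N -> (S1 (J d) <= J d.+1)%MS by move=> /JS/andP[].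
have [b [sb zb be]] := @mac_rep r1.+1 (codim (J' r1.+1)) isT.
have sD := sorted_dec_seq sa; have zD := leq_trans (size_dec_seq a) za.
have /andP[J'1 _] := J'S _ (ltnSn r1).
have le2 : (codim (J' r1.+2) <= mac r1.+2 b)%N.
  have /andP[_ h2] := J'S _ (ltnSn r1); apply: leq_trans (codimS h2) _.
  exact: (macaulay ch XC Xgen).
have Jcol : (J r1.+1 <= kermx (mu r1.+1 h *m cokermx (J r1.+2)))%MS.
  rewrite sub_colonP mulmx_sumr; apply: summx_sub => i _; rewrite -scalemxAr.
  by apply/scalemx_sub/S1_subX/JX.
have E := codim_adds (J r1.+2) (mu r1.+1 h).
have ge2 : (mac r1.+2 (dec_seq a) <= codim (J' r1.+2))%N.
  have := codimS Jcol; have := mac_diff sa (leqW za).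
  by rewrite c0; move: E; rewrite c1 /J' /=; lia.
have bD : mac r1.+1 b = mac r1.+1 (dec_seq a).
  apply/eqP; rewrite eqn_leq be; apply/andP; split; first exact: hle.
  rewrite leqNgt -be; apply/negP => /(mac_succ_lt sb sD zb zD); lia.
have c2 : codim (J' r1.+2) = mac r1.+2 (dec_seq a).
  have := mac_succ_le sD sb zD (leqW zb); rewrite bD => /(_ (leqnn _)); lia.
have ltk : (sumn (dec_seq a) + size (dec_seq a) < k)%N.
  have h1 (s : seq nat) : (sumn (dec_seq s) + size (dec_seq s) <= sumn s)%N.
    by elim: s => // -[|y] s //=; rewrite -/(dec_seq s); lia.
  by have := h1 a; rewrite -aE /= in lek *; lia.
have bD' : codim (J' r1.+1) = mac r1.+1 (dec_seq a) by rewrite -be.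
have [cJ' kJ' _] := IH _ r1.+1 J' ltk sD zD J'S bD' c2.
  have h0 : h != 0.
    apply/eqP => h0; move: bD'; rewrite /J' /= h0 mu0 => bD'.
    have /codimS : (J r1.+1 + (0 : 'M_(N r1, N r1.+1)) <= J r1.+1)%MS.
      by rewrite addsmx_sub submx_refl sub0mx.
    have pos : (0 < mac r1 a)%N by rewrite -aE /= ltn_addr // bin_gt0 leq_addl.
    by have := mac_diff sa za; rewrite c0 bD'; lia.
  have inj1 : forall v : 'rV_(N r1.+1), (v *m mu r1.+1 h <= J r1.+2)%MS -> (v <= J r1.+1)%MS.
    move=> v; rewrite -sub_colonP => hv; apply: submx_trans hv _.
    apply: codim_eq Jcol _; move: E; rewrite -[codim (_ + _)%MS]/(codim (J' r1.+2)) c1 c2.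
    by have := mac_diff sa (leqW za); rewrite c0; lia.
  have inj d : (r1 < d)%N -> forall v : 'rV_(N d), (v *m mu d h <= J d.+1)%MS -> (v <= J d)%MS.
    elim: d => // d IHd; rewrite ltnS leq_eqVlt => /predU1P[<-//|rd].
    case: d IHd rd => // d IHd rd; apply: (inj_step h0 _ _ _ (IHd rd)) (kJ' _ rd).
    + by have /andP[] := JS _ rd.
    + by have /andP[] := JS _ (ltnW rd : (r1 < d.+2)%N).
    + exact/S1_subX/JX.
  have cJ d : (r1 < d)%N -> codim (J d) = mac d a.
    elim: d => // d IHd; rewrite ltnS leq_eqVlt => /predU1P[<-//|rd].
    rewrite (codim_inj (inj _ rd) (JX _ rd)) IHd //.
    rewrite -[codim (_ + _)%MS]/(codim (J' d.+1)).
    by rewrite cJ'; last exact: ltnW; rewrite addnC -mac_diff //; lia.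
  split=> // [d rd|]; last first.
    exists h => d rd; split; first exact: inj.
    by rewrite -[codim _]/(codim (J' d.+1)) cJ' // ltnW.
  case: d rd => // d rd; apply: (koszul_step h0 (inj _ rd) _ (kJ' _ rd)).
  exact/S1_subX/JX.
Qed.

Definition colon (J : forall d, 'M[K]_(N d)) d : 'M[K]_(N d) :=
  (\bigcap_i kermx (X d i *m cokermx (J d.+1)))%MS.

Lemma colonP (J : forall d, 'M_(N d)) d q (v : 'M_(q, N d)) :
  reflect (forall i, (v *m X d i <= J d.+1)%MS) (v <= colon J d)%MS.
Proof.
apply: (iffP sub_bigcapmxP) => h i; first by rewrite -sub_colonP h.
by rewrite sub_colonP.
Qed.

(** Below d1 these are the v that all monomials of degree d1 - d send into J in degree d1, the
    saturation when J is saturated from d1 on. *)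
Definition sat_at (J : forall d, 'M[K]_(N d)) d1 d := iter (d1 - d) colon J d.

Lemma sat_at_ge J d1 d : (d1 <= d)%N -> sat_at J d1 d = J d.
Proof. by rewrite /sat_at -subn_eq0 => /eqP->. Qed.

Lemma sat_at_lt J d1 d : (d < d1)%N -> sat_at J d1 d = colon (sat_at J d1) d.
Proof.
move=> lt; rewrite {1}/sat_at (_ : (d1 - d)%N = (d1 - d.+1).+1); last by lia.
by rewrite /= {1}/colon /colon /sat_at.
Qed.

(** Where the codimension is given by a, persistence provides an h that is injective modulo J, so in
    those degrees J already equals its colon by the variables. *)
Lemma saturation_ex a (J : forall d, 'M_(N d)) d0 :
  sorted geq a -> (forall d i, (J d *m X d i <= J d.+1)%MS) ->
  (forall d, (d0 <= d)%N -> codim (J d) = mac d a) ->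
  exists (T : forall d, 'M_(N d)) d1,
  [/\ forall d i, (T d *m X d i <= T d.+1)%MS,
      forall d (v : 'rV_(N d)), (forall i, (v *m X d i <= T d.+1)%MS) -> (v <= T d)%MS,
      forall d, (J d <= T d)%MS & forall d, (d1 <= d)%N -> T d = J d].
Proof.
move=> sa JX; wlog ge0 : d0 / (size a <= d0)%N.
  move=> W cJ; apply: (W (maxn (size a) d0)) => [|d]; first by rewrite leq_maxl.
  by rewrite geq_max => /andP[_ /cJ].
move=> cJ.
have JS d : (d0 <= d)%N -> (J d.+1 == S1 (J d))%MS.
  move=> dd; have h : (S1 (J d) <= J d.+1)%MS by apply/S1_sub.
  rewrite h andbT; apply: (codim_eq h); rewrite (cJ d.+1); last exact: leqW.
  by apply: (macaulay ch XC Xgen sa _ (cJ _ dd)); lia.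
have [_ kJ [h hP]] := persistence sa ge0 JS (cJ _ (leqnn _)) (cJ _ (leqnSn _)).
exists (sat_at J d0), d0.
have TX d i : (sat_at J d0 d *m X d i <= sat_at J d0 d.+1)%MS.
  case: (leqP d0 d) => dd; first by rewrite !sat_at_ge ?JX //; lia.
  by move: i; apply/colonP; rewrite -sat_at_lt.
split=> // [d v hv|d|d dd]; last exact: sat_at_ge.
  case: (leqP d0 d) => dd; last by rewrite sat_at_lt //; apply/colonP.
  move: hv; rewrite !sat_at_ge; [move=> hv|lia|lia].
  have [+ _] := hP _ dd; apply; rewrite mulmx_sumr; apply: summx_sub => i _.
  by rewrite -scalemxAr scalemx_sub.
have [e] := ubnP (d0 - d)%N; elim: e d => // e IHe d le.
case: (leqP d0 d) => dd; first by rewrite sat_at_ge.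
rewrite sat_at_lt //; apply/colonP => i; apply: submx_trans (JX _ _) _.
by apply: IHe; lia.
Qed.

(** Saturation extends the injectivity of a generic h modulo J to all degrees. The section J + (h)
    need not be saturated; induction treats its saturation T. As J + (h) lies in T, descending from
    large degrees gives [codim (J d) <= mac d a], and a strict inequality would by Macaulay's bound
    persist in degree d + 1. Hence J + (h) = T above degree [size a], which is the last claim. *)
Theorem regularity a (J : forall d, 'M_(N d)) d0 :
  sorted geq a -> (forall d i, (J d *m X d i <= J d.+1)%MS) ->
  (forall d (v : 'rV_(N d)), (forall i, (v *m X d i <= J d.+1)%MS) -> (v <= J d)%MS) ->
  (forall d, (d0 <= d)%N -> codim (J d) = mac d a) ->
  (forall d, (size a <= d)%N -> codim (J d) = mac d a) /\
  exists h, (forall d (v : 'rV_(N d)), (v *m mu d h <= J d.+1)%MS -> (v <= J d)%MS) /\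
    forall d, (size a <= d)%N -> forall v : 'rV_(N d.+1),
      (forall i, (v *m X d.+1 i <= J d.+2 + mu d.+1 h)%MS) ->
      (v <= J d.+1 + mu d h)%MS.
Proof.
have [k] := ubnP (sumn a + size a)%N.
elim: k a d0 J => // k IH a d0 J lek sa JX Jsat.
case: a sa lek => [|x a'].
  move=> _ _ cJ.
  have full d (v : 'rV_(N d)) : (v <= J d)%MS.
    have [e] := ubnP (d0 - d)%N; elim: e d v => // e IHe d v le.
    case: (leqP d0 d) => [dd|dd]; first by apply: codim0; rewrite cJ //; case: (d).
    by apply: Jsat => i; apply: IHe; lia.
  split=> [d _|]; last first.
    exists 0; split=> [d v _|d _ v _]; first exact: full.
    exact: submx_trans (full _ _) (addsmxSl _ _).
  apply/eqP; rewrite (_ : mac d [::] = 0)%N; last by case: (d).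
  rewrite -leqn0 leq_subLR addn0.
  have /mxrankS : (1%:M <= J d)%MS by apply/rV_subP.
  by rewrite mxrank1.
move=> sa lek cJ; move: sa lek cJ.
move: {-1}(x :: a') (erefl (x :: a')) => a aE sa lek cJ.
wlog ge0 : d0 cJ / (size a <= d0)%N.
  by move=> W; apply: (W (maxn (size a) d0)) => [d|]; rewrite ?leq_maxl // geq_max => /andP[_ /cJ].
have pa : (0 < size a)%N by rewrite -aE.
have JS d : (d0 <= d)%N -> (J d.+1 == S1 (J d))%MS.
  move=> dd; have h : (S1 (J d) <= J d.+1)%MS by apply/S1_sub.
  rewrite h andbT; apply: (codim_eq h); rewrite (cJ d.+1); last exact: leqW.
  by apply: (macaulay ch XC Xgen sa _ (cJ _ dd)); lia.
have [_ kJ [h hP]] := persistence sa ge0 JS (cJ _ (leqnn _)) (cJ _ (leqnSn _)).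
have nzd d (v : 'rV_(N d)) : (v *m mu d h <= J d.+1)%MS -> (v <= J d)%MS.
  have [e] := ubnP (d0 - d)%N; elim: e d v => // e IHe d v le hv.
  case: (leqP d0 d) => [dd|dd]; first by have [+ _] := hP _ dd; apply.
  apply: Jsat => i; apply: IHe; first by lia.
  by rewrite -mulmxA -(muC XC) mulmxA (submx_trans (submxMr _ hv)).
pose J' := addh J h.
have sD := sorted_dec_seq sa.
have J'S d : (d0.+1 <= d)%N -> (J' d.+1 == S1 (J' d))%MS.
  by move=> rd; apply: S1_addh; [lia|apply: JS; lia].
have cJ' d : (d0.+1 <= d)%N -> codim (J' d) = mac d (dec_seq a).
  by case: d => // d rd; have [_] := hP _ rd.
have J'X d i : (J' d *m X d i <= J' d.+1)%MS.
  case: d => [|d] /=; first by apply: submx_trans (addsmxSl _ _).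
  rewrite addsmxMr addsmx_sub (submx_trans (JX _ _) (addsmxSl _ _)) /=.
  by rewrite (muC XC) (submx_trans (submxMl _ _)) ?addsmxSr.
have [T [d1 [TX Tsat J'T TJ']]] := saturation_ex sD J'X cJ'.
have cT d : (maxn d1 d0.+1 <= d)%N -> codim (T d) = mac d (dec_seq a).
  by rewrite geq_max => /andP[dd1 dd0]; rewrite TJ' ?cJ'.
have [|cT' _] := IH _ _ T _ sD TX Tsat cT.
  have h1 (s : seq nat) : (sumn (dec_seq s) + size (dec_seq s) <= sumn s)%N.
    by elim: s => // -[|y] s //=; rewrite -/(dec_seq s); lia.
  by have := h1 a; rewrite -aE /= in lek *; lia.
have cJ'J d : codim (J d.+1) = (codim (J' d.+1) + codim (J d))%N.
  by apply: (codim_inj (nzd d)); apply/S1_sub => i; apply: JX.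
have le1 d : (size a <= d)%N -> (codim (J d) <= mac d a)%N.
  have [e] := ubnP (d0 - d)%N; elim: e d => // e IHe d le da.
  case: (leqP d0 d) => [dd|dd]; first by rewrite cJ.
  have [|l1 l2] := (IHe d.+1 _ (leqW da), leq_trans (size_dec_seq a) (leqW da)); first by lia.
  have l3 := codimS (J'T d.+1); rewrite (cT' _ l2) in l3.
  by have := cJ'J d; have := mac_diff sa (leqW da); lia.
have cJa d : (size a <= d)%N -> codim (J d) = mac d a.
  have [e] := ubnP (d0 - d)%N; elim: e d => // e IHe d le da.
  case: (leqP d0 d) => [dd|dd]; first by rewrite cJ.
  have dpos : (0 < d)%N by lia.
  have [b [sb zb be]] := mac_rep (codim (J d)) dpos.
  have := le1 _ da; rewrite leq_eqVlt => /predU1P[//|]; rewrite -be.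
  move/(mac_succ_lt sb sa zb da) => lt.
  have := macaulay ch XC Xgen sb zb (esym be).
  have /codimS : (S1 (J d) <= J d.+1)%MS by apply/S1_sub => i; apply: JX.
  have := IHe d.+1; lia.
split=> //; exists h; split=> // d da v hv.
have JT' d' : (size a <= d')%N -> (T d'.+1 <= J' d'.+1)%MS.
  move=> da'; apply: codim_eq (J'T _) _; rewrite cT' ?(leq_trans (size_dec_seq a)) ?leqW //.
  by have := cJ'J d'; rewrite !cJa //; [have := mac_diff sa (leqW da'); lia|exact: leqW].
apply: submx_trans (JT' _ da); apply: Tsat => i.
exact: submx_trans (hv i) (J'T d.+2).
Qed.

End Persistence.

(** * Forms as row vectors *)

Notation nmon n d := #|monomials n d|.

Definition mon n d (i : 'I_(nmon n d)) : 'X_{1..n} := bmnm (enum_val i).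

Lemma mdeg_mon n d (i : 'I_(nmon n d)) : mdeg (mon i) = d.
Proof. by have := enum_valP i; rewrite inE => /eqP. Qed.

Lemma mon_inj n d : injective (@mon n d).
Proof. by move=> i j /val_inj /enum_val_inj. Qed.

Lemma monP n d m : mdeg m = d -> exists i, @mon n d i = m.
Proof.
move=> md; have lt : (mdeg m < d.+1)%N by rewrite md.
have mD : BMultinom lt \in monomials n d by rewrite inE /= md.
by exists (enum_rank_in mD (BMultinom lt)); rewrite /mon enum_rankK_in.
Qed.

Section Rows.
Variables (n : nat) (R : comNzRingType).
Implicit Types (f : {mpoly R[n]}).

Definition row_of_form d f : 'rV[R]_(nmon n d) := \row_i f@_(mon i).

Lemma row_of_form_linear d : linear (row_of_form d).
Proof. by move=> a f g; apply/rowP => i; rewrite !mxE mcoeffD mcoeffZ. Qed.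

HB.instance Definition _ d := GRing.isLinear.Build R {mpoly R[n]} 'rV[R]_(nmon n d) _
  (row_of_form d) (@row_of_form_linear d).

Lemma form_of_row_linear d : linear (@form_of_row R n d).
Proof.
move=> a u v; rewrite /form_of_row scaler_sumr -big_split; apply: eq_bigr => i _ /=.
by rewrite !mxE scalerDl scalerA.
Qed.

HB.instance Definition _ d := GRing.isLinear.Build R 'rV[R]_(nmon n d) {mpoly R[n]} _
  (@form_of_row R n d) (@form_of_row_linear d).

Lemma coef_form_of_row d (v : 'rV[R]_(nmon n d)) i : (form_of_row v)@_(mon i) = v 0 i.
Proof.
rewrite /form_of_row raddf_sum (bigD1 i) //= -/(mon i) mcoeffZ mcoeffX eqxx mulr1.
rewrite big1 ?addr0 // => j ji; rewrite -/(mon j) mcoeffZ mcoeffX (inj_eq (@mon_inj n d)).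
by rewrite (negPf ji) mulr0.
Qed.

Lemma form_of_rowK d : cancel (@form_of_row R n d) (row_of_form d).
Proof. by move=> v; apply/rowP => i; rewrite mxE coef_form_of_row. Qed.

Lemma form_of_row_inj d : injective (@form_of_row R n d).
Proof. exact: can_inj (@form_of_rowK d). Qed.

Lemma form_of_row_homog d (v : 'rV[R]_(nmon n d)) : form_of_row v \is d.-homog.
Proof.
apply: rpred_sum => i _; apply: rpredZ; rewrite dhomogX.
exact/eqP/mdeg_mon.
Qed.

Lemma row_of_formK d f : f \is d.-homog -> form_of_row (row_of_form d f) = f.
Proof.
move=> hf; apply/mpolyP => m; have [md|md] := eqVneq (mdeg m) d; last first.
  by rewrite !(dhomog_nemf_coeff _ md) // form_of_row_homog.
by have [i <-] := monP md; rewrite coef_form_of_row mxE.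
Qed.

Definition varmx d (i : 'I_n) : 'M[R]_(nmon n d, nmon n d.+1) :=
  \matrix_(s, t) (mon t == mon s + U_(i))%MM%:R.

Lemma form_of_delta d (s : 'I_(nmon n d)) :
  form_of_row (delta_mx 0 s) = 'X_[mon s] :> {mpoly R[n]}.
Proof.
rewrite /form_of_row (bigD1 s) //= mxE !eqxx scale1r big1 ?addr0 // => j js.
by rewrite mxE (negPf js) andbF scale0r.
Qed.

Lemma form_of_varmx d i (v : 'rV[R]_(nmon n d)) :
  form_of_row (v *m varmx d i) = 'X_i * form_of_row v.
Proof.
rewrite [v in LHS]row_sum_delta [v in RHS]row_sum_delta mulmx_suml !linear_sum mulr_sumr.
apply: eq_bigr => s _; rewrite -scalemxAl !linearZ_LR /= -scalerAr; congr (_ *: _).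
rewrite form_of_delta -rowE -mpolyXD addmC.
have [|t tE] := @monP n d.+1 (mon s + U_(i))%MM; first by rewrite mdegD mdeg1 mdeg_mon addn1.
rewrite -tE -form_of_delta; congr form_of_row; apply/rowP => j; rewrite !mxE -tE eqxx /=.
by rewrite (inj_eq (@mon_inj _ _)).
Qed.

Lemma varmxC d i j : varmx d i *m varmx d.+1 j = varmx d j *m varmx d.+1 i.
Proof.
apply/row_matrixP => s; rewrite !rowE !mulmxA; apply: form_of_row_inj.
by rewrite !form_of_varmx mulrCA.
Qed.

Lemma varmx_gen d (v : 'rV[R]_(nmon n d.+1)) : exists g, v = \sum_i g i *m varmx d i.
Proof.
have h (t : 'I_(nmon n d.+1)) : exists si : 'I_(nmon n d) * 'I_n, mon t = (mon si.1 + U_(si.2))%MM.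
  have : mdeg (mon t) != 0%N by rewrite (mdeg_mon t).
  rewrite mdeg_eq0 => mt0; have [i ti] : exists i, (mon t i != 0)%N.
    apply/existsP; apply: contraNT mt0 => /existsPn h; apply/eqP/mnmP => i.
    by rewrite mnm0E; have := h i; rewrite negbK => /eqP.
  have le : (U_(i) <= mon t)%MM by rewrite lep1mP.
  have [|s sE] := @monP n d (mon t - U_(i))%MM.
    by have := mdeg_mon t; rewrite -{1}(submK le) mdegD mdeg1 addn1 => -[].
  by exists (s, i); rewrite sE submK.
have [si siE] := fin_all_exists h.
exists (fun i => \sum_(t | (si t).2 == i) v 0 t *: delta_mx 0 (si t).1).
rewrite {1}[v]row_sum_delta (partition_big (fun t => (si t).2) xpredT) //=.
apply: eq_bigr => i _; rewrite mulmx_suml; apply: eq_bigr => t /eqP ti.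
rewrite -scalemxAl; congr (_ *: _); apply: form_of_row_inj.
by rewrite form_of_varmx !form_of_delta siE ti mpolyXD mulrC.
Qed.

End Rows.

Section RowsField.
Variables (n : nat) (K : fieldType).

Lemma mderiv_homog d (f : {mpoly K[n]}) i : f \is d.+1.-homog -> f^`M(i) \is d.-homog.
Proof.
move=> hf; rewrite (mpolyE f) linear_sum /= big_seq; apply: rpred_sum => m mf.
rewrite mderivZ mderivX scalerA; have [->|mi] := eqVneq (m i) 0%N.
  by rewrite mulr0 scale0r rpred0.
apply: rpredZ; rewrite dhomogX; apply/eqP.
have le : (U_(i) <= m)%MM by rewrite lep1mP.
by have := dhomog_mf hf mf; rewrite /= -{1}(submK le) mdegD mdeg1 addn1 => -[].
Qed.

Lemma euler d (f : {mpoly K[n]}) : f \is d.-homog ->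
  \sum_i 'X_i * f^`M(i) = d%:R *: f.
Proof.
move=> hf; rewrite {2}(mpolyE f) scaler_sumr.
transitivity (\sum_i \sum_(m <- msupp f) f@_m *: ('X_i * ('X_[m])^`M(i))).
  apply: eq_bigr => i _; rewrite {1}(mpolyE f) linear_sum mulr_sumr; apply: eq_bigr => m _ /=.
  by rewrite mderivZ scalerAr.
rewrite exchange_big /= big_seq [RHS]big_seq; apply: eq_bigr => m mf.
rewrite -scaler_sumr scalerA [d%:R * _]mulrC -scalerA; congr (_ *: _).
have <- := dhomog_mf hf mf; rewrite /= mdegE natr_sum scaler_suml; apply: eq_bigr => i _.
rewrite mderivX -scalerAr; have [->|mi] := eqVneq (m i) 0%N; first by rewrite !scale0r.
by rewrite -mpolyXD addmC submK // lep1mP.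
Qed.

Local Notation X := (@varmx n K).

Definition lform (h : 'rV[K]_n) : {mpoly K[n]} := \sum_i h 0 i *: 'X_i.

Lemma form_of_mu d (h : 'rV_n) (v : 'rV[K]_(nmon n d)) :
  form_of_row (v *m mu X d h) = lform h * form_of_row v.
Proof.
rewrite mulmx_sumr linear_sum mulr_suml; apply: eq_bigr => i _.
by rewrite -scalemxAr linearZ_LR /= form_of_varmx scalerAl.
Qed.

Lemma lform_eq0 h : lform h = 0 -> h = 0.
Proof.
move=> h0; apply/rowP => j; have := congr1 (mcoeff U_(j)) h0.
rewrite mcoeff0 raddf_sum (bigD1 j) //= mcoeffZ mcoeffXU eqxx mulr1 mxE => <-.
rewrite big1 ?addr0 // => i ij; rewrite mcoeffZ mcoeffXU (negPf ij).
by rewrite mulr0.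
Qed.

Lemma varmx_dom d h (v : 'rV[K]_(nmon n d)) : h != 0 -> v *m mu X d h = 0 -> v = 0.
Proof.
move=> h0 /(congr1 (@form_of_row _ _ _)) /eqP.
rewrite form_of_mu linear0 mulf_eq0 => /orP[/eqP/lform_eq0 /eqP|/eqP].
  by rewrite (negPf h0).
by rewrite -(linear0 (@form_of_row K n d)) => /form_of_row_inj.
Qed.

(** Euler's homotopy. Differentiating the relation by x_i turns the sum over j of x_j times the i-th
    derivative of f_j into - f_i, and Euler's formula turns the sum of x_j times the j-th derivative
    of f_i into (d + 1) f_i. The difference is (d + 2) f_i, hence the constant [c]. *)
Lemma varmx_kos d (g : 'I_n -> 'rV[K]_(nmon n d.+1)) : [pchar K] =i pred0 ->
  \sum_i g i *m X d.+1 i = 0 -> exists G : 'I_n -> 'I_n -> 'rV_(nmon n d),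
  (forall i j, G i j = - G j i) /\ forall i, g i = \sum_j G i j *m X d j.
Proof.
move=> ch g0; pose f i := form_of_row (g i).
have f0 : \sum_i 'X_i * f i = 0.
  rewrite -[RHS](linear0 (@form_of_row K n d.+2)) -[in RHS]g0 linear_sum.
  by apply: eq_bigr => i _ /=; rewrite form_of_varmx.
pose c : K := d.+2%:R^-1.
have c0 : d.+2%:R != 0 :> K by rewrite ((pcharf0P K).1 ch).
pose G i j := row_of_form d (c *: ((f i)^`M(j) - (f j)^`M(i))).
exists G; split=> [i j|i]; first by rewrite /G -[RHS]linearN -[in RHS]scalerN opprB.
apply: form_of_row_inj; rewrite linear_sum /= -/(f i).
have GE j : form_of_row (G i j *m X d j) = 'X_j * (c *: ((f i)^`M(j) - (f j)^`M(i))).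
  rewrite form_of_varmx row_of_formK //; apply/rpredZ/rpredB; apply: mderiv_homog.
    exact: form_of_row_homog.
  exact: form_of_row_homog.
rewrite (eq_bigr _ (fun j _ => GE j)).
transitivity (c *: (\sum_j 'X_j * (f i)^`M(j) - \sum_j 'X_j * (f j)^`M(i))); last first.
  by rewrite -sumrB scaler_sumr; apply: eq_bigr => j _; rewrite -scalerAr mulrBr.
rewrite (euler (form_of_row_homog (g i))).
have -> : \sum_j 'X_j * (f j)^`M(i) = - f i.
  have := congr1 (mderiv i) f0; rewrite linear_sum mderiv0.
  rewrite (eq_bigr (fun j => (i == j)%:R *: f j + 'X_j * (f j)^`M(i))); last first.
    move=> j _ /=; rewrite mderivM mderivX mnm1E; congr (_ + _).
    rewrite eq_sym -scalerAl; have [->|ij] := eqVneq i j; last by rewrite !scale0r.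
    by rewrite (_ : (U_(j) - U_(j))%MM = 0%MM) ?mpolyX0 ?mul1r //; apply/mnmP => k; rewrite mnmBE subnn mnm0E.
  rewrite big_split /= (bigD1 i) //= eqxx scale1r big1 ?addr0 => [|j ji].
    by move/eqP; rewrite addrC addr_eq0 => /eqP.
  by rewrite eq_sym (negPf ji) scale0r.
by rewrite opprK -[X in _ + X]scale1r -scalerDl scalerA -(natrD _ d.+1 1) addn1 mulVf // scale1r.
Qed.

End RowsField.

Local Open Scope quotient_scope.

(** * Commutative algebra *)

Definition asbool (P : Prop) : bool := excluded_middle_informative P.

Lemma asboolP P : reflect P (asbool P).
Proof. by rewrite /asbool; case: excluded_middle_informative => ?; constructor. Qed.

Section IdealBasics.
Variables (R : comNzRingType) (I : R -> Prop).
Hypothesis idI : is_ideal I.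

Lemma is_ideal0 : I 0. Proof. by case: idI. Qed.
Lemma is_idealD x y : I x -> I y -> I (x + y). Proof. by case: idI => _ + _; apply. Qed.
Lemma is_idealMl a x : I x -> I (a * x). Proof. by case: idI => _ _; apply. Qed.
Lemma is_idealMr a x : I x -> I (x * a). Proof. by rewrite mulrC; apply: is_idealMl. Qed.
Lemma is_idealN x : I x -> I (- x). Proof. by rewrite -mulN1r; apply: is_idealMl. Qed.
Lemma is_ideal_sum (J : Type) (s : seq J) (P : pred J) F :
  (forall i, P i -> I (F i)) -> I (\sum_(i <- s | P i) F i).
Proof.
by move=> h; elim/big_ind: _ => [|x y|i /h//]; [exact: is_ideal0|exact: is_idealD].
Qed.
End IdealBasics.

Section SubmodBasics.
Variables (R : comNzRingType) (M : lmodType R) (W : M -> Prop).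
Hypothesis sW : is_submod W.
Lemma submod0 : W 0. Proof. by case: sW. Qed.
Lemma submodD x y : W x -> W y -> W (x + y). Proof. by case: sW => _ + _; apply. Qed.
Lemma submodZ a x : W x -> W (a *: x). Proof. by case: sW => _ _; apply. Qed.
Lemma submodN x : W x -> W (- x). Proof. by rewrite -scaleN1r; apply: submodZ. Qed.
Lemma submodB x y : W x -> W y -> W (x - y).
Proof. by move=> hx hy; apply: submodD => //; apply: submodN. Qed.
Lemma submod_sum (J : Type) (s : seq J) (P : pred J) F :
  (forall i, P i -> W (F i)) -> W (\sum_(i <- s | P i) F i).
Proof.
by move=> h; elim/big_ind: _ => [|x y|i /h//]; [exact: submod0|exact: submodD].
Qed.
End SubmodBasics.

Lemma ker_mx_submod (R : comNzRingType) N p (C : 'M[R]_(N, p)) :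
  is_submod (fun v : 'rV_N => v *m C = 0).
Proof.
split=> [|x y hx hy|a x hx]; first by rewrite mul0mx.
  by rewrite mulmxDl hx hy addr0.
by rewrite -scalemxAl hx scaler0.
Qed.

Section Span.
Variables (R : comNzRingType) (M : lmodType R) (S : M -> Prop).

Lemma span_submod : is_submod (span S).
Proof.
split=> [|x y [d [c [s [hs ->]]]] [d' [c' [s' [hs' ->]]]]|a x [d [c [s [hs ->]]]]].
- by exists 0%N, (fun=> 0), (fun=> 0); split=> [[]//|]; rewrite big_ord0.
- exists (d + d')%N, (fun i => match split i with inl j => c j | inr j => c' j end).
  exists (fun i => match split i with inl j => s j | inr j => s' j end); split=> [i|].
    by case: (split i).
  rewrite big_split_ord /=; congr (_ + _); apply: eq_bigr => i _.
    by rewrite (unsplitK (inl i)).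
  by rewrite (unsplitK (inr i)).
exists d, (fun i => a * c i), s; split=> //.
by rewrite scaler_sumr; apply: eq_bigr => i _; rewrite scalerA.
Qed.

Lemma mem_span x : S x -> span S x.
Proof. by exists 1%N, (fun=> 1), (fun=> x); split=> //; rewrite big_ord1 scale1r. Qed.

Lemma span_min (W : M -> Prop) : is_submod W -> (forall x, S x -> W x) ->
  forall x, span S x -> W x.
Proof.
move=> sW h x [d [c [s [hs ->]]]]; apply: submod_sum => // i _.
by apply: submodZ => //; apply: h.
Qed.
End Span.

Section QuotRing.
Variables (R : comNzRingType) (I : R -> Prop).
Hypotheses (idI : is_ideal I) (I1 : ~ I 1).

(** The proofs are arguments so that the ideal structure can be attached to this constant as a
    canonical instance. *)
Definition qpred (_ : is_ideal I) (_ : ~ I 1) : R -> bool := fun x => asbool (I x).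
Local Notation qp := (qpred idI I1).

Lemma qpred_closed : idealr_closed qp.
Proof.
split=> [||a x y]; rewrite -?topredE /= /qpred.
- by apply/asboolP; exact: is_ideal0 idI.
- by apply/negP => /asboolP.
- by move=> /asboolP hx /asboolP hy; apply/asboolP; apply: (is_idealD idI) => //; apply: (is_idealMl idI).
Qed.

HB.instance Definition _ := isIdealr.Build R qp qpred_closed.

Lemma quot_ring : exists (Q : comNzRingType) (phi : {rmorphism R -> Q}),
  (forall q, exists a, q = phi a) /\ forall a, phi a = 0 <-> I a.
Proof.
pose qpi : idealr R := qp; pose Q : comNzRingType := {ideal_quot qpi}.
exists Q, (\pi_Q : {rmorphism R -> Q}); split=> [q|a].
  by exists (repr q); exact: esym (reprK q).
split=> [/eqP|h].
  have -> : (0 : Q) = \pi_Q 0 by rewrite (rmorph0 (\pi_Q : {rmorphism R -> Q})).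
  by rewrite -Quotient.idealrBE subr0 => /asboolP.
rewrite -(rmorph0 (\pi_Q : {rmorphism R -> Q})); apply/eqP.
by rewrite -Quotient.idealrBE subr0; apply/asboolP.
Qed.
End QuotRing.

Lemma localization (A : comNzRingType) (f : A) : (forall m, f ^+ m <> 0) ->
  exists (B : comNzRingType) (phi : {rmorphism A -> B}), is_localization f phi.
Proof.
move=> nil; pose t : {poly A} := f%:P * 'X - 1.
pose I (g : {poly A}) := exists h, g = t * h.
have idI : is_ideal I.
  split=> [|x y [h ->] [h' ->]|a x [h ->]]; first by exists 0; rewrite mulr0.
    by exists (h + h'); rewrite mulrDr.
  by exists (a * h); rewrite -[_ *: _]/(a * (t * h)) mulrCA.
(* The localization is A[X] / (f X - 1). Comparing coefficients in a = (f X - 1) h gives h_i = - f^i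
   a, and h has finitely many coefficients. *)
have kerI a : I a%:P -> exists m, f ^+ m * a = 0.
  case=> h e; have coef i : h`_i = - (f ^+ i * a).
    elim: i => [|i IH].
      have := congr1 (fun p : {poly A} => p`_0) e.
      rewrite /t mulrBl mul1r -mulrA coefB coefC /= coefCM coefXM /= mulr0 sub0r => ->.
      by rewrite expr0 mul1r opprK.
    have := congr1 (fun p : {poly A} => p`_i.+1) e.
    rewrite /t mulrBl mul1r -mulrA coefB coefC /= coefCM coefXM /= IH => /esym/eqP.
    by rewrite subr_eq0 => /eqP <-; rewrite mulrN mulrA exprS.
  exists (size h); apply/eqP; rewrite -oppr_eq0 -coef; apply/eqP.
  exact: nth_default.
have I1 : ~ I 1 by move=> /kerI [m]; rewrite mulr1; apply: nil.
have [B [psi [surj ker]]] := quot_ring idI I1.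
exists B, (psi \o polyC : {rmorphism A -> B}).
have Xf : psi 'X * psi f%:P = 1.
  apply/eqP; rewrite -subr_eq0 -rmorphM -(rmorph1 psi) -rmorphB; apply/eqP/ker.
  by exists 1; rewrite mulr1 mulrC.
split=> [|b|a /= /ker/kerI //]; first by exists (psi 'X).
have [g ->] := surj b; exists (size g), (\sum_(i < size g) g`_i * f ^+ (size g - i)).
rewrite /= -{1}[g]coefK poly_def !rmorph_sum mulr_suml; apply: eq_bigr => i _ /=.
rewrite -mul_polyC !rmorphM !rmorphXn /= -mulrA; congr (_ * _).
have -> : psi f%:P ^+ size g = psi f%:P ^+ (size g - i) * psi f%:P ^+ i.
  by rewrite -exprD subnK // ltnW.
by rewrite mulrCA -exprMn Xf expr1n mulr1.
Qed.

Section FracField.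
Variable Q : comNzRingType.
Hypothesis dom : forall x y : Q, x * y = 0 -> x = 0 \/ y = 0.

Definition dom_type (_ : forall x y : Q, x * y = 0 -> x = 0 \/ y = 0) : Type := Q.
Local Notation T := (dom_type dom).
HB.instance Definition _ := GRing.ComNzRing.on T.

Definition dunit (x : T) : bool := asbool (exists y, y * x = 1).
Definition dinv (x : T) : T :=
  if excluded_middle_informative (exists y, y * x = 1) is left h
  then proj1_sig (constructive_indefinite_description _ h) else x.

Lemma dmulVx : {in dunit, left_inverse 1 dinv *%R}.
Proof.
move=> x; rewrite -topredE /= /dunit /dinv => /asboolP h.
case: excluded_middle_informative => // h'.
by case: constructive_indefinite_description.
Qed.

Lemma dunitPl (x y : T) : y * x = 1 -> dunit x.
Proof. by move=> e; apply/asboolP; exists y. Qed.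

Lemma dinv_out : {in [predC dunit], dinv =1 id}.
Proof.
move=> x; rewrite -topredE /= /dunit /dinv => /asboolP h.
by case: excluded_middle_informative.
Qed.

HB.instance Definition _ := GRing.ComNzRing_hasMulInverse.Build T dmulVx dunitPl dinv_out.

Lemma ddom (x y : T) : x * y = 0 -> (x == 0) || (y == 0).
Proof. by move=> /dom[->|->]; rewrite eqxx ?orbT. Qed.

HB.instance Definition _ := GRing.ComUnitRing_isIntegral.Build T ddom.

Lemma frac_field : exists (K : fieldType) (phi : {rmorphism Q -> K}),
  injective phi /\ forall x, exists a b, phi b != 0 /\ x = phi a / phi b.
Proof.
pose phi : {rmorphism Q -> {fraction T}} := (@FracField.tofrac T : {rmorphism T -> _}).
exists ({fraction T} : fieldType), phi; split=> [a b /eqP|x].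
  by rewrite tofrac_eq => /eqP.
have d0 := denom_ratioP (repr x); exists \n_(repr x), \d_(repr x).
have t0 : phi \d_(repr x) != 0 by rewrite tofrac_eq0.
split=> //; apply: (mulIf t0); rewrite mulfVK //.
rewrite -{1}[x]reprK /phi /=; unlock FracField.tofrac.
rewrite -[LHS]FracField.pi_mul; apply/eqmodP.
rewrite /= FracField.equivfE /FracField.mulf !numden_Ratio ?oner_neq0 ?mulr1 //.
by rewrite mulrC.
Qed.
End FracField.

Local Close Scope quotient_scope.

Lemma ideal_gen_ideal (R : comNzRingType) (S : R -> Prop) : is_ideal (ideal_gen S).
Proof. exact: span_submod. Qed.

Lemma residue_field_exists (A : comNzRingType) (P : A -> Prop) : prime_ideal P ->
  exists (K : fieldType) (phi : {rmorphism A -> K}),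
    is_residue_field phi /\ forall a, phi a = 0 <-> P a.
Proof.
case=> idP P1 PM; have [Q [psi [surj ker]]] := quot_ring idP P1.
have dom (x y : Q) : x * y = 0 -> x = 0 \/ y = 0.
  have [[a ->] [b ->]] := (surj x, surj y); rewrite -rmorphM => /ker/PM[]/ker; tauto.
have [K [iota [inj frac]]] := frac_field dom.
exists K, (iota \o psi : {rmorphism A -> K}); split=> [x|a] /=.
  have [u [v [v0 ->]]] := frac x; have [[a ua] [b vb]] := (surj u, surj v).
  by exists a, b; rewrite /= -ua -vb.
split=> [|/ker->]; last exact: rmorph0.
by rewrite -(rmorph0 iota) => /inj/ker.
Qed.

Lemma ker_prime (A : comNzRingType) (K : fieldType) (phi : {rmorphism A -> K}) :
  prime_ideal (fun a => phi a = 0).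
Proof.
split=> [||x y].
- split=> [|x y hx hy|a x hx]; first exact: rmorph0.
    by rewrite rmorphD hx hy addr0.
  by rewrite -[_ *: _]/(a * x) rmorphM hx mulr0.
- by rewrite rmorph1 => /eqP; rewrite oner_eq0.
by rewrite rmorphM => /eqP; rewrite mulf_eq0 => /orP[]/eqP; tauto.
Qed.

Lemma ideal_gen_seqP (R : comNzRingType) (s : seq R) x : ideal_gen (fun y => y \in s) x ->
  exists c : 'rV_(size s), x = \sum_i c 0 i * s`_i.
Proof.
pose W (x : R) := exists c : 'rV_(size s), x = \sum_i c 0 i * s`_i.
apply: (@span_min R R^o _ W) => [|y ys].
  split=> [|y z [c ->] [c' ->]|a y [c ->]].
  - by exists 0; rewrite big1 // => i _; rewrite mxE mul0r.
  - by exists (c + c'); rewrite -big_split; apply: eq_bigr => i _; rewrite mxE mulrDl.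
  - exists (a *: c); rewrite -[_ *: _]/(a * _) mulr_sumr; apply: eq_bigr => i _.
    by rewrite mxE mulrA.
have ys' : (index y s < size s)%N by rewrite index_mem.
exists (delta_mx 0 (Ordinal ys')); rewrite (bigD1 (Ordinal ys')) //= mxE !eqxx mul1r nth_index //.
by rewrite big1 ?addr0 // => i ne; rewrite mxE (negPf ne) andbF mul0r.
Qed.

Section NoethPrime.
Variables (A : comNzRingType) (noeth : noetherian A).

(** An ideal maximal among those that contain I and no power of f is prime. It exists because
    otherwise choice builds a strictly increasing chain, whose union is finitely generated. *)
Lemma noeth_prime (I : A -> Prop) (f : A) :
  is_ideal I -> (forall m, ~ I (f ^+ m)) ->
  exists P, [/\ prime_ideal P, forall x, I x -> P x & ~ P f].
Proof.
move=> idI nI.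
pose good (J : A -> Prop) := [/\ is_ideal J, forall x, I x -> J x & forall m, ~ J (f ^+ m)].
have [M [[idM IM Mf] Mmax]] : exists M, good M /\ forall J, good J ->
    (forall x, M x -> J x) -> forall x, J x -> M x.
  apply: NNPP => nex.
  have step (J : {J | good J}) : exists J' : {J | good J},
      (forall x, sval J x -> sval J' x) /\ exists x, sval J' x /\ ~ sval J x.
    case: J => J gJ; apply: NNPP => nJ; apply: nex; exists J; split=> // J' gJ' JJ' x J'x.
    by apply: NNPP => nJx; apply: nJ; exists (exist _ J' gJ'); split=> //; exists x.
  pose next J := proj1_sig (constructive_indefinite_description _ (step J)).
  have nextP J : (forall x, sval J x -> sval (next J) x) /\
      exists x, sval (next J) x /\ ~ sval J x.
    by rewrite /next; case: constructive_indefinite_description.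
  have gI : good I by split.
  pose s k := iter k next (exist _ I gI).
  have mono k l x : (k <= l)%N -> sval (s k) x -> sval (s l) x.
    elim: l => [|l IH]; first by rewrite leqn0 => /eqP->.
    by rewrite leq_eqVlt => /predU1P[->//|] /IH h /h; case: (nextP (s l)) => + _; apply.
  pose U x := exists k, sval (s k) x.
  have idU : is_ideal U.
    have idk k : is_ideal (sval (s k)) by case: (svalP (s k)).
    split=> [|x y [k hx] [l hy]|a x [k hx]].
    - by exists 0%N; apply: is_ideal0.
    - exists (maxn k l); apply: (is_idealD (idk _)); first exact: mono (leq_maxl _ _) hx.
      exact: mono (leq_maxr _ _) hy.
    - by exists k; apply: is_idealMl.
  have [gs gsP] := noeth idU.
  have [k hk] : exists k, forall y, y \in gs -> sval (s k) y.
    have : forall y, y \in gs -> U y by move=> y ygs; apply/gsP/mem_span.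
    elim: (gs) => [|y t IH] h; first by exists 0%N.
    have [|k hk] := IH; first by move=> z zt; apply: h; rewrite inE zt orbT.
    have [l hl] := h y (mem_head _ _); exists (maxn k l) => z; rewrite inE => /predU1P[->|/hk].
      exact: mono (leq_maxr _ _) hl.
    exact: mono (leq_maxl _ _).
  have [_ [x [hx nx]]] := nextP (s k); apply: nx.
  have /gsP : U x by exists k.+1.
  by apply: span_min => //; case: (svalP (s k)).
exists M; split=> //; last by have := Mf 1%N; rewrite expr1.
have ext x : ~ M x -> exists m a b, M b /\ f ^+ m = b + a * x.
  move=> nMx; apply: NNPP => nex.
  apply: nMx; pose J z := exists b a, M b /\ z = b + a * x.
  apply: (Mmax J); last by exists 0, 1; rewrite add0r mul1r; split=> //; exact: is_ideal0.
    split=> [|z /IM Mz|m [b [a [Mb e]]]].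
    - split=> [|u v [b [a [Mb ->]]] [b' [a' [Mb' ->]]]|c u [b [a [Mb ->]]]].
      + by exists 0, 0; rewrite mul0r addr0; split=> //; exact: is_ideal0.
      + exists (b + b'), (a + a'); rewrite mulrDl addrACA; split=> //; exact: is_idealD.
      + exists (c * b), (c * a); rewrite -[_ *: _]/(c * _) mulrDr mulrA; split=> //.
        exact: is_idealMl.
    - by exists z, 0; rewrite mul0r addr0.
    - by apply: nex; exists m, a, b.
  by move=> z Mz; exists z, 0; rewrite mul0r addr0.
split=> // [|x y Mxy]; first by have := Mf 0%N; rewrite expr0.
apply: NNPP => /not_or_and[/ext[k [a [b [Mb e]]]] /ext[l [a' [b' [Mb' e']]]]].
apply: (Mf (k + l)%N); rewrite exprD e e' mulrDl; apply: (is_idealD idM); first exact: (is_idealMr idM).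
rewrite mulrDr; apply: (is_idealD idM); first exact (is_idealMl idM _ Mb').
by rewrite mulrACA; exact (is_idealMl idM _ Mxy).
Qed.

Lemma local_global (Q : A -> Prop) (f : A) : is_ideal Q ->
  (forall (K : fieldType) (phi : {rmorphism A -> K}), is_residue_field phi -> phi f != 0 ->
     exists2 delta, Q delta & phi delta != 0) ->
  exists m, Q (f ^+ m).
Proof.
move=> idQ h; apply: NNPP => nex.
have [|P [prP QP nPf]] := noeth_prime idQ (f := f); first by move=> m Qm; apply: nex; exists m.
have [K [phi [res ker]]] := residue_field_exists prP.
have [|d Qd] := h K phi res; first by apply/eqP => /ker.
by move/QP/ker: Qd => ->; rewrite eqxx.
Qed.

(** In the applications Q is the ideal of the c for which an assertion holds after multiplication by
    c. A denominator that is nonzero at each point then yields the assertion itself. *)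
Lemma local_global1 (Q : A -> Prop) : is_ideal Q ->
  (forall (K : fieldType) (phi : {rmorphism A -> K}), is_residue_field phi ->
     exists2 delta, Q delta & phi delta != 0) -> Q 1.
Proof.
move=> idQ h; have [|m] := local_global (f := 1) idQ; last by rewrite expr1n.
by move=> K phi res _; exact: h.
Qed.

Definition fin_gen N (L : 'rV[A]_N -> Prop) :=
  exists t (V : 'M[A]_(t, N)), forall v, L v <-> exists c, v = c *m V.

Lemma noeth_submod N (L : 'rV[A]_N -> Prop) : is_submod L -> fin_gen L.
Proof.
elim: N L => [|N IH] L sL.
  exists 0%N, 0 => v; split=> _; last by rewrite [v]thinmx0; exact: submod0.
  by exists 0; rewrite [v]thinmx0 [RHS]thinmx0.
have {}IH (L0 : 'rV[A]_N -> Prop) : is_submod L0 -> fin_gen L0 by exact: IH.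
move: L sL; rewrite -[N.+1]/(1 + N)%N => L sL.
pose I a := exists2 u : 'rV_N, L (row_mx a%:M u) & True.
have idI : is_ideal I.
  split=> [|x y [u Lu _] [v Lv _]|a x [u Lu _]].
  - by exists 0; rewrite // raddf0 row_mx0; exact: submod0.
  - exists (u + v) => //; rewrite raddfD -add_row_mx; exact: submodD.
  - exists (a *: u) => //; rewrite -[a *: x]/(a * x) scalar_mxM -mul_scalar_mx.
    by rewrite -mul_mx_row mul_scalar_mx; apply: submodZ.
have [s sP] := noeth idI.
have h (i : 'I_(size s)) : exists u : 'rV_N, L (row_mx (s`_i)%:M u).
  have /sP[u Lu _] : ideal_gen (fun y => y \in s) s`_i by apply: mem_span; exact: mem_nth.
  by exists u.
have [w wP] := fin_all_exists h.
pose L0 (u : 'rV_N) := L (row_mx 0 u).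
have sL0 : is_submod L0.
  split=> [|x y hx hy|a x hx]; rewrite /L0.
  - by rewrite row_mx0; exact: submod0.
  - by rewrite -[0]addr0 -add_row_mx; exact: submodD.
  - by rewrite -[0 : 'M_(1,1)](scaler0 _ a) -scale_row_mx; exact: submodZ.
have [t [V VP]] := IH _ sL0.
pose W : 'M[A]_(size s, 1 + N) := \matrix_i row_mx (s`_i)%:M (w i).
exists (size s + t)%N, (col_mx W (row_mx 0 V)) => v; split=> [Lv|[c ->]]; last first.
  rewrite -[c]hsubmxK mul_row_col mul_mx_row mulmx0; apply: (submodD sL).
    rewrite mulmx_sum_row; apply: submod_sum => // i _; apply: submodZ => //.
    by rewrite rowK.
  by apply/VP; exists (rsubmx c).
have /sP/ideal_gen_seqP [c ce] : I (lsubmx v 0 0).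
  by exists (rsubmx v) => //; rewrite -mx11_scalar hsubmxK.
have LcW : L (c *m W).
  rewrite mulmx_sum_row; apply: (submod_sum sL) => i _; apply: (submodZ sL).
  by rewrite rowK.
have lW : lsubmx (c *m W) = lsubmx v.
  rewrite [RHS]mx11_scalar ce; apply/rowP => j; rewrite !ord1 !mxE; apply: eq_bigr => i _.
  by rewrite !mxE split1; case: unliftP => //= j'; rewrite !mxE.
have /VP [c' c'E] : L0 (rsubmx (v - c *m W)).
  rewrite /L0; have -> : row_mx 0 (rsubmx (v - c *m W)) = v - c *m W.
    by rewrite -[RHS]hsubmxK; congr row_mx; rewrite raddfB /= lW subrr.
  exact: (submodB sL).
exists (row_mx c c'); rewrite mul_row_col mul_mx_row mulmx0 -c'E.
rewrite -[v in LHS](subrK (c *m W)) addrC; congr (_ + _).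
rewrite -[LHS]hsubmxK; congr row_mx.
by rewrite raddfB /= lW subrr.
Qed.
End NoethPrime.

Lemma noeth_surj (A B : comNzRingType) (phi : {rmorphism A -> B}) :
  (forall b, exists a, b = phi a) -> noetherian A -> noetherian B.
Proof.
move=> surj noeth I idI; pose J a := I (phi a).
have idJ : is_ideal J.
  split=> [|x y hx hy|a x hx]; rewrite /J.
  - by rewrite rmorph0; exact: is_ideal0.
  - by rewrite rmorphD; exact: is_idealD.
  - by rewrite -[_ *: _]/(a * x) rmorphM; exact: is_idealMl.
have [s sP] := noeth J idJ; exists [seq phi x | x <- s] => b; split=> [Ib|].
  have [a ba] := surj b; subst b.
  have /sP/ideal_gen_seqP[c ->] : J a by [].
  rewrite rmorph_sum; apply: (is_ideal_sum (ideal_gen_ideal _)) => i _.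
  rewrite rmorphM; apply: (is_idealMl (ideal_gen_ideal _)); apply: mem_span.
  by apply: map_f; apply: mem_nth.
apply: span_min => // y /mapP[x xs ->]; apply/sP.
exact: mem_span.
Qed.

Theorem hilbert_basis (A : comNzRingType) : noetherian A -> noetherian {poly A}.
Proof.
move=> noeth I idI.
(* The coefficient at a bound of the degree, possibly 0, replaces the leading coefficient, so sums
   need no case distinction on cancellation. *)
pose L a := exists f d, [/\ I f, forall i, (d < i)%N -> f`_i = 0 & f`_d = a].
have idL : is_ideal L.
  split=> [|x y [f [d [If fd <-]]] [g [e [Ig ge <-]]]|a x [f [d [If fd <-]]]].
  - exists 0, 0%N; split=> [|i _|]; rewrite ?coef0 //; exact: is_ideal0.
  - exists (f * 'X^e + g * 'X^d), (d + e)%N; split=> [|i lt|].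
    + by apply: (is_idealD idI); apply: (is_idealMr idI).
    + rewrite coefD !coefMXn fd ?ge ?if_same ?addr0 //; lia.
    + rewrite coefD !coefMXn addnK addKn; case: ltnP => ?; first lia.
      by case: ltnP => ?; first lia.
  - exists (a%:P * f), d; split=> [|i lt|]; first exact: is_idealMl.
      by rewrite coefCM fd ?mulr0.
    by rewrite coefCM.
have [s sP] := noeth L idL.
have h (i : 'I_(size s)) : exists fd : {poly A} * nat,
    [/\ I fd.1, forall j, (fd.2 < j)%N -> fd.1`_j = 0 & fd.1`_fd.2 = s`_i].
  have /sP[f [d hf]] : ideal_gen (fun y => y \in s) s`_i by apply: mem_span; exact: mem_nth.
  by exists (f, d).
have [F FP] := fin_all_exists h.
pose D := (\sum_i (F i).2)%N.
have leD i : ((F i).2 <= D)%N by rewrite /D (bigD1 i) //= leq_addr.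
pose M (v : 'rV[A]_D) := I (rVpoly v).
have sM : is_submod M.
  split=> [|x y hx hy|a x hx]; rewrite /M.
  - by rewrite linear0; exact: is_ideal0.
  - by rewrite linearD; exact: is_idealD.
  - by rewrite linearZ_LR /= -mul_polyC; exact: is_idealMl.
have [t [V VP]] := noeth_submod noeth sM.
pose gs := [seq (F i).1 | i : 'I_(size s)] ++ [seq rVpoly (row j V) | j : 'I_t].
exists gs => f; pose G := ideal_gen (fun y => y \in gs).
have idG : is_ideal G by exact: ideal_gen_ideal.
split; last first.
  apply: span_min => // y; rewrite mem_cat => /orP[] /mapP[i _ ->].
    by have [] := FP i.
  by apply/VP; exists (delta_mx 0 i); rewrite -rowE.
have [e] := ubnP (size f); elim: e f => // e IH f lef If.
case: (leqP (size f) D) => [fD|fD].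
  have /VP[c ce] : M (poly_rV f) by rewrite /M poly_rV_K.
  rewrite -(poly_rV_K fD) ce mulmx_sum_row linear_sum.
  apply: (is_ideal_sum idG) => j _; rewrite linearZ_LR /= -mul_polyC.
  apply: (is_idealMl idG); apply: mem_span; rewrite mem_cat; apply/orP; right.
  by apply/mapP; exists j; rewrite ?mem_enum.
have f0 : size f = (size f).-1.+1 by lia.
have /sP/ideal_gen_seqP[c ce] : L (f`_(size f).-1).
  exists f, (size f).-1; split=> // i lt; by apply: nth_default; rewrite f0.
pose g := \sum_i (c 0 i)%:P * (F i).1 * 'X^((size f).-1 - (F i).2).
have gG : G g.
  apply: (is_ideal_sum idG) => i _; apply: (is_idealMr idG); apply: (is_idealMl idG).
  apply: mem_span; rewrite mem_cat; apply/orP; left.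
  by apply/mapP; exists i; rewrite ?mem_enum.
have gI : I g.
  by apply: (is_ideal_sum idI) => i _; apply: (is_idealMr idI); apply: (is_idealMl idI); have [] := FP i.
rewrite -(subrK g f); apply: (is_idealD idG) => //; apply: IH; last first.
  by apply: (is_idealD idI) => //; apply: (is_idealN idI).
suff le : (size (f - g)%R <= (size f).-1)%N.
  by apply: leq_trans (_ : (size f).-1.+1 <= e)%N; rewrite ?ltnS // -f0.
apply/leq_sizeP => j; rewrite leq_eqVlt coefB => /predU1P[<-|lt].
  rewrite ce coef_sum -sumrB big1 // => i _.
  rewrite -mulrA coefCM coefMXn; have [_ _ <-] := FP i.
  have := leD i; case: ltnP => ? ?; first lia.
  by rewrite subKn ?subrr //; lia.
rewrite nth_default; last by rewrite f0.
rewrite coef_sum big1 ?subrr // => i _; rewrite -mulrA coefCM coefMXn.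
have [_ Fz _] := FP i; case: ltnP => ?; first by rewrite mulr0.
by rewrite Fz ?mulr0 //; have := leD i; lia.
Qed.

Theorem noeth_mpoly (A : comNzRingType) n : noetherian A -> noetherian {mpoly A[n]}.
Proof.
move=> noeth; elim: n => [|n IH].
  apply: (@noeth_surj A _ (@mpolyC 0 A : {rmorphism _ -> _})) => // p.
  exists p@_0; apply/mpolyP => m; rewrite mcoeffC.
  have -> : m = 0%MM by apply/mnmP; case.
  by rewrite eqxx mulr1.
pose w : {rmorphism {mpoly A[n]} -> {mpoly A[n.+1]}} := @mwiden n A.
have cw : commr_rmorph w ('X_ord_max) by move=> x; exact: mulrC.
pose psi : {rmorphism {poly {mpoly A[n]}} -> {mpoly A[n.+1]}} := horner_morph cw.
apply: (@noeth_surj _ _ psi); last exact: hilbert_basis.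
pose im p := exists q, p = psi q.
have imD p q : im p -> im q -> im (p + q).
  by move=> [p' ->] [q' ->]; exists (p' + q'); rewrite rmorphD.
have imM p q : im p -> im q -> im (p * q).
  by move=> [p' ->] [q' ->]; exists (p' * q'); rewrite rmorphM.
have imw p : im (w p) by exists p%:P; rewrite [psi _]horner_morphC.
have imC c : im c%:MP by rewrite -(mwidenC n c); exact: imw.
have imX i : im 'X_i.
  case: (unliftP ord_max i) => [j|] ->; last by exists 'X; rewrite [psi _]horner_morphX.
  have -> : 'X_(lift ord_max j) = w 'X_j :> {mpoly A[n.+1]}.
    rewrite [w _]mwidenX mnmwiden1; congr 'X_[U_(_)]; apply: val_inj => /=.
    by rewrite /bump leqNgt ltn_ord.
  exact: imw.
move=> p; rewrite (mpolyE p).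
elim/big_ind: _ => [|x y|m _]; [by exists 0; rewrite rmorph0|exact: imD|].
rewrite -mul_mpolyC; apply: (imM) => //; rewrite mpolyXE_id.
elim/big_ind: _ => [|x y|i _]; [by exists 1; rewrite rmorph1|exact: imM|].
elim: (m i) => [|k IHk]; first by rewrite expr0; exists 1; rewrite rmorph1.
by rewrite exprS; apply: (imM).
Qed.

(** * Submodules of free modules near a point of the spectrum *)

Lemma noeth_field (K : fieldType) : noetherian K.
Proof.
move=> I idI; case: (classic (exists2 x, I x & x != 0)) => [[x Ix x0]|nI].
  exists [:: 1] => y; split=> _.
    by exists 1%N, (fun=> y), (fun=> 1); split=> [i|]; rewrite ?mem_head // big_ord1 [RHS]mulr1.
  by rewrite -[y](mulfVK x0); apply: is_idealMl.
exists [::] => y; split=> [Iy|].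
  have -> : y = 0 by apply: NNPP => /eqP y0; apply: nI; exists y.
  exact: is_ideal0 (ideal_gen_ideal _).
by apply: span_min => // z; rewrite in_nil.
Qed.

Lemma subspace_mx (K : fieldType) N (W : 'rV[K]_N -> Prop) : is_submod W ->
  exists M : 'M[K]_N, forall w, W w <-> (w <= M)%MS.
Proof.
move=> /(noeth_submod (@noeth_field K))[t [V VP]]; exists <<V>>%MS => w.
rewrite VP genmxE; split=> [[c ->]|/submxP//]; exact: submxMl.
Qed.

Section Lift.
Variables (A : comNzRingType) (K : fieldType) (phi : {rmorphism A -> K}).
Hypothesis res : is_residue_field phi.

Lemma lift_mx a b (M : 'M[K]_(a, b)) :
  exists c M', phi c != 0 /\ map_mx phi M' = phi c *: M.
Proof.
have h (ij : 'I_a * 'I_b) : exists nd : A * A, phi nd.2 != 0 /\ M ij.1 ij.2 * phi nd.2 = phi nd.1.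
  by have [n [d [d0 ->]]] := res (M ij.1 ij.2); exists (n, d); rewrite divfK.
have [nd ndP] := fin_all_exists h.
exists (\prod_ij (nd ij).2).
exists (\matrix_(i, j) ((nd (i, j)).1 * \prod_(ij | ij != (i, j)) (nd ij).2)); split.
  by rewrite rmorph_prod; apply/prodf_neq0 => ij _; case: (ndP ij).
apply/matrixP => i j; rewrite !mxE rmorphM.
have [_ /= <-] := ndP (i, j).
rewrite [in RHS](bigD1 (i, j)) //= rmorphM; ring.
Qed.

(** The K-span of the image of L: over a residue field one denominator b clears all coefficients of
    a linear combination. *)
Definition fibre_pred N (L : 'rV[A]_N -> Prop) (w : 'rV[K]_N) :=
  exists b v, [/\ phi b != 0, L v & phi b *: w = map_mx phi v].

(* The image of L in K^N as a matrix; the choice exists by fibreP when phi is a residue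
   field and L a submodule, and is junk otherwise. *)
Definition fibre N (L : 'rV[A]_N -> Prop) : 'M[K]_N :=
  epsilon (inhabits 0) (fun M : 'M[K]_N => forall w, fibre_pred L w <-> (w <= M)%MS).

Lemma fibreP N (L : 'rV[A]_N -> Prop) : is_submod L ->
  forall w, (w <= fibre L)%MS <-> fibre_pred L w.
Proof.
move=> sL w; apply: iff_sym; move: w; apply: (epsilon_spec (inhabits 0)
  (fun M : 'M[K]_N => forall w, fibre_pred L w <-> (w <= M)%MS)).
apply: subspace_mx; split=> [|w w' [b [v [b0 Lv e]]] [b' [v' [b0' Lv' e']]]|x w [b [v [b0 Lv e]]]].
- by exists 1, 0; split; rewrite ?rmorph1 ?oner_neq0 ?raddf0 ?scaler0 //; exact: submod0.
- exists (b * b'), (b' *: v + b *: v'); rewrite rmorphM mulf_neq0 //; split=> //.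
    by apply: (submodD sL); apply: (submodZ sL).
  by rewrite map_mxD !map_mxZ -e -e' !scalerA scalerDr mulrC.
have [n [d [d0 ->]]] := res x.
exists (b * d), (n *: v); rewrite rmorphM mulf_neq0 //; split=> //; first exact: submodZ.
rewrite map_mxZ -e !scalerA; congr (_ *: _).
by rewrite -mulrA [phi d * _]mulrC divfK // mulrC.
Qed.

Lemma mem_fibre N (L : 'rV[A]_N -> Prop) v : is_submod L -> L v ->
  (map_mx phi v <= fibre L)%MS.
Proof. by move=> sL Lv; apply/fibreP => //; exists 1, v; rewrite rmorph1 oner_neq0 scale1r. Qed.

(* Near the point phi, L is the kernel of the surjection C, split by X up to d:
   the denominator-free form of "L is locally a direct summand of corank p". *)
Definition locpres N p (L : 'rV[A]_N -> Prop) :=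
  exists (C : 'M[A]_(N, p)) (X : 'M[A]_(p, N)) (d : A),
  [/\ phi d != 0, X *m C = d%:M, forall v, L v -> v *m C = 0
    & forall v, v *m C = 0 -> L (d *: v)].

Lemma locpres_mk N p (L : 'rV[A]_N -> Prop) (C : 'M[A]_(N, p)) X d1 d2 d3 :
  is_submod L -> phi d1 != 0 -> phi d2 != 0 -> phi d3 != 0 -> X *m C = d1%:M ->
  (forall v, L v -> d3 *: (v *m C) = 0) -> (forall v, v *m C = 0 -> L (d2 *: v)) ->
  locpres p L.
Proof.
move=> sL d10 d20 d30 XC LC CL; exists (d3 *: C), (d2 *: X), (d1 * d2 * d3); split.
- by rewrite !rmorphM !mulf_neq0.
- rewrite -scalemxAl -scalemxAr XC scalerA scale_scalar_mx; congr (_%:M); ring.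
- by move=> v /LC; rewrite scalemxAr.
move=> v; rewrite -scalemxAr scalemxAl => /CL; rewrite scalerA => h.
by rewrite -mulrA -scalerA; apply: submodZ.
Qed.

Lemma locpres_local N p (L L' : 'rV[A]_N -> Prop) s s' : is_submod L -> is_submod L' ->
  phi s != 0 -> phi s' != 0 ->
  (forall v, L v -> L' (s *: v)) -> (forall v, L' v -> L (s' *: v)) ->
  locpres p L -> locpres p L'.
Proof.
move=> sL sL' s0 s0' LL' L'L [C [X [d [d0 XC LC CL]]]].
apply: (@locpres_mk _ _ _ C X d (s * d) s') => //; first by rewrite rmorphM mulf_neq0.
  by move=> v /L'L/LC; rewrite scalemxAl.
by move=> v /CL/LL'; rewrite scalerA.
Qed.

(** The matrix [d%:M - C *m X] is d times the projection onto the kernel of C along the rows of X.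
    It corrects a lift of a vector killed by C over K to one killed by C over A. *)
Lemma locpres_fibre N p (L : 'rV[A]_N -> Prop) (C : 'M[A]_(N, p)) X d : is_submod L ->
  phi d != 0 -> X *m C = d%:M -> (forall v, L v -> v *m C = 0) ->
  (forall v, v *m C = 0 -> L (d *: v)) ->
  (fibre L :=: kermx (map_mx phi C))%MS.
Proof.
move=> sL d0 XC LC CL; apply/eqmxP/andP; split; apply/rV_subP => w.
  move/fibreP => /(_ sL)[b [v [b0 /LC vC e]]]; apply/sub_kermxP.
  apply: (scalerI b0); rewrite scalemxAl e scaler0 -(map_mx0 phi) -vC.
  by rewrite map_mxM.
move/sub_kermxP => wC; have [c [w' [c0 w'E]]] := lift_mx w.
apply/fibreP => //; exists (c * d * d), (d *: (w' *m (d%:M - C *m X))).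
rewrite !rmorphM !mulf_neq0 //; split=> //.
  apply: CL; rewrite -mulmxA mulmxBl -mulmxA XC mul_scalar_mx mul_mx_scalar subrr.
  by rewrite mulmx0.
rewrite map_mxZ map_mxM map_mxB w'E map_scalar_mx map_mxM -scalemxAl mulmxBr mulmxA wC.
by rewrite mul0mx subr0 mul_mx_scalar !scalerA; congr (_ *: _); ring.
Qed.

Lemma locpres_codim N p (L : 'rV[A]_N -> Prop) : is_submod L -> locpres p L ->
  codim (fibre L) = p.
Proof.
move=> sL [C [X [d [d0 XC LC CL]]]].
have rC : \rank (map_mx phi C) = p.
  apply/eqP; rewrite eqn_leq rank_leq_col.
  have e : map_mx phi X *m map_mx phi C *m (phi d)^-1%:M = 1%:M.
    by rewrite -map_mxM XC map_scalar_mx -scalar_mxM divff.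
  have := mxrankM_maxl (map_mx phi X *m map_mx phi C) (phi d)^-1%:M.
  rewrite e mxrank1 => /leq_trans-> //; exact: mxrankM_maxr.
rewrite /codim (locpres_fibre sL d0 XC LC CL) mxrank_ker rC subKn //.
by rewrite -{1}rC rank_leq_row.
Qed.

Lemma row_base_ex N q (M : 'M[K]_N) : \rank M = q ->
  exists Y : 'M_(q, N), (Y :=: M)%MS.
Proof. by move=> <-; exists (row_base M); exact: eq_row_base. Qed.

Lemma frame N q p (L : 'rV[A]_N -> Prop) (X : 'M[A]_(p, N)) :
  is_submod L -> \rank (fibre L) = q -> row_full (fibre L + map_mx phi X)%MS ->
  exists G : 'M[A]_(q, N), [/\ forall i, L (row i G), (fibre L <= map_mx phi G)%MS
    & row_full (col_mx (map_mx phi G) (map_mx phi X))].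
Proof.
move=> sL rL full; have [Y YE] := row_base_ex rL.
have h i : exists bv : A * 'rV_N, [/\ phi bv.1 != 0, L bv.2 & phi bv.1 *: row i Y = map_mx phi bv.2].
  have /fibreP : (row i Y <= fibre L)%MS by rewrite -YE row_sub.
  by move=> /(_ sL)[b [v ?]]; exists (b, v).
have [bv bvP] := fin_all_exists h.
pose G := \matrix_i (bv i).2.
have YG : (Y <= map_mx phi G)%MS.
  apply/row_subP => i; have [b0 _ e] := bvP i.
  have -> : row i Y = (phi (bv i).1)^-1 *: row i (map_mx phi G).
    by rewrite -map_row rowK -e scalerA mulVf // scale1r.
  by rewrite scalemx_sub // row_sub.
exists G; split=> [i||]; [by rewrite rowK; case: (bvP i)|by rewrite -YE|].
rewrite -sub1mx.
move: full; rewrite -!sub1mx => full; apply: submx_trans full _.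
rewrite -addsmxE; apply: addsmxS => //; by rewrite -YE.
Qed.

(* Square determinants are only available for syntactically square blocks. *)
Lemma frame_det q p (L : 'rV[A]_(q + p) -> Prop) (X : 'M[A]_(p, q + p)) :
  is_submod L -> \rank (fibre L) = q -> row_full (fibre L + map_mx phi X)%MS ->
  exists (G : 'M[A]_(q, q + p)) d (Ca : 'M[A]_(q + p, q)) (Cb : 'M[A]_(q + p, p)),
  [/\ (forall i, L (row i G)) /\ (fibre L <= map_mx phi G)%MS,
      phi d != 0, G *m Cb = 0, X *m Cb = d%:M & Ca *m G + Cb *m X = d%:M].
Proof.
move=> sL rL full; have [G [LG GK fG]] := frame sL rL full.
pose T := col_mx G X; exists G, (\det T), (lsubmx (\adj T)), (rsubmx (\adj T)).
have := mul_mx_adj T; rewrite -{1}[\adj T]hsubmxK /T mul_col_row -/T.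
move=> e0; have [_ e1 _ e2] := eq_block_mx (etrans e0 (scalar_mx_block q p (\det T))).
have := mul_adj_mx T; rewrite -{1}[\adj T]hsubmxK {1}/T mul_row_col -/T => e3.
split=> //; rewrite -det_map_mx map_col_mx.
by move: fG; rewrite row_full_unit unitmxE unitfE.
Qed.

(** Nakayama's lemma with denominators. With P the kernel of phi, the hypothesis on v says that L
    meets P A^N in P L near the point. After splitting off a frame G of the fibre, the remaining
    component of the generators V satisfies [S *: (V *m Cb *m X) = Pi *m V] with [Pi] zero at the
    point; so the determinant [ep], nonzero there, kills [V *m Cb]. *)
Lemma locpres_nak N p (L : 'rV[A]_N -> Prop) : is_submod L -> fin_gen L ->
  codim (fibre L) = p ->
  (forall v, L v -> map_mx phi v = 0 -> exists2 s, phi s != 0 &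
     span (fun y => exists a w, [/\ phi a = 0, L w & y = a *: w]) (s *: v)) ->
  locpres p L.
Proof.
move=> sL [t [V VP]] cL nak.
have [q eN] : exists q, N = (q + p)%N by exists (\rank (fibre L)); have := codimE (fibre L); lia.
subst N; have rL : \rank (fibre L) = q by have := codimE (fibre L); lia.
have rC : \rank (fibre L)^C%MS = p by rewrite mxrank_compl rL addKn.
have [XK XKE] := row_base_ex rC; have [c [X [c0 XE]]] := lift_mx XK.
have full : row_full (fibre L + map_mx phi X)%MS.
  rewrite -sub1mx; apply: submx_trans (_ : (1%:M <= fibre L + (fibre L)^C)%MS) _.
    by rewrite sub1mx addsmx_compl_full.
  by apply: addsmxS => //; rewrite XE -XKE eqmx_scale.
have [G [d [Ca [Cb [[LG GK] d0 GCb XCb e]]]]] := frame_det sL rL full.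
have LG' (u : 'rV_q) : L (u *m G).
  by rewrite mulmx_sum_row; apply: (submod_sum sL) => i _; apply: (submodZ sL).
have dE (v : 'rV_(q + p)) : d *: v = v *m Ca *m G + v *m Cb *m X.
  by rewrite -!mulmxA -mulmxDr e mul_mx_scalar.
have LV i : L (row i V) by apply/VP; exists (delta_mx 0 i); rewrite -rowE.
have h i : exists sc : A * 'rV[A]_t, [/\ phi sc.1 != 0, map_mx phi sc.2 = 0 &
    sc.1 *: (row i V *m Cb *m X) = sc.2 *m V].
  have [||s s0 hs] := nak (row i V *m Cb *m X).
  - have -> : row i V *m Cb *m X = d *: row i V - row i V *m Ca *m G.
      by rewrite dE addrC addKr.
    by apply: (submodB sL) => //; apply: (submodZ sL).
  - have /submxP[u ue] := submx_trans (mem_fibre sL (LV i)) GK.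
    by rewrite !map_mxM ue -[u *m _ *m _]mulmxA -map_mxM GCb map_mx0 mulmx0 mul0mx.
  suff [u [u0 ue]] : exists u : 'rV_t, map_mx phi u = 0 /\
      s *: (row i V *m Cb *m X) = u *m V by exists (s, u).
  apply: (span_min (W := fun y => exists u : 'rV_t, map_mx phi u = 0 /\ y = u *m V) _ _ hs)
    => [|y [a [w [a0 /VP[u ->] ->]]]].
    split=> [|x y [c1 [h1 ->]] [c2 [h2 ->]]|a x [c1 [h1 ->]]].
    - by exists 0; rewrite map_mx0 mul0mx.
    - by exists (c1 + c2); rewrite map_mxD h1 h2 addr0 mulmxDl.
    - by exists (a *: c1); rewrite map_mxZ h1 scaler0 scalemxAl.
  by exists (a *: u); rewrite map_mxZ a0 scale0r scalemxAl.
have [sc scP] := fin_all_exists h.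
pose S := \prod_i (sc i).1.
pose Pi : 'M[A]_t := \matrix_i ((\prod_(j | j != i) (sc j).1) *: (sc i).2).
have PiE : S *: (V *m Cb *m X) = Pi *m V.
  apply/row_matrixP => i; rewrite linearZ_LR /= !row_mul rowK.
  have [_ _ ei] := scP i; rewrite -scalemxAl -ei scalerA; congr (_ *: _).
  by rewrite /S (bigD1 i) //= mulrC.
have Pi0 : map_mx phi Pi = 0.
  apply/row_matrixP => i; rewrite -map_row rowK map_mxZ row0.
  by have [_ -> _] := scP i; rewrite scaler0.
pose ep := \det ((S * d)%:M - Pi).
have ep0 : phi ep != 0.
  rewrite /ep -det_map_mx map_mxB Pi0 subr0 map_scalar_mx det_scalar expf_neq0 //.
  rewrite rmorphM mulf_neq0 // rmorph_prod; apply/prodf_neq0 => i _.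
  by have [] := scP i.
have epV : ep *: (V *m Cb) = 0.
  rewrite -mul_scalar_mx -mul_adj_mx -mulmxA mulmxBl mul_scalar_mx.
  suff -> : (S * d) *: (V *m Cb) = Pi *m (V *m Cb) by rewrite subrr mulmx0.
  rewrite [RHS]mulmxA -PiE -scalemxAl -[_ *m X *m _]mulmxA XCb mul_mx_scalar scalerA.
  by [].
apply: (locpres_mk (d1 := d) (d2 := d) (d3 := ep) sL d0 d0 ep0 XCb) => v.
  by case/VP=> c' ->; rewrite -mulmxA scalemxAr epV mulmx0.
by move=> vCb; rewrite dE vCb mul0mx addr0.
Qed.

(** The codimension bound makes the fibres equal, so a frame G lifts into L1. What a vector of L2
    has besides its G-part is a combination of the rows of X killed by C, and [X *m C] is a scalar
    invertible at the point. *)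
Lemma locpres_span N p (L1 L2 : 'rV[A]_N -> Prop) : is_submod L1 -> is_submod L2 ->
  (forall v, L1 v -> L2 v) -> (codim (fibre L1) <= p)%N -> locpres p L2 ->
  exists q s (G : 'M[A]_(q, N)) (Ca : 'M[A]_(N, q)), [/\ (q + p = N)%N, phi s != 0,
    forall i, L1 (row i G) & forall v, L2 v -> s *: v = v *m Ca *m G].
Proof.
move=> sL1 sL2 L12 c1 lp; have c2 := locpres_codim sL2 lp.
have f12 : (fibre L1 <= fibre L2)%MS.
  apply/rV_subP => w /fibreP => /(_ sL1)[b [v [b0 /L12 L2v e]]].
  by apply/fibreP => //; exists b, v.
have f21 : (fibre L2 <= fibre L1)%MS by apply: codim_eq f12 _; rewrite c2.
have {}c1 : codim (fibre L1) = p.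
  by apply/eqP; rewrite eqn_leq c1 -c2 codimS.
case: lp => C [X [d' [d0' XC LC CL]]].
have [q eN] : exists q, N = (q + p)%N by exists (\rank (fibre L1)); have := codimE (fibre L1); lia.
subst N; have rL : \rank (fibre L1) = q by have := codimE (fibre L1); lia.
have full : row_full (fibre L1 + map_mx phi X)%MS.
  have fC := locpres_fibre sL2 d0' XC LC CL.
  rewrite -sub1mx; apply/rV_subP => w _.
  rewrite -(subrK ((phi d')^-1 *: (w *m map_mx phi C *m map_mx phi X)) w).
  apply: addmx_sub_adds; last by rewrite scalemx_sub // submxMl.
  apply: submx_trans f21; rewrite fC; apply/sub_kermxP.
  rewrite mulmxBl -scalemxAl -!mulmxA -map_mxM XC map_scalar_mx mul_mx_scalar.
  by rewrite -scalemxAr scalerA mulVf // scale1r subrr.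
have [G [d [Ca [Cb [[LG GK] d0 GCb XCb e]]]]] := frame_det sL1 rL full.
exists q, (d' * d), G, (d' *: Ca); rewrite rmorphM mulf_neq0 //; split=> // v L2v.
have dE : d *: v = v *m Ca *m G + v *m Cb *m X.
  by rewrite -!mulmxA -mulmxDr e mul_mx_scalar.
have GC : G *m C = 0.
  by apply/row_matrixP => i; rewrite row_mul row0; apply/LC/L12.
have : d' *: (v *m Cb) = 0.
  have := congr1 (mulmx^~ C) dE; rewrite mulmxDl -scalemxAl (LC _ L2v) scaler0.
  by rewrite -!mulmxA GC XC !mulmx0 add0r mulmxA mul_mx_scalar => <-.
rewrite -scalerA dE scalerDr => h; rewrite -scalemxAr -scalemxAl -[RHS]addr0; congr (_ + _).
by rewrite scalemxAl h mul0mx.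
Qed.

Lemma locpres_eq N p (L1 L2 : 'rV[A]_N -> Prop) : is_submod L1 -> is_submod L2 ->
  (forall v, L1 v -> L2 v) -> (codim (fibre L1) <= p)%N -> locpres p L2 ->
  exists2 s, phi s != 0 & forall v, L2 v -> L1 (s *: v).
Proof.
move=> sL1 sL2 L12 c1 /(locpres_span sL1 sL2 L12 c1)[q [s [G [Ca [_ s0 LG h]]]]].
exists s => // v /h ->; rewrite mulmx_sum_row; apply: (submod_sum sL1) => i _.
exact: (submodZ sL1).
Qed.

(** Tor_1 of a free quotient vanishes: the projection [d%:M - C *m X] writes d v as a combination of
    vectors which, up to d, lie in L, and the coefficients are the entries of v, zero at the
    point. *)
Lemma locpres_mod N p (L : 'rV[A]_N -> Prop) v : is_submod L -> locpres p L ->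
  L v -> map_mx phi v = 0 -> exists2 s, phi s != 0 &
     span (fun y => exists a w, [/\ phi a = 0, L w & y = a *: w]) (s *: v).
Proof.
move=> sL [C [X [d [d0 XC LC CL]]]] Lv v0; exists (d * d); first by rewrite rmorphM mulf_neq0.
have -> : d * d *: v = \sum_i v 0 i *: (d *: row i (d%:M - C *m X)).
  have e : d *: v = v *m (d%:M - C *m X).
    by rewrite mulmxBr mulmxA (LC _ Lv) mul0mx subr0 mul_mx_scalar.
  rewrite -scalerA e mulmx_sum_row scaler_sumr; apply: eq_bigr => i _.
  by rewrite !scalerA mulrC.
apply: submod_sum => [|i _]; first exact: span_submod.
apply: mem_span; exists (v 0 i), (d *: row i (d%:M - C *m X)); split=> //.
  by have := congr1 (fun M : 'M_(_, _) => M 0 i) v0; rewrite !mxE.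
apply: CL; rewrite -row_mul mulmxBl -mulmxA XC mul_scalar_mx mul_mx_scalar subrr.
by rewrite row0.
Qed.

(** Exactness at the point extends to a neighbourhood. Y is chosen injective on the image of Phi at
    the point; since the kernel of Psi there lies in that image, [B] is injective at the point and
    split near it up to the determinant [th]. So [Phi *m Y] has the kernel of Phi up to [th]. *)
Lemma locpres_ker N F G p (Phi : 'M[A]_(N, F)) (Psi : 'M[A]_(F, G)) :
  (forall w : 'rV[K]_F, w *m map_mx phi Psi = 0 -> (w <= map_mx phi Phi)%MS) ->
  Phi *m Psi = 0 -> \rank (map_mx phi Phi) = p ->
  locpres p (fun v => v *m Phi = 0).
Proof.
move=> ex PP rP; have [PK [QK PQ]] := mxrank_witness (eq_leq (esym rP)).
have [c [P' [c0 P'E]]] := lift_mx PK; have [c' [Y [c0' YE]]] := lift_mx QK.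
have injY (w : 'rV_F) : (w <= map_mx phi Phi)%MS -> w *m QK = 0 -> w = 0.
  have /submxP[Z ZE] : (map_mx phi Phi <= PK *m map_mx phi Phi)%MS.
    have s : (PK *m map_mx phi Phi <= map_mx phi Phi)%MS by apply: submxMl.
    have /leqifP := mxrank_leqif_sup s; case: (_ <= _)%MS => //.
    by rewrite rP ltnNge (mxrank_witness_le (P := 1%:M) (Q := QK)) // mul1mx.
  case/submxP => u -> h; have uZ : u *m map_mx phi Phi = u *m Z *m (PK *m map_mx phi Phi).
    by rewrite {1}ZE mulmxA.
  by move: h; rewrite uZ -mulmxA PQ mulmx1 => ->; rewrite mul0mx.
pose B := row_mx Y Psi.
have [ZK ZKE] : exists Z, map_mx phi B *m Z = 1%:M.
  apply/row_freeP; rewrite -kermx_eq0; apply/eqP/row_matrixP => i; rewrite row0.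
  have : row i (kermx (map_mx phi B)) *m map_mx phi B = 0 by rewrite -row_mul mulmx_ker row0.
  rewrite {2}/B map_row_mx mul_mx_row -[0]row_mx0 => /eq_row_mx[h1 /ex h2].
  apply: injY => //; apply: (scalerI c0'); rewrite scalemxAr -YE h1.
  by rewrite scaler0.
have [b [Z [b0 ZE]]] := lift_mx ZK.
pose th := \det (B *m Z).
have th0 : phi th != 0.
  rewrite /th -det_map_mx map_mxM ZE -scalemxAr ZKE detZ det1 mulr1.
  exact: expf_neq0.
pose D := \det (P' *m Phi *m Y).
have D0 : phi D != 0.
  rewrite /D -det_map_mx !map_mxM P'E YE -!scalemxAl -scalemxAr PQ !detZ det1 mulr1.
  by rewrite mulf_neq0 ?expf_neq0.
apply: (@locpres_mk _ _ _ (Phi *m Y) (\adj (P' *m Phi *m Y) *m P') D th 1) => //.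
- exact: ker_mx_submod.
- by rewrite rmorph1 oner_neq0.
- by rewrite -mul_adj_mx !mulmxA.
- by move=> v h; rewrite mulmxA h mul0mx scaler0.
move=> v h; have e : v *m Phi *m B = 0.
  by rewrite mul_mx_row -!mulmxA h PP mulmx0 row_mx0.
by rewrite -scalemxAl -mul_mx_scalar -mul_mx_adj !mulmxA e !mul0mx.
Qed.

End Lift.

Lemma locpres_base (A B : comNzRingType) (K K' : fieldType) (phi : {rmorphism A -> K})
    (psi : {rmorphism B -> K'}) (f : {rmorphism A -> B}) N p (L : 'rV[A]_N -> Prop) :
  (forall a, psi (f a) = 0 -> phi a = 0) -> locpres phi p L ->
  locpres psi p (submod_pullback f L).
Proof.
move=> ker [C [X [d [d0 XC LC CL]]]].
have sL : is_submod (submod_pullback f L) by exact: span_submod.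
have fd0 : psi (f d) != 0 by apply: contraNneq d0 => /ker->.
apply: (@locpres_mk _ _ _ _ _ _ (map_mx f C) (map_mx f X) (f d) (f (d * d)) 1) => //.
- by rewrite !rmorphM mulf_neq0.
- by rewrite rmorph1 oner_neq0.
- by rewrite -map_mxM XC map_scalar_mx.
- move=> v; rewrite scale1r; apply: (span_min (W := fun v => v *m map_mx f C = 0)).
    exact: ker_mx_submod.
  by move=> w [u /LC e ->]; rewrite -map_mxM e map_mx0.
move=> v vC; rewrite rmorphM -scalerA.
have -> : f d *: v = v *m map_mx f (d%:M - C *m X).
  by rewrite map_mxB map_mxM map_scalar_mx mulmxBr mulmxA vC mul0mx subr0 mul_mx_scalar.
rewrite mulmx_sum_row scaler_sumr; apply: (submod_sum sL) => i _.
rewrite scalerA mulrC -scalerA; apply: (submodZ sL); apply: mem_span.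
exists (d *: row i (d%:M - C *m X)); last by rewrite map_mxZ map_row.
apply: CL; rewrite -row_mul mulmxBl -mulmxA XC mul_scalar_mx mul_mx_scalar subrr.
by rewrite row0.
Qed.

Lemma common_denom (A : comNzRingType) (K : fieldType) (phi : {rmorphism A -> K})
    (T : finType) (Q : T -> A -> Prop) :
  (forall t a b, Q t a -> Q t (b * a)) -> (forall t, exists2 s, phi s != 0 & Q t s) ->
  exists2 s, phi s != 0 & forall t, Q t s.
Proof.
move=> QM h; have {}h t : exists s, phi s != 0 /\ Q t s by have [s ? ?] := h t; exists s.
have [s sP] := fin_all_exists h; exists (\prod_t s t) => [|t].
  by rewrite rmorph_prod; apply/prodf_neq0 => t _; case: (sP t).
by rewrite (bigD1 t) //= mulrC; apply: QM; case: (sP t).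
Qed.

Section RingMult.
Variables (n : nat).

Lemma map_varmx (A B : comNzRingType) (f : {rmorphism A -> B}) d i :
  map_mx f (@varmx n A d i) = varmx B d i.
Proof. by apply/matrixP => s t; rewrite !mxE rmorph_nat. Qed.

Definition muR (A : comNzRingType) d (h : 'rV[A]_n) : 'M[A]_(nmon n d, nmon n d.+1) :=
  \sum_i h 0 i *: varmx A d i.

Lemma map_muR (A : comNzRingType) (K : fieldType) (f : {rmorphism A -> K}) d h :
  map_mx f (muR d h) = mu (@varmx n K) d (map_mx f h).
Proof.
rewrite /muR /mu raddf_sum; apply: eq_bigr => i _ /=.
by rewrite map_mxZ map_varmx mxE.
Qed.

Lemma muRC (A : comNzRingType) d i (h : 'rV[A]_n) :
  muR d h *m varmx A d.+1 i = varmx A d i *m muR d.+1 h.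
Proof.
rewrite mulmx_suml mulmx_sumr; apply: eq_bigr => j _.
by rewrite -scalemxAl -scalemxAr varmxC.
Qed.

Lemma muZ (K : fieldType) d c (h : 'rV[K]_n) :
  mu (@varmx n K) d (c *: h) = c *: mu (@varmx n K) d h.
Proof.
by rewrite /mu scaler_sumr; apply: eq_bigr => i _; rewrite mxE scalerA.
Qed.
End RingMult.

Section Local.
Variables (A : comNzRingType) (K : fieldType) (phi : {rmorphism A -> K}).
Hypothesis res : is_residue_field phi.

Lemma row_free_det p p' (T : 'M[A]_(p, p')) :
  (forall w : 'rV[K]_p, w *m map_mx phi T = 0 -> w = 0) ->
  exists Z d, phi d != 0 /\ T *m Z = d%:M.
Proof.
move=> inj; have [ZK ZKE] : exists Z, map_mx phi T *m Z = 1%:M.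
  apply/row_freeP; rewrite -kermx_eq0; apply/eqP/row_matrixP => i; rewrite row0.
  by apply: inj; rewrite -row_mul mulmx_ker row0.
have [b [Z [b0 ZE]]] := lift_mx res ZK.
exists (Z *m \adj (T *m Z)), (\det (T *m Z)); split; last by rewrite mulmxA mul_mx_adj.
by rewrite -det_map_mx map_mxM ZE -scalemxAr ZKE detZ det1 mulr1 expf_neq0.
Qed.

(* X *m M *m C' is the map induced by M between the local quotients. *)
Lemma induced_map N N' p p' (L : 'rV[A]_N -> Prop) (L' : 'rV[A]_N' -> Prop)
    (M : 'M[A]_(N, N')) (C : 'M[A]_(N, p)) (X : 'M[A]_(p, N)) d (C' : 'M[A]_(N', p')) :
  X *m C = d%:M -> (forall v, v *m C = 0 -> L (d *: v)) -> (forall v, L' v -> v *m C' = 0) ->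
  (forall v, L v -> L' (v *m M)) ->
  d *: (C *m (X *m M *m C')) = (d * d) *: (M *m C').
Proof.
move=> XC CL LC' LM.
have key : d *: ((d%:M - C *m X) *m (M *m C')) = 0.
  apply/row_matrixP => i; rewrite row0 linearZ_LR /= row_mul mulmxA !scalemxAl.
  apply/LC'/LM/CL; rewrite -row_mul mulmxBl -mulmxA XC.
  by rewrite mul_scalar_mx mul_mx_scalar subrr row0.
apply/esym/eqP; rewrite -subr_eq0 -scalerA -scalerBr -mul_scalar_mx !mulmxA -!mulmxBl.
by rewrite -mulmxA key.
Qed.

(** The induced map of free quotients is injective at the point, hence has a one-sided inverse near
    it, up to a determinant. *)
Lemma inj_local N N' p p' (L : 'rV[A]_N -> Prop) (L' : 'rV[A]_N' -> Prop)
    (M : 'M[A]_(N, N')) : is_submod L -> is_submod L' -> locpres phi p L -> locpres phi p' L' ->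
  (forall v, L v -> L' (v *m M)) ->
  (forall w : 'rV[K]_N, (w *m map_mx phi M <= fibre phi L')%MS -> (w <= fibre phi L)%MS) ->
  exists2 s, phi s != 0 & forall v, L' (v *m M) -> L (s *: v).
Proof.
move=> sL sL' [C [X [d [d0 XC LC CL]]]] [C' [X' [d' [d0' XC' LC' CL']]]] LM inj.
have fL := locpres_fibre res sL d0 XC LC CL.
have fL' := locpres_fibre res sL' d0' XC' LC' CL'.
have [w|Z [t [t0 tE]]] := @row_free_det _ _ (X *m M *m C').
  rewrite !map_mxM !mulmxA => h.
  have : (w *m map_mx phi X <= fibre phi L)%MS.
    by apply: inj; rewrite fL'; apply/sub_kermxP.
  rewrite fL => /sub_kermxP; rewrite -mulmxA -map_mxM XC map_scalar_mx mul_mx_scalar.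
  by move/eqP; rewrite scaler_eq0 (negPf d0) => /eqP.
exists (d * (d * t)); first by rewrite !rmorphM !mulf_neq0.
have e := induced_map XC CL LC' LM.
move=> v /LC' vMC; rewrite -scalerA; apply: CL.
rewrite -scalerA -!scalemxAl -[t *: _]mul_mx_scalar -tE.
have -> : d *: (v *m C *m (X *m M *m C' *m Z)) = v *m (d *: (C *m (X *m M *m C'))) *m Z.
  by rewrite -scalemxAr -scalemxAl !mulmxA.
by rewrite e -scalemxAr mulmxA vMC scaler0 mul0mx.
Qed.

End Local.

Definition ker_span (A : comNzRingType) (K : fieldType) (phi : A -> K) N
    (L : 'rV[A]_N -> Prop) : 'rV[A]_N -> Prop :=
  span (fun y => exists a w, [/\ phi a = 0, L w & y = a *: w]).

(** * Flat families of graded submodules *)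

Section Family.
Variables (n : nat) (A : comNzRingType).
Local Notation X := (@varmx n A).
Variable E : forall d, 'rV[A]_(nmon n d) -> Prop.
Hypothesis noeth : noetherian A.
Hypothesis sE : forall d, is_submod (@E d).
Hypothesis EX : forall d i v, @E d v -> @E d.+1 (v *m X d i).

Lemma EmuR d h v : @E d v -> @E d.+1 (v *m muR d h).
Proof.
move=> Ev; rewrite mulmx_sumr; apply: (submod_sum (@sE _)) => i _.
by rewrite -scalemxAr; apply/(submodZ (@sE _))/EX.
Qed.

Section Fibre.
Variables (K : fieldType) (phi : {rmorphism A -> K}).
Hypothesis res : is_residue_field phi.
Hypothesis ch : [pchar K] =i pred0.
Local Notation XK := (@varmx n K).
Local Notation J := (fun d => fibre phi (@E d)).

Lemma fibreX d i : (J d *m XK d i <= J d.+1)%MS.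
Proof.
apply/rV_subP => w /submxP[u ->]; rewrite mulmxA.
have : (u *m J d <= J d)%MS by apply: submxMl.
move/(fibreP res (@sE d)) => [b [v [b0 Ev e]]].
apply/(fibreP res (@sE _)); exists b, (v *m X d i); split=> //; first exact: EX.
by rewrite scalemxAl e map_mxM map_varmx.
Qed.

Lemma fibre_S1 d : (forall v, @E d.+1 v -> exists g, (forall i, @E d (g i)) /\
    v = \sum_i g i *m X d i) -> (J d.+1 == S1 XK (J d))%MS.
Proof.
move=> gen; apply/andP; split; last by apply/S1_sub => i; apply: fibreX.
apply/rV_subP => w /(fibreP res (@sE _))[b [v [b0 /gen[g [gE ->]] e]]].
have -> : w = \sum_i ((phi b)^-1 *: map_mx phi (g i)) *m XK d i.
  apply: (scalerI b0); rewrite e raddf_sum scaler_sumr; apply: eq_bigr => i _ /=.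
  by rewrite map_mxM map_varmx -scalemxAl scalerA mulfV // scale1r.
by apply: mem_S1 => i; apply/scalemx_sub/mem_fibre.
Qed.

Lemma ker_spanX d i v : ker_span phi (@E d) v -> ker_span phi (@E d.+1) (v *m X d i).
Proof.
apply: (span_min (W := fun v => ker_span phi (@E d.+1) (v *m X d i))).
  have s : is_submod (ker_span phi (@E d.+1)) by exact: span_submod.
  split=> [|x y hx hy|a x hx]; first by rewrite mul0mx; exact: submod0.
    by rewrite mulmxDl; exact: submodD.
  by rewrite -scalemxAl; exact: submodZ.
move=> y [a [w [a0 Ew ->]]]; apply: mem_span; exists a, (w *m X d i).
by rewrite -scalemxAl; split=> //; exact: EX.
Qed.

(* The localization of A^N / E d has no first Tor with the residue field. *)
Definition mod_prop d := forall v, @E d v -> map_mx phi v = 0 ->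
  exists2 s, phi s != 0 & ker_span phi (@E d) (s *: v).

(** Write v as the sum of the g_i x_i. At the point this is a syzygy, hence of Koszul type. Lifting
    the alternating family to E in degree d and subtracting it makes the g_i vanish at the point
    and, up to a denominator, leaves v unchanged. *)
Lemma mod_step d : (forall v, @E d.+2 v -> exists g, (forall i, @E d.+1 (g i)) /\
    v = \sum_i g i *m X d.+1 i) -> koszul XK J d -> mod_prop d.+1 -> mod_prop d.+2.
Proof.
move=> gen kos md v Ev v0; have [g [gE vE]] := gen v Ev.
have [||G [GJ Galt gG]] := kos (fun i => map_mx phi (g i)).
- by move=> i; apply: mem_fibre.
- by rewrite -[RHS]v0 vE raddf_sum; apply: eq_bigr => i _ /=; rewrite map_mxM map_varmx.
have [b b0 hb] : exists2 b, phi b != 0 & forall ij : 'I_n * 'I_n,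
    exists2 w, @E d w & phi b *: G ij.1 ij.2 = map_mx phi w.
  apply: (common_denom (Q := fun ij b => exists2 w, @E d w & phi b *: G ij.1 ij.2 = map_mx phi w)).
    move=> ij b c [w Ew e]; exists (c *: w); first exact: submodZ.
    by rewrite rmorphM -scalerA e map_mxZ.
  by move=> ij; have /(fibreP res (@sE d))[b [w [b0 Ew e]]] := GJ ij.1 ij.2; exists b => //; exists w.
have {}hb ij : exists w, @E d w /\ phi b *: G ij.1 ij.2 = map_mx phi w.
  by have [w] := hb ij; exists w.
have [w wP] := fin_all_exists hb.
(* An alternating lift of 2 b G; the lifts of the single entries need not be alternating. *)
pose u i j := w (i, j) - w (j, i).
have uE i j : @E d (u i j).
  by apply: (submodB (@sE d)); [case: (wP (i, j))|case: (wP (j, i))].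
have uK i j : map_mx phi (u i j) = (phi (b *+ 2)) *: G i j.
  rewrite map_mxB; have [[_ <-] [_ <-]] := (wP (i, j), wP (j, i)); rewrite /=.
  by rewrite (Galt j i) scalerN opprK rmorphMn /= mulr2n scalerDl.
have b20 : phi (b *+ 2) != 0.
  by rewrite rmorphMn /= -mulr_natr mulf_neq0 // ((pcharf0P K).1 ch).
pose g' i := (b *+ 2) *: g i - \sum_j u i j *m X d j.
have g'E i : @E d.+1 (g' i).
  apply: (submodB (@sE _)); first exact: (submodZ (@sE _)).
  by apply: (submod_sum (@sE _)) => j _; apply: EX.
have g'0 i : map_mx phi (g' i) = 0.
  rewrite map_mxB map_mxZ gG scaler_sumr raddf_sum -sumrB big1 // => j _ /=.
  by rewrite map_mxM map_varmx uK scalemxAl subrr.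
have [s s0 hs] : exists2 s, phi s != 0 & forall i, ker_span phi (@E d.+1) (s *: g' i).
  apply: (common_denom (Q := fun i s => ker_span phi (@E d.+1) (s *: g' i))) => [i a c h|i].
    by rewrite -scalerA; apply: (submodZ (span_submod _)).
  exact: md.
exists (s * (b *+ 2)); first by rewrite rmorphM mulf_neq0.
have -> : s * (b *+ 2) *: v = \sum_i (s *: g' i) *m X d.+1 i.
  have alt : \sum_i (\sum_j u i j *m X d j) *m X d.+1 i = 0.
    transitivity (\sum_i \sum_j (w (i, j) *m X d j *m X d.+1 i - w (j, i) *m X d j *m X d.+1 i)).
      apply: eq_bigr => i _; rewrite mulmx_suml; apply: eq_bigr => j _.
      by rewrite mulmxBl mulmxBl.
    transitivity (\sum_i \sum_j w (i, j) *m X d j *m X d.+1 i - \sum_i \sum_j w (j, i) *m X d j *m X d.+1 i).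
      by rewrite -sumrB; apply: eq_bigr => i _; rewrite -sumrB.
    rewrite [X in _ - X]exchange_big /=; apply/eqP; rewrite subr_eq0; apply/eqP.
    by apply: eq_bigr => i _; apply: eq_bigr => j _; rewrite -!mulmxA varmxC.
  transitivity (s *: \sum_i (g' i *m X d.+1 i)); last first.
    by rewrite scaler_sumr; apply: eq_bigr => i _; rewrite scalemxAl.
  rewrite -scalerA; congr (_ *: _).
  rewrite (eq_bigr (fun i => (b *+ 2) *: g i *m X d.+1 i - (\sum_j u i j *m X d j) *m X d.+1 i)).
    by rewrite sumrB alt subr0 vE scaler_sumr; apply: eq_bigr => i _; rewrite scalemxAl.
  by move=> i _; rewrite mulmxBl.
by apply: (submod_sum (span_submod _)) => i _; apply: ker_spanX.
Qed.

Variables (r : nat) (a : seq nat).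
Hypotheses (sa : sorted geq a) (za : (size a <= r)%N).
Hypothesis gen : forall d, (r <= d)%N -> forall v, @E d.+1 v ->
  exists g, (forall i, @E d (g i)) /\ v = \sum_i g i *m X d i.
Hypothesis loc0 : locpres phi (mac r a) (@E r).
Hypothesis cod1 : codim (J r.+1) = mac r.+1 a.
Hypothesis mod1 : mod_prop r.+1.

(** Persistence supplies the ranks of the fibres and their Koszul exactness. The latter carries
    [mod_prop] upward from degree r + 1, and [locpres_nak] converts both into freeness. *)
Lemma flat_family : (forall d, (r <= d)%N -> locpres phi (mac d a) (@E d)) /\
  exists h, forall d, (r <= d)%N ->
    forall v : 'rV_(nmon n d), (v *m mu XK d h <= J d.+1)%MS -> (v <= J d)%MS.
Proof.
have JS d : (r <= d)%N -> (J d.+1 == S1 XK (J d))%MS by move=> rd; apply/fibre_S1/gen.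
have [cJ kJ [h hP]] := persistence ch (@varmxC n K) (@varmx_gen n K) (@varmx_dom n K)
  (fun d g => @varmx_kos n K d g ch) sa za JS (locpres_codim res (@sE r) loc0) cod1.
split; last by exists h => d /hP[].
have md d : (r <= d)%N -> mod_prop d.
  elim: d => [|d IH]; first by rewrite leqn0 => /eqP r0; move: loc0; rewrite r0 => l v; apply: locpres_mod l.
  rewrite leq_eqVlt => /predU1P[<-|]; first by move=> v; apply: locpres_mod loc0.
  rewrite ltnS leq_eqVlt => /predU1P[<-//|rd].
  case: d IH rd => // d IH rd; apply: mod_step (IH _) => //; last exact: ltnW.
    by apply: gen; exact: ltnW.
  exact: kJ.
move=> d rd; apply: locpres_nak => //; [exact: noeth_submod|exact: cJ|exact: md].
Qed.

End Fibre.
End Family.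

(** * Descent of freeness from large degrees to the Gotzmann number *)

Section Descent.
Variables (n : nat) (A : comNzRingType).
Local Notation X := (@varmx n A).
Variable E : forall d, 'rV[A]_(nmon n d) -> Prop.
Hypothesis noeth : noetherian A.
Hypothesis sE : forall d, is_submod (@E d).
Hypothesis EX : forall d i v, @E d v -> @E d.+1 (v *m X d i).

Section AtPoint.
Variables (K : fieldType) (phi : {rmorphism A -> K}).
Hypothesis res : is_residue_field phi.
Hypothesis ch : [pchar K] =i pred0.
Local Notation XK := (@varmx n K).
Local Notation J := (fun d => fibre phi (@E d)).

Lemma mul_local d p p' h :
  locpres phi p (@E d) -> locpres phi p' (@E d.+1) ->
  (forall v : 'rV_(nmon n d), (v *m mu XK d (map_mx phi h) <= J d.+1)%MS -> (v <= J d)%MS) ->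
  exists2 s, phi s != 0 & forall v, @E d.+1 (v *m muR d h) -> @E d (s *: v).
Proof.
move=> l0 l1 inj; apply: (inj_local res (sE d) (sE d.+1) l0 l1).
  by move=> v; apply: EmuR.
by move=> w; rewrite map_muR; apply: inj.
Qed.

Lemma lift_dir (h : 'rV[K]_n) (P : 'rV[K]_n -> Prop) : (forall c h, c != 0 -> P h -> P (c *: h)) ->
  P h -> exists h', P (map_mx phi h').
Proof.
move=> PZ Ph; have [c [h' [c0 e]]] := lift_mx res h.
by exists h'; rewrite e; apply: PZ.
Qed.

Variable a : seq nat.
Hypothesis sa : sorted geq a.
Hypothesis Esat : forall d v, (forall i, @E d.+1 (v *m X d i)) -> @E d v.

(** Write M_e for the forms of degree e modulo E. Near the point E in degree d is the kernel of
    multiplication by h from the forms of degree d to M_(d+1). This map continues, by the variables,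
    to copies of M_(d+2) / h M_(d+1). The hypothesis on colons modulo h makes the complex exact in
    the middle at the point, and [locpres_ker] applies. *)
Lemma descend_step d (T : forall d, 'M[K]_(nmon n d)) h :
  (J d.+1 == T d.+1)%MS -> (J d.+2 == T d.+2)%MS ->
  (forall d (v : 'rV_(nmon n d)), (v *m mu XK d (map_mx phi h) <= T d.+1)%MS -> (v <= T d)%MS) ->
  (forall i, (T d *m XK d i <= T d.+1)%MS) ->
  (forall v : 'rV_(nmon n d.+1),
    (forall i, (v *m XK d.+1 i <= T d.+2 + mu XK d.+1 (map_mx phi h))%MS) ->
    (v <= T d.+1 + mu XK d (map_mx phi h))%MS) ->
  locpres phi (mac d.+1 a) (@E d.+1) -> locpres phi (mac d.+2 a) (@E d.+2) ->
  locpres phi (codim (T d)) (@E d).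
Proof.
move=> JT1 JT2 nzd TX tf l1 l2.
have JT1' := eqmxP JT1; have JT2' := eqmxP JT2.
have [s s0 hs] : exists2 s, phi s != 0 & forall v, @E d.+2 (v *m muR d.+1 h) -> @E d.+1 (s *: v).
  by apply: (mul_local l1 l2) => v; rewrite JT1' JT2'; apply: nzd.
case: l1 => C1 [X1 [d1 [d10 XC1 LC1 CL1]]]; case: l2 => C2 [X2 [d2 [d20 XC2 LC2 CL2]]].
have f1 := locpres_fibre res (sE _) d10 XC1 LC1 CL1.
have f2 := locpres_fibre res (sE _) d20 XC2 LC2 CL2.
pose H := @muR n A.
pose hK := map_mx phi h.
pose T' := X1 *m H d.+1 h *m C2.
have [w|Z [t [t0 tE]]] := @row_free_det _ _ _ res _ _ T'.
  rewrite /T' !map_mxM map_muR !mulmxA => hw.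
  have : (w *m map_mx phi X1 <= J d.+1)%MS.
    by rewrite JT1'; apply: nzd; rewrite -JT2' f2; apply/sub_kermxP.
  rewrite f1 => /sub_kermxP; rewrite -mulmxA -map_mxM XC1 map_scalar_mx mul_mx_scalar.
  by move/eqP; rewrite scaler_eq0 (negPf d10) => /eqP.
(* Up to the factor t this is the projection along the image of [T']; it represents the passage to
   M_(d+2) / h M_(d+1). *)
pose Q := t%:M - Z *m T'.
have T'Q : T' *m Q = 0 by rewrite mulmxBr mulmxA tE mul_mx_scalar mul_scalar_mx subrr.
have K1 i := induced_map XC1 CL1 LC2 (fun v => @EX d.+1 i v).
have K2 := induced_map XC1 CL1 LC2 (fun v => @EmuR n A E sE EX d.+1 h v).
rewrite -/(H _ _) -/T' in K2.
pose Phi := H d h *m C1.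
(* The factor [d1] absorbs the denominator of [K1], so that [Phi *m Psi] vanishes exactly. *)
pose Psi := \mxrow_(i < n) (d1 *: (X1 *m X d.+1 i *m C2 *m Q)).
have PP : Phi *m Psi = 0.
  apply/mxrowP => i; rewrite submxrow0 -mul_submxrow mxrowK.
  have -> : Phi *m (d1 *: (X1 *m X d.+1 i *m C2 *m Q)) =
      H d h *m (d1 *: (C1 *m (X1 *m X d.+1 i *m C2))) *m Q.
    by rewrite /Phi -!scalemxAr -scalemxAl !mulmxA.
  have -> : H d h *m (d1 *: (C1 *m (X1 *m X d.+1 i *m C2))) *m Q =
      X d i *m ((d1 * d1) *: (H d.+1 h *m C2)) *m Q.
    by rewrite K1 -!scalemxAr -!scalemxAl !mulmxA muRC.
  have T'Q' : X1 *m (muR d.+1 h *m (C2 *m Q)) = 0 by rewrite !mulmxA.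
  by rewrite -K2 -scalemxAr -scalemxAl -!mulmxA T'Q' !mulmx0 scaler0.
have kerPhi (v : 'rV[K]_(nmon n d)) : v *m map_mx phi Phi = 0 <-> (v <= T d)%MS.
  rewrite /Phi map_mxM map_muR mulmxA; split=> [e|].
    by apply: nzd; rewrite -JT1' f1; apply/sub_kermxP.
  move=> vT; apply/sub_kermxP; rewrite -f1 JT1' mulmx_sumr; apply: summx_sub => i _.
  by rewrite -scalemxAr scalemx_sub // (submx_trans (submxMr _ vT)).
have rPhi : \rank (map_mx phi Phi) = codim (T d).
  have : (kermx (map_mx phi Phi) == T d)%MS.
    apply/andP; split; apply/rV_subP => v; first by move/sub_kermxP/kerPhi.
    by move=> ?; apply/sub_kermxP/kerPhi.
  move/eqmx_rank; rewrite mxrank_ker /codim => <-.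
  by rewrite subKn // rank_leq_row.
have sker : is_submod (fun v : 'rV_(nmon n d) => v *m Phi = 0).
  split=> [|x y hx hy|c x hx]; first by rewrite mul0mx.
    by rewrite mulmxDl hx hy addr0.
  by rewrite -scalemxAl hx scaler0.
have := locpres_ker res _ PP rPhi; move=> lk.
refine (locpres_local (s := s * d1) (s' := 1) sker (sE d) _ _ _ _ _).
- by rewrite rmorphM mulf_neq0.
- by rewrite rmorph1 oner_neq0.
(* If v h lies in E up to [d1], so does every x_i v h; there h cancels up to [s], and saturation
   over A returns v. *)
- move=> v hv; apply: Esat => i; rewrite -scalemxAl -scalerA scalemxAl; apply: hs.
  rewrite -mulmxA -muRC mulmxA -scalemxAl; apply: (EX); apply: CL1.
  by rewrite -mulmxA.
- by move=> v Ev; rewrite scale1r mulmxA; apply: LC1; apply: EmuR.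
apply: lk => w wP.
have mK i : map_mx phi (d1 *: (X1 *m X d.+1 i *m C2 *m Q)) = submxrow (map_mx phi Psi) i.
  rewrite -[in LHS](mxrowK (fun i => d1 *: (X1 *m X d.+1 i *m C2 *m Q)) i) -/Psi.
  by apply/matrixP => x y; rewrite !mxE.
have wQ i : w *m map_mx phi (X1 *m X d.+1 i *m C2 *m Q) = 0.
  apply: (scalerI d10); rewrite scaler0 scalemxAr -map_mxZ mK mul_submxrow wP.
  by rewrite submxrow0.
have : (w *m map_mx phi X1 <= T d.+1 + mu XK d hK)%MS.
  apply: tf => i; set y := w *m map_mx phi X1 *m XK d.+1 i.
  have yQ : phi t *: (y *m map_mx phi C2) = y *m map_mx phi C2 *m map_mx phi Z *m map_mx phi T'.
    have e := wQ i.
    have eQ : map_mx phi Q = (phi t)%:M - map_mx phi Z *m map_mx phi T'.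
      by rewrite map_mxB map_scalar_mx map_mxM.
    rewrite (map_mxM _ (X1 *m X d.+1 i *m C2) Q) (map_mxM _ (X1 *m X d.+1 i) C2) in e.
    rewrite (map_mxM _ X1) map_varmx eQ !mulmxA -/y mulmxBr mul_mx_scalar mulmxA in e.
    by apply/eqP; rewrite -subr_eq0 e.
  pose y' := (phi t)^-1 *: (y *m map_mx phi C2 *m map_mx phi Z *m map_mx phi X1).
  rewrite -(subrK (y' *m mu XK d.+1 hK) y); apply: addmx_sub_adds; last exact: submxMl.
  rewrite /T' !map_mxM map_muR !mulmxA in yQ.
  rewrite -JT2' f2; apply/sub_kermxP; rewrite mulmxBl /y' -!scalemxAl -yQ.
  by rewrite scalerA mulVf // scale1r subrr.
case/sub_addsmxP => u uE.
suff -> : w = ((phi d1)^-1 *: u.2) *m map_mx phi Phi by exact: submxMl.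
apply: (scalerI d10); rewrite -scalemxAl scalerA mulfV // scale1r /Phi map_mxM map_muR mulmxA.
have -> : u.2 *m mu XK d hK *m map_mx phi C1 = w *m map_mx phi X1 *m map_mx phi C1.
  rewrite uE mulmxDl; suff -> : u.1 *m T d.+1 *m map_mx phi C1 = 0 by rewrite add0r.
  by apply/sub_kermxP; rewrite -f1 JT1' submxMl.
by rewrite -mulmxA -map_mxM XC1 map_scalar_mx mul_mx_scalar.
Qed.

(** E is saturated but its fibre J need not be; T is the saturation of J and agrees with it in large
    degrees. Going down, [descend_step] gives J the codimension of T in degree d, so J = T there
    too, which feeds the next step. *)
Theorem descend D0 : (forall d, (D0 <= d)%N -> mod_prop (@E) phi d) ->
  (forall d, (D0 <= d)%N -> codim (J d) = mac d a) ->
  forall d, (size a <= d)%N -> locpres phi (mac d a) (@E d).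
Proof.
move=> md cJ.
have JX d i : (J d *m XK d i <= J d.+1)%MS by apply: fibreX.
have [T [d1 [TX Tsat JT TJ]]] := saturation_ex ch (@varmxC n K) (@varmx_gen n K)
  (@varmx_dom n K) (fun d g => @varmx_kos n K d g ch) sa JX cJ.
pose D := maxn D0 d1.
have DJ d : (D <= d)%N -> T d = J d by rewrite geq_max => /andP[_ /TJ].
have DD d : (D <= d)%N -> (D0 <= d)%N by rewrite geq_max => /andP[].
have cT0 d : (D <= d)%N -> codim (T d) = mac d a by move=> dd; rewrite DJ ?cJ ?DD.
have [cT [hK [nzdK tfK]]] := regularity ch (@varmxC n K) (@varmx_gen n K)
  (@varmx_dom n K) (fun d g => @varmx_kos n K d g ch) sa TX Tsat cT0.
pose good h := (forall d (v : 'rV_(nmon n d)), (v *m mu XK d h <= T d.+1)%MS -> (v <= T d)%MS) /\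
  forall d, (size a <= d)%N -> forall v : 'rV_(nmon n d.+1),
  (forall i, (v *m XK d.+1 i <= T d.+2 + mu XK d.+1 h)%MS) -> (v <= T d.+1 + mu XK d h)%MS.
have [||h [nzd tf]] := @lift_dir hK good; last 1 first.
- suff H d : (size a <= d)%N -> locpres phi (mac d a) (@E d) /\ (J d == T d)%MS.
    by move=> d /H[].
  have [e] := ubnP (D - d)%N; elim: e d => // e IH d le da.
  have step : locpres phi (mac d a) (@E d).
    case: (leqP D d) => dD.
      by apply: (locpres_nak res (sE d)); [exact: noeth_submod|rewrite cJ ?DD|apply: md; exact: DD].
    have [||l1 J1] := IH d.+1; [lia|lia|].
    have [||l2 J2] := IH d.+2; [lia|lia|].
    rewrite -(cT _ da); apply: (descend_step (h := h) (T := T)) => //.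
    by move=> v; apply: tf.
  split=> //; apply/andP; split; first exact: JT.
  by apply: codim_eq (JT d) _; rewrite (cT _ da) (locpres_codim res (sE d) step).
- move=> c h c0 [h1 h2]; split=> [d v|d da v hv].
    by rewrite muZ -scalemxAr eqmx_scale //; apply: h1.
  apply: submx_trans (_ : (_ <= T d.+1 + mu XK d h)%MS) _.
    apply: h2 => // i; apply: submx_trans (hv i) _.
    by rewrite muZ addsmxS // eqmx_scale.
  by rewrite muZ addsmxS // eqmx_scale.
- by split.
Qed.

End AtPoint.

Hypothesis chA : forall (K : fieldType) (phi : {rmorphism A -> K}), [pchar K] =i pred0.
Variable a : seq nat.
Hypothesis sa : sorted geq a.

(** At each point Macaulay's bound limits the codimension of what E generates from degree d, so by
    [locpres_eq] this fills E in degree d + 1 up to a denominator. *)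
Lemma gen_global d : (size a <= d)%N ->
  (forall (K : fieldType) (phi : {rmorphism A -> K}), is_residue_field phi ->
    locpres phi (mac d a) (@E d) /\ locpres phi (mac d.+1 a) (@E d.+1)) ->
  forall v, @E d.+1 v -> exists g, (forall i, @E d (g i)) /\ v = \sum_i g i *m X d i.
Proof.
move=> da loc v Ev; pose L1 v := exists g, (forall i, @E d (g i)) /\ v = \sum_i g i *m X d i.
have sL1 : is_submod L1.
  split=> [|x y [g [gE ->]] [g' [gE' ->]]|c x [g [gE ->]]].
  - exists (fun=> 0); split=> [_|]; first exact: (submod0 (sE _)).
    by rewrite big1 // => i _; rewrite mul0mx.
  - exists (fun i => g i + g' i); split=> [i|]; first exact: (submodD (sE _)).
    by rewrite -big_split; apply: eq_bigr => i _; rewrite mulmxDl.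
  - exists (fun i => c *: g i); split=> [i|]; first exact: (submodZ (sE _)).
    by rewrite scaler_sumr; apply: eq_bigr => i _; rewrite scalemxAl.
rewrite -[v]scale1r -/(L1 _).
apply: (local_global1 noeth (Q := fun c => L1 (c *: v))).
  split=> [|x y hx hy|c x hx]; first by rewrite scale0r; exact: (submod0 sL1).
    by rewrite scalerDl; exact: (submodD sL1).
  by rewrite -[_ *: x]/(c * x) -scalerA; exact: (submodZ sL1).
move=> K phi res; have [l0 l1] := loc K phi res.
have L1E w : L1 w -> @E d.+1 w.
  by move=> [g [gE ->]]; apply: (submod_sum (sE _)) => i _; apply: EX.
have [|s s0 /(_ v Ev) hs] := locpres_eq res sL1 (sE _) L1E _ l1; last by exists s.
have := macaulay (chA phi) (@varmxC n K) (@varmx_gen n K) sa da (locpres_codim res (sE d) l0).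
apply: leq_trans; apply: codimS; apply/S1_sub => i; apply/rV_subP => w /submxP[u ->].
rewrite mulmxA; have : (u *m fibre phi (@E d) <= fibre phi (@E d))%MS by exact: submxMl.
move/(fibreP res (sE d)) => [b [y [b0 Ey e]]].
apply/(fibreP res sL1); exists b, (y *m X d i); split=> //; last first.
  by rewrite scalemxAl e map_mxM map_varmx.
exists (fun j => if j == i then y else 0); split=> [j|]; first by case: eqP => // _; exact: (submod0 (sE _)).
by rewrite (bigD1 i) //= eqxx big1 ?addr0 // => j /negPf->; rewrite mul0mx.
Qed.

(** If all v x_i lie in E, so does v h for a lift of the given linear form, and multiplication by h
    is injective near the point. *)
Lemma sat_global d :
  (forall (K : fieldType) (phi : {rmorphism A -> K}), is_residue_field phi ->
    [/\ locpres phi (mac d a) (@E d), locpres phi (mac d.+1 a) (@E d.+1)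
      & exists h, forall v : 'rV_(nmon n d), (v *m mu (@varmx n K) d h <= fibre phi (@E d.+1))%MS ->
        (v <= fibre phi (@E d))%MS]) ->
  forall v, (forall i, @E d.+1 (v *m X d i)) -> @E d v.
Proof.
move=> loc v hv; rewrite -[v]scale1r.
apply: (local_global1 noeth (Q := fun c => @E d (c *: v))).
  split=> [|x y hx hy|c x hx]; first by rewrite scale0r; exact: (submod0 (sE _)).
    by rewrite scalerDl; exact: (submodD (sE _)).
  by rewrite -[_ *: x]/(c * x) -scalerA; exact: (submodZ (sE _)).
move=> K phi res; have [l0 l1 [hK hKP]] := loc K phi res.
have [|h hP] := lift_dir res (P := fun h => forall v : 'rV_(nmon n d),
  (v *m mu (@varmx n K) d h <= fibre phi (@E d.+1))%MS -> (v <= fibre phi (@E d))%MS) _ hKP.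
  by move=> c h c0 h1 w; rewrite muZ -scalemxAr eqmx_scale //; apply: h1.
have [s s0 hs] := mul_local res l0 l1 hP.
exists s => //; apply: hs; rewrite mulmx_sumr; apply: (submod_sum (sE _)) => i _.
by rewrite -scalemxAr; apply: (submodZ (sE _)).
Qed.

End Descent.

(** * Homogeneous ideals and flatness of the charts *)

Lemma form_row_pihomog (R : comNzRingType) n d (f : {mpoly R[n]}) :
  form_of_row (row_of_form d f) = pihomog mdeg d f.
Proof.
rewrite [f in LHS]mpolyE [f in RHS]mpolyE !linear_sum /=; apply: eq_bigr => m _.
rewrite !linearZ_LR /=; congr (_ *: _); rewrite pihomogX; case: eqP => md.
  by rewrite row_of_formK // dhomogX md.
rewrite (_ : row_of_form d 'X_[m] = 0) ?linear0 //; apply/rowP => i; rewrite !mxE mcoeffX.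
by case: eqP => // mi; case: md; rewrite mi; exact: mdeg_mon.
Qed.

Lemma map_form_of_row (A B : comNzRingType) (f : {rmorphism A -> B}) n d (v : 'rV[A]_(nmon n d)) :
  map_mpoly f (form_of_row v) = form_of_row (map_mx f v).
Proof.
rewrite /form_of_row raddf_sum; apply: eq_bigr => i _ /=.
by rewrite map_mpolyZ map_mpolyX mxE.
Qed.

Lemma map_row_of_form (A B : comNzRingType) (f : {rmorphism A -> B}) n d (g : {mpoly A[n]}) :
  row_of_form d (map_mpoly f g) = map_mx f (row_of_form d g).
Proof. by apply/rowP => i; rewrite !mxE mcoeff_map_mpoly. Qed.

Lemma pihomogMX (R : comNzRingType) n d m (f : {mpoly R[n]}) :
  pihomog mdeg d ('X_[m] * f) =
  if (mdeg m <= d)%N then 'X_[m] * pihomog mdeg (d - mdeg m) f else 0.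
Proof.
have E : pihomog mdeg d ('X_[m] * f) = \sum_(m' <- msupp f) f@_m' *:
    (if (mdeg m + mdeg m' == d)%N then 'X_[m + m'] else 0).
  rewrite {1}(mpolyE f) mulr_sumr linear_sum; apply: eq_bigr => m' _ /=.
  by rewrite -scalerAr linearZ_LR /= -mpolyXD pihomogX /= mdegD.
rewrite E {E}; case: leqP => h.
  rewrite [in RHS](mpolyE f) linear_sum mulr_sumr; apply: eq_bigr => m' _ /=.
  rewrite linearZ_LR /= -scalerAr pihomogX; congr (_ *: _).
  rewrite -{1}(subnKC h) eqn_add2l; case: eqP => _; last by rewrite mulr0.
  by rewrite mpolyXD.
rewrite big1 // => m' _; case: eqP => [e|_]; last by rewrite scaler0.
by move: h; rewrite -e ltnNge leq_addr.
Qed.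

Lemma row_of_form_mulX (R : comNzRingType) n d i (f : {mpoly R[n]}) :
  row_of_form d.+1 ('X_i * f) = row_of_form d f *m varmx R d i.
Proof.
apply: form_of_row_inj; rewrite form_of_varmx !form_row_pihomog pihomogMX mdeg1.
by rewrite subn1.
Qed.

Lemma row_of_form_mulX0 (R : comNzRingType) n i (f : {mpoly R[n]}) :
  row_of_form 0 ('X_i * f) = 0.
Proof. by apply: form_of_row_inj; rewrite form_row_pihomog pihomogMX mdeg1 linear0. Qed.

Lemma mpoly_ideal (R : comNzRingType) n (W : {mpoly R[n]} -> Prop) :
  @is_submod R {mpoly R[n]} W -> (forall i f, W f -> W ('X_i * f)) -> is_ideal W.
Proof.
move=> sW WX; split; [exact: (submod0 sW)|exact: (submodD sW)|] => c f Wf.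
rewrite -[_ *: _]/(c * f) (mpolyE c) mulr_suml; apply: (submod_sum sW) => m _.
rewrite -scalerAl; apply: (submodZ sW); rewrite mpolyXE_id.
elim/big_rec: _ => [|i x _]; first by rewrite mul1r.
by rewrite -mulrA; elim: (m i) => [|k IH] hx; rewrite ?expr0 ?mul1r // exprS -mulrA; apply/WX/IH.
Qed.

Lemma ideal_submod (R : comNzRingType) n (I : {mpoly R[n]} -> Prop) : is_ideal I ->
  @is_submod R {mpoly R[n]} I.
Proof.
move=> idI; split; [exact: is_ideal0|by move=> x y; exact: is_idealD|].
by move=> a x Ix; rewrite -mul_mpolyC; apply: is_idealMl.
Qed.

Section HomogIdeal.
Variables (A : comNzRingType) (n : nat) (I : {mpoly A[n.+1]} -> Prop).
Hypothesis idI : is_ideal I.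
Hypothesis homI : forall f d, I f -> I (pihomog mdeg d f).

Definition graded_part d (v : 'rV[A]_(nmon n.+1 d)) := I (form_of_row v).

Lemma graded_submod d : is_submod (@graded_part d).
Proof.
split=> [|x y hx hy|a x hx]; rewrite /graded_part.
- by rewrite linear0; exact: is_ideal0.
- by rewrite linearD; exact: is_idealD.
- by rewrite linearZ_LR /= -mul_mpolyC; exact: is_idealMl.
Qed.

Lemma gradedX d i v : @graded_part d v -> @graded_part d.+1 (v *m varmx A d i).
Proof. by rewrite /graded_part form_of_varmx => h; apply: is_idealMl. Qed.

Lemma graded_row d f : I f -> @graded_part d (row_of_form d f).
Proof. by move=> If; rewrite /graded_part form_row_pihomog; apply: homI. Qed.

Variables (K : fieldType) (phi : {rmorphism A -> K}).
Hypothesis res : is_residue_field phi.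

Lemma ideal_imageP d w : ideal_image phi I (form_of_row w) <->
  (w <= fibre phi (@graded_part d))%MS.
Proof.
pose W (f : {mpoly K[n.+1]}) :=
  forall d, (row_of_form d f <= fibre phi (@graded_part d))%MS.
have sW : is_ideal W.
  apply: mpoly_ideal => [|i x hx [|e]].
  - split=> [e|x y hx hy e|c x hx e]; first by rewrite linear0 sub0mx.
      by rewrite linearD addmx_sub.
    by rewrite linearZ_LR scalemx_sub.
  - by rewrite row_of_form_mulX0 sub0mx.
  rewrite row_of_form_mulX; apply: submx_trans (submxMr _ (hx e)) _.
  by apply: fibreX => //; [exact: graded_submod|move=> *; exact: gradedX].
split=> [h|].
  rewrite -(form_of_rowK w).
  apply: (span_min (M := {mpoly K[n.+1]}^o) sW _ h) => g [f If ->] e.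
  by rewrite map_row_of_form; apply: mem_fibre => //; [exact: graded_submod|exact: graded_row].
move/(fibreP res (@graded_submod d)) => [b [v [b0 Iv e]]].
have idJ : is_ideal (ideal_image phi I) by exact: ideal_gen_ideal.
have -> : form_of_row w = ((phi b)^-1)%:MP * map_mpoly phi (form_of_row v).
  by rewrite map_form_of_row -e linearZ_LR mul_mpolyC scalerA mulVf // scale1r.
by apply: (is_idealMl idJ); apply: mem_span; exists (form_of_row v).
Qed.

End HomogIdeal.

Lemma hilbert_codim (K : fieldType) n d (J : {mpoly K[n]} -> Prop) (M : 'M[K]_(nmon n d)) h :
  (forall w : 'rV_(nmon n d), J (form_of_row w) <-> (w <= M)%MS) ->
  hilbert_fun_at J d h <-> codim M = h.
Proof.
move=> JM; split=> [[e [eh ex]]|cM].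
  pose Y : 'M[K]_(h, nmon n d) := \matrix_j row_of_form d (e j).
  have cY (c : 'rV_h) : \sum_j c 0 j *: e j = form_of_row (c *m Y).
    rewrite mulmx_sum_row linear_sum; apply: eq_bigr => j _.
    by rewrite linearZ_LR /= rowK row_of_formK.
  have full : (1%:M <= M + Y)%MS.
    apply/rV_subP => w _; have [c [+ _]] := ex _ (form_of_row_homog w).
    rewrite cY -linearB => /JM hw.
    by rewrite -(subrK (c *m Y) w); apply: addmx_sub_adds => //; exact: submxMl.
  have free : row_free (Y *m cokermx M).
    rewrite -kermx_eq0; apply/eqP/row_matrixP => i; rewrite row0.
    set c := row i _; have cE : c *m Y *m cokermx M = 0.
      by rewrite /c -mulmxA -row_mul mulmx_ker row0.
    have [c0 [_ u]] := ex 0 (dhomog0 _ _ _).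
    have h1 (c' : 'rV_h) : (c' *m Y <= M)%MS -> c0 = c'.
      move=> c'M; apply: u; rewrite cY sub0r -linearN; apply/JM.
      by rewrite eqmx_opp.
    by rewrite -(h1 c) ?(h1 0) ?mul0mx ?sub0mx // submxE cE.
  have := mxrank_adds M Y; rewrite (eqP free).
  by have /mxrankS := full; rewrite mxrank1; have := rank_leq_col (M + Y)%MS; rewrite /codim; lia.
have rC : \rank M^C%MS = h by rewrite mxrank_compl.
have [Y YE] := row_base_ex rC.
exists (fun j => form_of_row (row j Y)); split=> [j|f fh]; first exact: form_of_row_homog.
have cY (c : 'rV_h) : \sum_j c 0 j *: form_of_row (row j Y) = form_of_row (c *m Y).
  by rewrite mulmx_sum_row linear_sum; apply: eq_bigr => j _; rewrite linearZ_LR.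
rewrite -(row_of_formK fh); set w := row_of_form d f.
have /sub_addsmxP[u uE] : (w <= M + Y)%MS.
  apply: submx_full; rewrite -sub1mx; have := addsmx_compl_full M; rewrite -sub1mx => h1.
  by apply: submx_trans h1 _; apply: addsmxS => //; rewrite YE.
exists u.2; split=> [|c].
  by rewrite cY -linearB; apply/JM; rewrite uE addrK submxMl.
rewrite cY -linearB => /JM; rewrite uE -addrA -mulmxBl => h1.
have h2 : ((u.2 - c) *m Y <= M)%MS.
  by rewrite -[_ *m Y](addKr (u.1 *m M)) addmx_sub // eqmx_opp submxMl.
have : ((u.2 - c) *m Y <= M :&: M^C)%MS by rewrite sub_capmx h2 -YE submxMl.
rewrite capmx_compl submx0 => /eqP h3; apply/eqP; rewrite -subr_eq0; apply/eqP.
have Yfree : row_free Y by rewrite /row_free YE.1 rC.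
by apply: (row_free_inj Yfree); rewrite mul0mx.
Qed.

Local Open Scope quotient_scope.

Section SubQuotLmod.
Variables (A : comNzRingType) (M : lmodType A) (W : M -> Prop).

Definition smpred (_ : is_submod W) : M -> bool := fun x => asbool (W x).

Hypothesis sW : is_submod W.
Local Notation wp := (smpred sW).

Lemma smpredP x : reflect (W x) (x \in wp).
Proof. exact: asboolP. Qed.

Lemma smpred_closed : submod_closed wp.
Proof.
split=> [|a x y /smpredP hx /smpredP hy]; apply/smpredP; first exact: submod0.
by apply: (submodD sW) => //; apply: (submodZ sW).
Qed.

Definition wpc : submodClosed M :=
  HB.pack wp (GRing.isSubmodClosed.Build A M wp smpred_closed).

Lemma smpred_zmod_closed : zmod_closed wp.
Proof.
split=> [|x y /smpredP hx /smpredP hy]; apply/smpredP; first exact: submod0.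
exact: (submodB sW).
Qed.

Definition wpz : zmodClosed M := HB.pack wp (GRing.isZmodClosed.Build M wp smpred_zmod_closed).

Record smtype := SMtype { smval : M; _ : smval \in wpc }.
HB.instance Definition _ := [isSub for smval].
HB.instance Definition _ := [Choice of smtype by <:].
HB.instance Definition _ := [SubChoice_isSubLmodule of smtype by <:].

Lemma sub_lmod : exists (S : lmodType A) (iota : {linear S -> M}),
  injective iota /\ forall x, W x <-> exists s, iota s = x.
Proof.
exists (smtype : lmodType A), (\val : {linear smtype -> M}); split; first exact: val_inj.
move=> x; split=> [/smpredP Wx|[s <-]]; last by apply/smpredP; case: s.
by exists (SMtype Wx).
Qed.

Definition qtype := Quotient.quot wpz.
HB.instance Definition _ := GRing.Zmodule.on qtype.

Definition qscale : A -> qtype -> qtype := locked (fun a q => \pi_qtype (a *: repr q)).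

Lemma pi_eq x y : (\pi_qtype x == \pi_qtype y :> qtype) = (x - y \in wp).
Proof. by rewrite -[RHS]/((x - y) \in wpz) Quotient.idealrBE. Qed.

Lemma pi_scale a x : \pi_qtype (a *: x) = qscale a (\pi_qtype x).
Proof.
rewrite /qscale -lock; apply/eqP; rewrite pi_eq -scalerBr; apply/smpredP/(submodZ sW)/smpredP.
by rewrite -pi_eq reprK.
Qed.

Lemma pi_addq x y : \pi_qtype (x + y) = (\pi_qtype x : qtype) + \pi_qtype y.
Proof. by rewrite [LHS]Quotient.pi_add. Qed.

Lemma qscaleA a b v : qscale a (qscale b v) = qscale (a * b) v.
Proof. by rewrite -(reprK v) -!pi_scale scalerA. Qed.
Lemma qscale1 : left_id 1 qscale.
Proof. by move=> v; rewrite -(reprK v) -pi_scale scale1r. Qed.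
Lemma qscaleDr : right_distributive qscale +%R.
Proof. by move=> a u v; rewrite -(reprK u) -(reprK v) -pi_addq -!pi_scale -pi_addq scalerDr. Qed.
Lemma qscaleDl v : {morph qscale^~ v : a b / a + b}.
Proof. by move=> a b; rewrite -(reprK v) -!pi_scale -pi_addq scalerDl. Qed.

HB.instance Definition _ := GRing.Zmodule_isLmodule.Build A qtype qscaleA qscale1 qscaleDr qscaleDl.

Definition qproj (x : M) : qtype := \pi_qtype x.
Lemma qproj_linear : linear qproj.
Proof. by move=> a x y; rewrite /qproj pi_addq pi_scale. Qed.
HB.instance Definition _ := GRing.isLinear.Build A M qtype _ qproj qproj_linear.

Lemma quot_lmod : exists (Q : lmodType A) (pi : {linear M -> Q}),
  forall x, pi x = 0 <-> W x.
Proof.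
exists (qtype : lmodType A), (qproj : {linear M -> qtype}) => x.
split=> [/eqP|Wx]; last apply/eqP.
  by rewrite -(linear0 qproj) pi_eq subr0 => /smpredP.
by rewrite -(linear0 qproj) pi_eq subr0; apply/smpredP.
Qed.
End SubQuotLmod.

Section FunLmod.
Variables (A : comNzRingType) (T : Type) (N : lmodType A).
(** The target of a test bilinear map in the proof of flatness; equality and choice on it come from
    the classical axioms. *)
Definition funmod := T -> N.

Definition fun_eq (f g : funmod) : bool := asbool (f = g).
Lemma fun_eqP : Equality.axiom fun_eq. Proof. by move=> f g; apply: asboolP. Qed.
HB.instance Definition _ := hasDecEq.Build funmod fun_eqP.

Definition fun_find (P : pred funmod) (n : nat) : option funmod :=
  if excluded_middle_informative (exists x, P x) is left h
  then Some (proj1_sig (constructive_indefinite_description _ h)) else None.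
Lemma fun_findP P n x : fun_find P n = Some x -> P x.
Proof.
rewrite /fun_find; case: excluded_middle_informative => // h [<-].
by case: constructive_indefinite_description.
Qed.
Lemma fun_find_ex (P : pred funmod) : (exists x, P x) -> exists n, fun_find P n.
Proof. by move=> h; exists 0%N; rewrite /fun_find; case: excluded_middle_informative. Qed.
Lemma fun_find_ext (P Q : pred funmod) : P =1 Q -> fun_find P =1 fun_find Q.
Proof. by move=> /functional_extensionality->. Qed.
HB.instance Definition _ := hasChoice.Build funmod fun_findP fun_find_ex fun_find_ext.

Definition fadd (f g : funmod) : funmod := fun t => f t + g t.
Definition fopp (f : funmod) : funmod := fun t => - f t.
Definition fzero : funmod := fun=> 0.
Definition fscale (a : A) (f : funmod) : funmod := fun t => a *: f t.
Local Notation fext := (functional_extensionality _ _).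
Lemma faddA : associative fadd. Proof. by move=> f g h; apply: fext => t; exact: addrA. Qed.
Lemma faddC : commutative fadd. Proof. by move=> f g; apply: fext => t; exact: addrC. Qed.
Lemma fadd0 : left_id fzero fadd. Proof. by move=> f; apply: fext => t; exact: add0r. Qed.
Lemma faddN : left_inverse fzero fopp fadd. Proof. by move=> f; apply: fext => t; exact: addNr. Qed.
HB.instance Definition _ := GRing.isZmodule.Build funmod faddA faddC fadd0 faddN.
Lemma fscaleA a b v : fscale a (fscale b v) = fscale (a * b) v.
Proof. by apply: fext => t; exact: scalerA. Qed.
Lemma fscale1 : left_id 1 fscale. Proof. by move=> f; apply: fext => t; exact: scale1r. Qed.
Lemma fscaleDr : right_distributive fscale +%R.
Proof. by move=> a f g; apply: fext => t; exact: scalerDr. Qed.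
Lemma fscaleDl v : {morph fscale^~ v : a b / a + b}.
Proof. by move=> a b; apply: fext => t; exact: scalerDl. Qed.
HB.instance Definition _ := GRing.Zmodule_isLmodule.Build A funmod fscaleA fscale1 fscaleDr fscaleDl.
End FunLmod.

Local Close Scope quotient_scope.

Section LinearProp.
Variables (A : comNzRingType) (M T : lmodType A) (f : M -> T).
Hypothesis lf : linear f.

Definition linear_of (_ : linear f) := f.
HB.instance Definition _ := GRing.isLinear.Build A M T _ (linear_of lf) lf.

Lemma linear_prop0 : f 0 = 0.
Proof. exact: (linear0 (linear_of lf)). Qed.
Lemma linear_propB x y : f (x - y) = f x - f y.
Proof. exact: (linearB (linear_of lf)). Qed.
Lemma linear_propZ a x : f (a *: x) = a *: f x.
Proof. exact: (linearZ_LR (linear_of lf)). Qed.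
Lemma linear_prop_sum (J : finType) (F : J -> M) : f (\sum_j F j) = \sum_j f (F j).
Proof. exact: (linear_sum (linear_of lf)). Qed.
End LinearProp.

Section Chart.
Variables (A : comNzRingType) (n : nat) (i : 'I_n.+1).
Implicit Types (g w : {mpoly A[n.+1]}).

(** Components of degree above D are dropped, so this is linear in g for every D; once D reaches the
    degree of g it is the usual homogenization by x_i. *)
Definition homogenize D g : {mpoly A[n.+1]} :=
  \sum_(e < D.+1) 'X_i ^+ (D - e) * pihomog mdeg e g.

Lemma homogenize_linear D : linear (homogenize D).
Proof.
move=> a f g; rewrite /homogenize scaler_sumr -big_split; apply: eq_bigr => e _ /=.
by rewrite linearP mulrDr -scalerAr.
Qed.
HB.instance Definition _ D := GRing.isLinear.Build A {mpoly A[n.+1]} {mpoly A[n.+1]} _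
  (homogenize D) (@homogenize_linear D).

Lemma varX_homog k : ('X_i ^+ k : {mpoly A[n.+1]}) \is k.-homog.
Proof.
rewrite -{2}[k]mul1n; apply: dhomogMn; rewrite dhomogX; apply/eqP.
exact: mdeg1.
Qed.

Lemma homogenize_homog D g : homogenize D g \is D.-homog.
Proof.
apply: rpred_sum => e _; have eD : (e <= D)%N by rewrite -ltnS.
have : 'X_i ^+ (D - e) * pihomog mdeg e g \is (D - e + e).-homog.
  by apply: dhomogM; [exact: varX_homog|exact: pihomogP].
by rewrite subnK.
Qed.

Lemma homogenize_form D d g : g \is d.-homog -> (d <= D)%N ->
  homogenize D g = 'X_i ^+ (D - d) * g.
Proof.
move=> hg dD; have dD' : (d < D.+1)%N by [].
rewrite /homogenize (bigD1 (Ordinal dD')) //= pihomog_dE // big1 ?addr0 // => e ne.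
rewrite (pihomog_ne0 (d := d)) ?mulr0 //; apply: contraNneq ne => de.
by apply/eqP/val_inj.
Qed.

Lemma homogenizeMX D m w : homogenize D ('X_[m] * w) =
  if (mdeg m <= D)%N then 'X_[m] * homogenize (D - mdeg m) w else 0.
Proof.
rewrite /homogenize (eq_bigr (fun e : 'I_D.+1 => if (mdeg m <= e)%N
    then 'X_[m] * ('X_i ^+ (D - e) * pihomog mdeg (e - mdeg m) w) else 0)); last first.
  by move=> e _; rewrite pihomogMX; case: leqP => _; rewrite ?mulr0 // mulrCA.
case: leqP => h; last first.
  rewrite big1 // => e _; case: leqP => // me; have := ltn_ord e; rewrite ltnS => eD.
  by have := leq_trans me eD; rewrite leqNgt h.
rewrite mulr_sumr -big_mkcond /=.
rewrite -(big_mkord (fun e => mdeg m <= e)%N (fun e => 'X_[m] * ('X_i ^+ (D - e) * pihomog mdeg (e - mdeg m) w))).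
rewrite -(big_mkord xpredT (fun e => 'X_[m] * ('X_i ^+ (D - mdeg m - e) * pihomog mdeg e w))).
rewrite (big_cat_nat (n := mdeg m)) //=; last exact: leqW.
rewrite big_nat_cond big1 ?add0r; last first.
  by move=> e /andP[/andP[_ h1] h2]; rewrite leqNgt h1 in h2.
rewrite -{1}[mdeg m]add0n big_addn big_nat_cond [RHS]big_nat_cond -subSn //.
apply: eq_big => [e|e _]; first by rewrite leq_addl.
by rewrite addnK addnC subnDA.
Qed.

Variable I : {mpoly A[n.+1]} -> Prop.
Hypothesis idI : is_ideal I.
Hypothesis homI : forall f d, I f -> I (pihomog mdeg d f).

Lemma homogenize_chart w : chart_ideal I i w ->
  exists D0, forall D, (D0 <= D)%N -> I (homogenize D w).
Proof.
pose W w := exists D0, forall D, (D0 <= D)%N -> I (homogenize D w).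
have WD x y : W x -> W y -> W (x + y).
  move=> [D1 h1] [D2 h2]; exists (maxn D1 D2) => D; rewrite geq_max => /andP[/h1 ? /h2 ?].
  by rewrite linearD; apply: is_idealD.
have W0 : W 0 by exists 0%N => D _; rewrite linear0; exact: is_ideal0.
apply: (span_min (W := W) (M := {mpoly A[n.+1]}^o)) => [|f [If|->]].
- split=> // c f [D0 h0]; rewrite -[_ *: _]/(c * f) (mpolyE c) mulr_suml.
  elim/big_ind: _ => [||m _] //; exists (D0 + mdeg m)%N => D hD.
  rewrite -scalerAl linearZ_LR /= homogenizeMX; case: leqP => ?; last first.
    by rewrite scaler0; exact: is_ideal0.
  rewrite -mul_mpolyC; do 2!apply: (is_idealMl idI); apply: h0; lia.
- exists 0%N => D _; apply: (is_ideal_sum idI) => e _; apply: (is_idealMl idI).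
  exact: homI.
exists 1%N => -[//|D] _; rewrite linearB /= (@homogenize_form D.+1 1) //; last first.
  by rewrite dhomogX; apply/eqP; exact: mdeg1.
rewrite (@homogenize_form D.+1 0) ?dhomog1 // subn0 subSS subn0 mulr1 -exprSr subrr.
exact: is_ideal0.
Qed.

Lemma chart_homogenize D g : (mmeasure mdeg g <= D)%N -> chart_ideal I i (g - homogenize D g).
Proof.
move=> gD; have idC : is_ideal (chart_ideal I i) by exact: ideal_gen_ideal.
rewrite {1}(pihomog_partitionE (leqW gD)) -sumrB; apply: (is_ideal_sum idC) => e _.
rewrite -[X in X - _]mul1r -mulrBl; apply: (is_idealMr idC).
rewrite -opprB; apply: (is_idealN idC); rewrite subrX1; apply: (is_idealMr idC).
by apply: mem_span; right.
Qed.

Hypothesis flatI : @flat_quot A {mpoly A[n.+1]} (chart_ideal I i).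

(** Flatness is tested on the inclusion of P in A. The tensor of the m_j with the c_j is zero over
    A, hence already over P, and is evaluated by the bilinear map (v, z) to z v, with values modulo
    P times the chart ideal. *)
Lemma flat_ideal (P : A -> Prop) : is_ideal P -> forall d (c : 'I_d -> A) (m : 'I_d -> {mpoly A[n.+1]}),
  (forall j, P (c j)) -> chart_ideal I i (\sum_j c j *: m j) ->
  @span A {mpoly A[n.+1]} (fun y => exists a w, [/\ P a, chart_ideal I i w & y = a *: w]) (\sum_j c j *: m j).
Proof.
move=> idP d c m Pc hf; set PC := span _.
have [S [iota [inj SP]]] := @sub_lmod A A^o P idP.
have h j : exists s, iota s = c j by apply/SP.
have [y yE] := fin_all_exists h.
have [Q [pi piP]] := @quot_lmod A {mpoly A[n.+1]} PC (span_submod _).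
apply/piP; rewrite linear_sum.
have tz : tensor_zero (chart_ideal I i) m y.
  apply: (flatI inj) => T b bl br bW /=.
  transitivity (b (\sum_j c j *: m j) (1 : A^o)); last exact: bW.
  have br1 := br (1 : A^o); rewrite (linear_prop_sum br1); apply: eq_bigr => j _.
  rewrite (linear_propZ br1) -(linear_propZ (bl (m j))); congr (b _ _).
  by rewrite yE -[c j in LHS]mulr1.
transitivity (\sum_j pi ((iota (y j) : A) *: m j)); first by apply: eq_bigr => j _; rewrite yE.
apply: (tz Q (fun v z => pi ((iota z : A) *: v))).
- by move=> v a x z; rewrite linearP scalerDl linearD -[a *: iota x]/(a * iota x) -scalerA linearZ_LR.
- by move=> z a v w; rewrite scalerDr linearD scalerA mulrC -scalerA linearZ_LR.
move=> w z Cw; apply/piP; apply: mem_span; exists (iota z), w; split=> //.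
by apply/SP; exists z.
Qed.

Definition extended (P : A -> Prop) : {mpoly A[n.+1]} -> Prop :=
  @span A {mpoly A[n.+1]} (fun y => exists a w, [/\ P a, I w & y = a *: w]).

Lemma extended_ideal P : is_ideal (extended P).
Proof.
have sE : @is_submod A {mpoly A[n.+1]} (extended P) by exact: span_submod.
split; [exact: (submod0 sE)|exact: (submodD sE)|].
move=> c f; apply: (span_min (W := fun f => extended P (c * f))).
  split=> [|x y hx hy|a x hx]; first by rewrite mulr0; exact: (submod0 sE).
    by rewrite mulrDr; exact: (submodD sE).
  by rewrite -scalerAr; exact: (submodZ sE).
move=> y [a [w [Pa Iw ->]]]; apply: mem_span; exists a, (c * w); split=> //.
  exact: is_idealMl.
by rewrite -scalerAr.
Qed.

(** Flatness on the chart writes f as a combination, with coefficients in P, of elements of the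
    chart ideal. Homogenizing in a large degree returns these to I and multiplies f by a power of
    x_i. *)
Lemma flat_extended (P : A -> Prop) f d : is_ideal P -> I f -> f \is d.-homog ->
  (forall m, P f@_m) -> exists k, extended P ('X_i ^+ k * f).
Proof.
move=> idP If hf Pf.
have Cf : chart_ideal I i f by apply: mem_span; left.
have [d' [c [s [sP sE]]]] : @span A {mpoly A[n.+1]}
    (fun y => exists a w, [/\ P a, chart_ideal I i w & y = a *: w]) f.
  have fE : f = \sum_(j < size (msupp f)) f@_(nth 0%MM (msupp f) j) *: 'X_[nth 0%MM (msupp f) j].
    by rewrite {1}(mpolyE f) (big_nth 0%MM) big_mkord.
  by rewrite fE; apply: flat_ideal => //; rewrite -fE.
have h j : exists D0, forall D, (D0 <= D)%N -> extended P (homogenize D (s j)).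
  have [a [w [Pa /homogenize_chart[D0 h0] ->]]] := sP j; exists D0 => D /h0 Iw.
  by rewrite linearZ_LR; apply: mem_span; exists a, (homogenize D w).
have [D0 D0P] := fin_all_exists h.
pose D := (d + \sum_j D0 j)%N; exists (D - d)%N.
rewrite -(homogenize_form hf) ?leq_addr // sE linear_sum.
have sE' : @is_submod A {mpoly A[n.+1]} (extended P) by exact: span_submod.
apply: (submod_sum sE') => j _; rewrite linearZ_LR; apply: (submodZ sE'); apply: D0P.
by rewrite /D (bigD1 j) //=; lia.
Qed.
End Chart.

Lemma mcoeff_pihomog (R : comNzRingType) n d (f : {mpoly R[n]}) m :
  (pihomog mdeg d f)@_m = if mdeg m == d then f@_m else 0.
Proof.
case: eqP => [md|/eqP md]; last by apply: dhomog_nemf_coeff (pihomogP _ _ _) _.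
by rewrite -form_row_pihomog; have [i <-] := monP md; rewrite coef_form_of_row mxE.
Qed.

Lemma pihomog_msize (R : comNzRingType) n d (f : {mpoly R[n]}) :
  (msize f <= d)%N -> pihomog mdeg d f = 0.
Proof.
move=> le; apply/mpolyP => m; rewrite mcoeff0 mcoeff_pihomog; case: eqP => // md.
by apply: memN_msupp_eq0; apply: msize_mdeg_ge; rewrite md.
Qed.

Lemma mdeg_pigeon n k (m : 'X_{1..n.+1}) : (n.+1 * k <= mdeg m)%N -> exists i, (k <= m i)%N.
Proof.
move=> h; apply: NNPP => nex; case: k h nex => [|k] h nex; first by apply: nex; exists ord0.
have lt i : (m i <= k)%N by rewrite leqNgt; apply/negP => lt; apply: nex; exists i.
have : (mdeg m <= n.+1 * k)%N.
  by rewrite mdegE -[n.+1 in leqRHS]card_ord -sum_nat_const; apply: leq_sum.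
by move/(leq_trans h); rewrite leq_mul2l ltnn.
Qed.

(** The elements of I whose coefficients vanish at the point form a finitely generated ideal.
    Flatness on each chart puts the components of the generators into P I after multiplication by a
    power of the variable, and every monomial of large degree contains such a power. *)
Lemma flat_mod_prop (A : comNzRingType) n (I : {mpoly A[n.+1]} -> Prop)
    (K : fieldType) (phi : {rmorphism A -> K}) :
  noetherian A -> closed_subscheme I -> flat_subscheme I ->
  exists D0, forall d, (D0 <= d)%N -> mod_prop (@graded_part A n I) phi d.
Proof.
move=> noeth [idI homI _] flatI.
pose P a := phi a = 0.
have idP : is_ideal P by have [] := ker_prime phi.
pose Q f := I f /\ forall m, P f@_m.
have idQ : is_ideal Q.
  split=> [|f g [If Pf] [Ig Pg]|c f [If Pf]].
  - split=> [|m]; first exact: is_ideal0.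
    by rewrite mcoeff0; exact: (is_ideal0 idP).
  - split=> [|m]; first exact: is_idealD.
    by rewrite mcoeffD; apply: (is_idealD idP).
  - rewrite -[_ *: _]/(c * f); split=> [|m]; first exact: is_idealMl.
    rewrite mcoeffMr; apply: (is_ideal_sum idP) => k _; exact: (is_idealMl idP).
have [s sP] := noeth_mpoly noeth idQ.
pose M := (\sum_(j < size s) msize s`_j)%N.
have h (t : 'I_(size s) * 'I_M * 'I_n.+1) :
    exists k, extended I P ('X_(t.2) ^+ k * pihomog mdeg t.1.2 s`_(t.1.1)).
  have [Is Ps] : Q s`_(t.1.1) by apply/sP/mem_span/mem_nth.
  apply: (flat_extended idI homI (flatI t.2) idP) => //.
    exact: homI.
    exact: pihomogP.
  by move=> m; rewrite mcoeff_pihomog; case: eqP => // _; exact: (is_ideal0 idP).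
have [k kP] := fin_all_exists h.
pose kk := (\sum_t k t)%N.
(* The generators have components only in degrees below [M], so a cofactor monomial has degree at
   least (n + 1) kk, hence an exponent at least kk. *)
exists (M + n.+1 * kk)%N => d dD v Iv v0; exists 1; first by rewrite rmorph1 oner_neq0.
have sX : @is_submod A {mpoly A[n.+1]} (extended I P) by exact: span_submod.
have idX : is_ideal (extended I P) by exact: extended_ideal.
have : extended I P (form_of_row v).
  have /sP/ideal_gen_seqP[c ce] : Q (form_of_row v).
    split=> // m; have [md|md] := eqVneq (mdeg m) d; last first.
      rewrite (dhomog_nemf_coeff (form_of_row_homog v) md); exact: (is_ideal0 idP).
    have [i <-] := monP md; rewrite coef_form_of_row /P.
    by have := congr1 (fun w : 'rV_(_) => w 0 i) v0; rewrite !mxE.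
  rewrite -(pihomog_dE (form_of_row_homog v)) ce linear_sum.
  apply: (submod_sum sX) => j _ /=; rewrite (mpolyE (c 0 j)) mulr_suml linear_sum.
  apply: (submod_sum sX) => m _ /=; rewrite -scalerAl linearZ_LR; apply: (submodZ sX) => /=.
  rewrite pihomogMX; case: leqP => md; last exact: (submod0 sX).
  have [le|lt] := leqP M (d - mdeg m).
    rewrite pihomog_msize ?mulr0; first exact: (submod0 sX).
    by apply: leq_trans le; rewrite /M (bigD1 j) //= leq_addr.
  have [|i mi] := @mdeg_pigeon n kk m; first lia.
  pose t := (j, Ordinal lt, i); have kt : (k t <= m i)%N.
    by apply: leq_trans mi; rewrite /kk (bigD1 t) //= leq_addr.
  have -> : 'X_[m] = 'X_[m - U_(i) *+ k t] * 'X_i ^+ k t :> {mpoly A[n.+1]}.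
    rewrite mpolyXn -mpolyXD submK //; apply/mnm_lepP => l; rewrite mulmnE mnm1E.
    by case: eqP => [<-|]; rewrite ?mul1n.
  by rewrite -mulrA; apply: (is_idealMl idX); exact: (kP t).
rewrite scale1r -{2}(form_of_rowK v).
apply: (span_min (M := {mpoly A[n.+1]}) (W := fun f => ker_span phi (@graded_part A n I d) (row_of_form d f))).
  have sk : is_submod (ker_span phi (@graded_part A n I d)) by exact: span_submod.
  split=> [|x y hx hy|a x hx]; first by rewrite linear0; exact: (submod0 sk).
    by rewrite linearD; exact: (submodD sk).
  by rewrite linearZ_LR; exact: (submodZ sk).
move=> f [a [w [Pa Iw ->]]]; apply: mem_span; exists a, (row_of_form d w).
by split; [|exact: graded_row|rewrite linearZ_LR].
Qed.

(* Conversely: z : T is detected in the sequences (b (homogenize D m) y)_D, taken up to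
   finitely many D, so tensors over the chart can be tested in one large degree. *)
Section LocpresFlat.
Variables (A : comNzRingType) (n : nat) (I : {mpoly A[n.+1]} -> Prop).
Hypothesis noeth : noetherian A.
Hypothesis clI : closed_subscheme I.
Variables (r : nat) (p : nat -> nat).
Hypothesis loc : forall (K : fieldType) (phi : {rmorphism A -> K}), is_residue_field phi ->
  forall d, (r <= d)%N -> locpres phi (p d) (@graded_part A n I d).

Lemma locpres_flat : flat_subscheme I.
Proof.
have [idI homI satI] := clI.
move=> i N' N u inj d m y tz T b bl br bC; set t := \sum_i _.
rewrite -[t]scale1r.
apply: (local_global1 noeth (Q := fun c => c *: t = 0)).
  split=> [|x z hx hz|c x hx]; first by rewrite scale0r.
    by rewrite scalerDl hx hz addr0.
  by rewrite -[_ *: x]/(c * x) -scalerA hx scaler0.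
move=> K phi res.
have h D : exists RD : 'M[A]_(nmon n.+1 D) * A, (r <= D)%N ->
  [/\ phi RD.2 != 0, forall v, graded_part I v -> v *m RD.1 = 0 &
      forall v, graded_part I (RD.2 *: (RD.2 *: v - v *m RD.1))].
  case: (leqP r D) => rD; last by exists (0, 0).
  have [C [X [e [e0 XC LC CL]]]] := loc res rD; exists (C *m X, e) => _; split=> //= v.
    by move=> /LC vC; rewrite mulmxA vC mul0mx.
  apply: CL; rewrite mulmxBl -!mulmxA XC mul_mx_scalar -scalemxAl -scalemxAr subrr.
  by [].
pose RD D := proj1_sig (constructive_indefinite_description _ (h D)).
have RP D : (r <= D)%N -> [/\ phi (RD D).2 != 0, forall v, graded_part I v -> v *m (RD D).1 = 0 &
      forall v, graded_part I ((RD D).2 *: ((RD D).2 *: v - v *m (RD D).1))].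
  by rewrite /RD; case: constructive_indefinite_description.
(* On the homogenization in degree D this is multiplication by the denominator modulo I, up to that
   denominator, but it kills I exactly. *)
pose red D (g : {mpoly A[n.+1]}) : {mpoly A[n.+1]} :=
  form_of_row (row_of_form D (homogenize i D g) *m (RD D).1).
have redD D : linear (red D).
  by move=> a f g; rewrite /red !linearP mulmxDl -scalemxAl linearP.
pose F := @funmod A (nat * 'X_{1..n.+1})%type N.
pose Z (g : F) := exists D0, forall D mu, (D0 <= D)%N -> g (D, mu) = 0.
have sZ : @is_submod A F Z.
  split=> [|f g [D1 h1] [D2 h2]|a f [D1 h1]]; first by exists 0%N.
    exists (maxn D1 D2) => D mu; rewrite geq_max => /andP[/h1 e1 /h2 e2].
    by rewrite -[LHS]/(f _ + g _) e1 e2 addr0.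
  by exists D1 => D mu /h1 e; rewrite -[LHS]/(a *: f _) e scaler0.
have [Q [pi piP]] := quot_lmod sZ.
(* An element of the chart ideal has its homogenizations in I only for large D, so [b'] kills it
   only modulo [Z]. *)
pose b' (f : {mpoly A[n.+1]}) (z : N) : F := fun Dm => (red Dm.1 f)@_(Dm.2) *: z.
have : \sum_j pi (b' (m j) (u (y j))) = 0.
  apply: (tz Q (fun f z => pi (b' f z))) => [f a z z'|z a f g|f z Cf].
  - rewrite -linearP; congr (pi _); apply: FunctionalExtensionality.functional_extensionality => Dm.
    by rewrite /b' scalerDr scalerA mulrC -scalerA.
  - rewrite -linearP; congr (pi _); apply: FunctionalExtensionality.functional_extensionality => Dm.
    by rewrite /b' redD mcoeffD mcoeffZ scalerDl -scalerA.
  apply/piP; have [D0 hD0] := homogenize_chart idI homI Cf; exists (maxn D0 r) => D mu.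
  rewrite geq_max => /andP[/hD0 If rD]; rewrite /b' /= /red.
  have [_ vR _] := RP D rD; rewrite vR ?linear0 ?mcoeff0 ?scale0r //;
  exact: (graded_row homI D If).
rewrite -linear_sum => /piP[D0 hD0].
pose D := (D0 + r + \sum_j mmeasure mdeg (m j))%N.
have rD : (r <= D)%N by rewrite /D; lia.
have [e0 _ eI] := RP D rD; set e := (RD D).2 in e0 eI.
exists (e * e); last by rewrite rmorphM mulf_neq0.
have z0 mu : \sum_j (red D (m j))@_mu *: y j = 0.
  apply: inj; rewrite linear0 linear_sum.
  have DD : (D0 <= D)%N by rewrite /D; lia.
  rewrite -[RHS](hD0 D mu DD); have : forall s : seq 'I_d, \sum_(j <- s) u ((red D (m j))@_mu *: y j) =
      (\sum_(j <- s) b' (m j) (u (y j))) (D, mu).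
    elim=> [|j s IH]; first by rewrite !big_nil.
    by rewrite !big_cons IH linearZ_LR.
  by move=> H; exact: H.
have bsum (f : {mpoly A[n.+1]}) z : chart_ideal I i f -> b f z = 0 by apply: bC.
have key j : e * e *: b (m j) (y j) = e *: b (red D (m j)) (y j).
  have brj := br (y j).
  have mD : (mmeasure mdeg (m j) <= D)%N by rewrite /D (bigD1 j) //=; lia.
  have E1 : b (m j) (y j) = b (homogenize i D (m j)) (y j).
    apply/eqP; rewrite -subr_eq0 -(linear_propB brj); apply/eqP/bsum.
    exact: chart_homogenize.
  rewrite E1 -scalerA -!(linear_propZ brj); apply/eqP; rewrite -subr_eq0 -(linear_propB brj).
  apply/eqP/bsum/mem_span; left.
  have := eI (row_of_form D (homogenize i D (m j))).
  by rewrite /graded_part linearZ_LR linearB linearZ_LR /= row_of_formK ?homogenize_homog // scalerBr.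
rewrite /t scaler_sumr (eq_bigr _ (fun j _ => key j)) -scaler_sumr.
suff -> : \sum_j b (red D (m j)) (y j) = 0 by rewrite scaler0.
transitivity (\sum_j \sum_s b 'X_[@mon n.+1 D s] ((red D (m j))@_(mon s) *: y j)).
  apply: eq_bigr => j _; have brj := br (y j).
  rewrite {1}/red {1}/form_of_row (linear_prop_sum brj); apply: eq_bigr => s _.
  by rewrite (linear_propZ brj) -(linear_propZ (bl _)) coef_form_of_row.
rewrite exchange_big big1 //= => s _.
by rewrite -(linear_prop_sum (bl _)) z0 (linear_prop0 (bl _)).
Qed.
End LocpresFlat.

(** * Points of the Grassmannian *)

Section Localized.
Variables (A B : comNzRingType) (f : A) (chi : {rmorphism A -> B}).
Hypothesis loc : is_localization f chi.

Lemma loc_expM m : exists g, g * chi (f ^+ m) = 1.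
Proof.
have [[g gf] _ _] := loc; exists (g ^+ m).
by rewrite rmorphXn -exprMn gf expr1n.
Qed.

Lemma loc_common (T : finType) (Q : T -> nat -> Prop) :
  (forall t k l, Q t k -> Q t (k + l)%N) -> (forall t, exists k, Q t k) ->
  exists k, forall t, Q t k.
Proof.
move=> QM h; have [k kP] := fin_all_exists h.
by exists (\sum_t k t)%N => t; rewrite (bigD1 t) //=; apply: QM.
Qed.

Lemma loc_lift_mx a b (M : 'M[B]_(a, b)) :
  exists m M0, map_mx chi M0 = chi (f ^+ m) *: M.
Proof.
have [_ lf _] := loc.
have [||m mP] := @loc_common ('I_a * 'I_b)%type
    (fun ij k => exists c, M ij.1 ij.2 * chi f ^+ k = chi c).
- move=> ij k l [c e]; exists (c * f ^+ l).
  by rewrite exprD mulrA e rmorphM rmorphXn.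
- by move=> ij; have [k [c e]] := lf (M ij.1 ij.2); exists k, c.
have [c cP] := fin_all_exists mP.
exists m, (\matrix_(i, j) c (i, j)); apply/matrixP => i j.
by rewrite !mxE -cP rmorphXn mulrC.
Qed.

Lemma loc_ker_mx a b (M : 'M[A]_(a, b)) : map_mx chi M = 0 -> exists m, f ^+ m *: M = 0.
Proof.
have [_ _ kf] := loc; move=> M0.
have [||m mP] := @loc_common ('I_a * 'I_b)%type (fun ij k => f ^+ k * M ij.1 ij.2 = 0).
- by move=> ij k l e; rewrite exprD mulrAC e mul0r.
- by move=> ij; apply: kf; have := congr1 (fun X : 'M_(a, b) => X ij.1 ij.2) M0; rewrite !mxE.
by exists m; apply/matrixP => i j; rewrite !mxE; exact: (mP (i, j)).
Qed.

Lemma presents_quotZ N p (L : 'rV[B]_N -> Prop) (C : 'M[B]_(N, p)) u g :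
  g * u = 1 -> presents_quot L C -> presents_quot L (u *: C).
Proof.
move=> gu [surj ker]; split=> [w|v].
  have [v vC] := surj (g *: w); exists v.
  by rewrite -scalemxAr vC scalerA mulrC gu scale1r.
rewrite -ker -scalemxAr; split=> [e|->]; last by rewrite scaler0.
by rewrite -[v *m C]scale1r -gu -scalerA e scaler0.
Qed.

Lemma pullback_denom N (L : 'rV[A]_N -> Prop) w : is_submod L ->
  submod_pullback chi L w -> exists m v, L v /\ map_mx chi v = chi (f ^+ m) *: w.
Proof.
move=> sL; have [_ lf _] := loc.
apply: (span_min (W := fun w => exists m v, L v /\ map_mx chi v = chi (f ^+ m) *: w)).
  split=> [|x y [m [v [Lv e]]] [m' [v' [Lv' e']]]|b x [m [v [Lv e]]]].
  - by exists 0%N, 0; rewrite map_mx0 scaler0; split=> //; exact: submod0.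
  - exists (m + m')%N, (f ^+ m' *: v + f ^+ m *: v'); split.
      by apply: (submodD sL); apply: (submodZ sL).
    rewrite map_mxD !map_mxZ e e' exprD rmorphM !scalerA scalerDr.
    by rewrite [chi (f ^+ m') * _]mulrC.
  have [k [c ce]] := lf b; exists (m + k)%N, (c *: v); split; first exact: submodZ.
  rewrite map_mxZ e -ce exprD !rmorphM !rmorphXn !scalerA; congr (_ *: _); ring.
by move=> y [v Lv ->]; exists 0%N, v; rewrite expr0 rmorph1 scale1r.
Qed.

Lemma presents_denom N p (L : 'rV[A]_N -> Prop) (C : 'M[A]_(N, p)) :
  noetherian A -> is_submod L -> presents_quot (submod_pullback chi L) (map_mx chi C) ->
  exists X m1 m2 m3, [/\ X *m C = (f ^+ m1)%:M, forall v, v *m C = 0 -> L (f ^+ m2 *: v)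
    & forall v, L v -> f ^+ m3 *: (v *m C) = 0].
Proof.
move=> noeth sL [surj ker].
have [Y YP] := fin_all_exists (fun i : 'I_p => surj (delta_mx 0 i)).
pose XB : 'M[B]_(p, N) := \matrix_i Y i.
have XBE : XB *m map_mx chi C = 1%:M.
  by apply/row_matrixP => i; rewrite row_mul rowK YP rowE mulmx1.
have [k [X0 X0E]] := loc_lift_mx XB.
have [|l lE] := @loc_ker_mx _ _ (X0 *m C - (f ^+ k)%:M).
  by rewrite map_mxB map_mxM X0E -scalemxAl XBE map_scalar_mx scalemx1 subrr.
have sK : is_submod (fun v : 'rV_N => v *m C = 0).
  exact: ker_mx_submod.
have [t [W WP]] := noeth_submod noeth sK.
have [||m2 m2P] := @loc_common 'I_t (fun j m => L (f ^+ m *: row j W)).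
- by move=> j a b h; rewrite addnC exprD -scalerA; apply: submodZ.
- move=> j; have : row j W *m C = 0 by apply/WP; exists (delta_mx 0 j); rewrite -rowE.
  move/(congr1 (map_mx chi)); rewrite map_mxM map_mx0 => /ker/(pullback_denom sL).
  move=> [m [v [Lv e]]]; have [|l' l'E] := @loc_ker_mx _ _ (v - f ^+ m *: row j W).
    by rewrite map_mxB map_mxZ e subrr.
  exists (l' + m)%N; rewrite exprD -scalerA.
  move: l'E; rewrite scalerBr => /eqP; rewrite subr_eq0 => /eqP <-.
  exact: submodZ.
have [t' [V VP]] := noeth_submod noeth sL.
have [|m3 m3E] := @loc_ker_mx _ _ (V *m C).
  rewrite map_mxM; apply/row_matrixP => j; rewrite row_mul row0; apply/ker/mem_span.
  by exists (row j V); [apply/VP; exists (delta_mx 0 j); rewrite -rowE|rewrite map_row].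
exists (f ^+ l *: X0), (l + k)%N, m2, m3; split.
- move: lE; rewrite scalerBr => /eqP; rewrite subr_eq0 => /eqP e.
  by rewrite -scalemxAl e scale_scalar_mx exprD.
- move=> v /WP[c ->]; rewrite mulmx_sum_row scaler_sumr; apply: (submod_sum sL) => j _.
  by rewrite scalerA mulrC -scalerA; apply: (submodZ sL).
by move=> v /VP[c ->]; rewrite -mulmxA scalemxAr m3E mulmx0.
Qed.

End Localized.

Section GrLocal.
Variables (A : comNzRingType) (N p : nat) (L : 'rV[A]_N -> Prop).
Hypothesis noeth : noetherian A.

Lemma Gr_chart (K : fieldType) (phi : {rmorphism A -> K}) : Gr p L ->
  exists f (B : comNzRingType) (chi : {rmorphism A -> B}) (C : 'M[A]_(N, p)),
    [/\ phi f != 0, is_localization f chi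
      & presents_quot (submod_pullback chi L) (map_mx chi C)].
Proof.
move=> [sL grL]; have [f [nf [B [chi [C [loc pres]]]]]] := grL _ (ker_prime phi).
have [m [C0 C0E]] := loc_lift_mx loc C; have [g gf] := loc_expM loc m.
exists f, B, chi, C0; split=> //; first by apply/eqP.
by rewrite C0E; apply: presents_quotZ pres; exact: gf.
Qed.

Lemma locpres_Gr : is_submod L ->
  (forall (K : fieldType) (phi : {rmorphism A -> K}), is_residue_field phi -> locpres phi p L) ->
  Gr p L.
Proof.
move=> sL lp; split=> // P prP; have [K [phi [res ker]]] := residue_field_exists prP.
have [C [X [d [d0 XC LC CL]]]] := lp _ phi res.
exists d; split; first by move/ker/eqP; rewrite (negPf d0).
have [|B [chi loc]] := @localization _ d.
  by move=> m e; have /eqP := rmorphXn phi m d; rewrite e rmorph0 eq_sym expf_eq0 (negPf d0) andbF.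
exists B, chi, (map_mx chi C); split=> //; split=> [w|v].
  have [g gd] := loc_expM loc 1; rewrite expr1 in gd.
  exists (g *: (w *m map_mx chi X)); rewrite -scalemxAl -mulmxA -map_mxM XC map_scalar_mx.
  by rewrite mul_mx_scalar scalerA gd scale1r.
split=> [vC|]; last first.
  apply: (span_min (W := fun v : 'rV_N => v *m map_mx chi C = 0)).
    exact: ker_mx_submod.
  by move=> y [u /LC e ->]; rewrite -map_mxM e map_mx0.
have [m [v0 v0E]] := loc_lift_mx loc v.
have [|l lE] := @loc_ker_mx _ _ _ _ loc _ _ (v0 *m C).
  by rewrite map_mxM v0E -scalemxAl vC scaler0.
rewrite scalemxAl in lE; have Lv := CL _ lE.
have [g gd] := loc_expM loc (1 + l + m).
have -> : v = g *: map_mx chi (d *: (d ^+ l *: v0)).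
  rewrite !map_mxZ v0E !scalerA -[LHS]scale1r -gd !exprD expr1 !rmorphM.
  by congr (_ *: _); ring.
by apply: (submodZ (span_submod _)); apply: mem_span; exists (d *: (d ^+ l *: v0)).
Qed.
End GrLocal.

Lemma row_of_form_mulX_low (R : comNzRingType) n d i (f : {mpoly R[n]}) :
  (forall e, (e < d)%N -> row_of_form e f = 0) -> row_of_form d ('X_i * f) = 0.
Proof.
case: d => [|d] f0; first exact: row_of_form_mulX0.
by rewrite row_of_form_mulX f0 ?mul0mx.
Qed.

Section Saturation.
Variables (A : comNzRingType) (n : nat) (I : {mpoly A[n.+1]} -> Prop).
Hypothesis idI : is_ideal I.
Hypothesis homI : forall f d, I f -> I (pihomog mdeg d f).

Lemma sub_saturation f : I f -> saturation I f.
Proof. by move=> If i; exists 0%N; rewrite expr0 mul1r. Qed.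

Lemma saturation_closed : closed_subscheme (saturation I).
Proof.
split=> [|f d sf i|f sf i].
- split=> [|f g hf hg i|c f hf i].
  + by apply: sub_saturation; exact: is_ideal0.
  + have [[m hm] [k hk]] := (hf i, hg i); exists (m + k)%N; rewrite mulrDr.
    apply: (is_idealD idI); first by rewrite exprD mulrAC; apply: (is_idealMr idI).
    by rewrite exprD -mulrA; apply: (is_idealMl idI).
  + have [m hm] := hf i; exists m; rewrite -[_ *: _]/(c * f) mulrCA.
    exact: is_idealMl.
- have [m hm] := sf i; exists m; have := homI (d + m) hm.
  by rewrite mpolyXn pihomogMX mdegMn mdeg1 mul1n leq_addl addnK.
have [m hm] := sf i; have [k hk] := hm i; exists (k + m)%N.
by rewrite exprD -mulrA.
Qed.

(** By the pigeonhole principle all monomials of some large degree send v into I; the hypothesis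
    then lowers that degree one step at a time. *)
Lemma saturation_graded r :
  (forall d, (r <= d)%N -> forall v, (forall i, @graded_part A n I d.+1 (v *m varmx A d i)) ->
     graded_part I v) ->
  forall d, (r <= d)%N -> forall v : 'rV_(nmon n.+1 d),
    graded_part (saturation I) v <-> graded_part I v.
Proof.
move=> satI d rd v; split=> [sv|]; last exact: sub_saturation.
have [k kP] := fin_all_exists sv.
have : forall m, mdeg m = (n.+1 * \sum_i k i)%N -> I ('X_[m] * form_of_row v).
  move=> m md; have [|i mi] := @mdeg_pigeon n (\sum_i k i) m; first by rewrite md.
  have ki : (k i <= m i)%N by apply: leq_trans mi; rewrite (bigD1 i) //= leq_addr.
  have -> : 'X_[m] = 'X_[m - U_(i) *+ k i] * 'X_i ^+ k i :> {mpoly A[n.+1]}.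
    rewrite mpolyXn -mpolyXD submK //; apply/mnm_lepP => l; rewrite mulmnE mnm1E.
    by case: eqP => [<-|]; rewrite ?mul1n.
  by rewrite -mulrA; apply: (is_idealMl idI).
elim: (n.+1 * _)%N d rd v {sv kP} => [|e IH] d rd v h.
  by have := h 0%MM mdeg0; rewrite mpolyX0 mul1r.
apply: (satI _ rd) => i; apply: IH; first exact: leqW.
move=> m md; rewrite form_of_varmx mulrA -mpolyXD; apply: h.
by rewrite mdegD mdeg1 md addn1.
Qed.

End Saturation.

(** * The ideal generated by L, and Gotzmann's theorem over a noetherian ring *)

Section Generated.
Variables (A : comNzRingType) (n r : nat) (L : 'rV[A]_(nmon n.+1 r) -> Prop).
Hypothesis sL : is_submod L.

Definition form_ideal : {mpoly A[n.+1]} -> Prop :=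
  ideal_gen (fun f => exists2 v, L v & f = form_of_row v).
Local Notation I0 := form_ideal.
Local Notation E := (@graded_part A n I0).

Lemma form_ideal_ideal : is_ideal I0. Proof. exact: ideal_gen_ideal. Qed.
Local Notation idI0 := form_ideal_ideal.

Lemma form_ideal_homog f d : I0 f -> I0 (pihomog mdeg d f).
Proof.
move=> h; move: d; move: h.
apply: (span_min (M := {mpoly A[n.+1]}^o) (W := fun f => forall d, I0 (pihomog mdeg d f))).
  apply: mpoly_ideal => [|i g Ig d].
    have [s0 sD sZ] := ideal_submod idI0.
    split=> [d|x y Ix Iy d|c x Ix d]; first by rewrite linear0.
      by rewrite linearD; apply: sD; [exact: Ix|exact: Iy].
    by rewrite linearZ_LR; apply: sZ; exact: Ix.
  rewrite pihomogMX; case: ifP => _; first exact: (is_idealMl idI0).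
  exact: (is_ideal0 idI0).
move=> g [v Lv ->] d; have [<-|dr] := eqVneq r d; last first.
  by rewrite (pihomog_ne0 dr (form_of_row_homog v)); exact: (is_ideal0 idI0).
rewrite pihomog_dE; first by apply: mem_span; exists v.
exact: form_of_row_homog.
Qed.

Lemma form_ideal_row f : I0 f ->
  (forall d, (d < r)%N -> row_of_form d f = 0) /\ L (row_of_form r f).
Proof.
apply: (span_min (M := {mpoly A[n.+1]}^o)
  (W := fun f => (forall d, (d < r)%N -> row_of_form d f = 0) /\ L (row_of_form r f))).
  apply: mpoly_ideal => [|i g [g0 Lg]].
    split=> [|x y [x0 Lx] [y0 Ly]|a x [x0 Lx]].
    - by split=> [d _|]; rewrite linear0 //; exact: (submod0 sL).
    - by split=> [d dr|]; rewrite linearD /=; [rewrite x0 ?y0 ?addr0|exact: (submodD sL)].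
    - by split=> [d dr|]; rewrite linearZ_LR /=; [rewrite x0 ?scaler0|exact: (submodZ sL)].
  split=> [[|d] dr|]; [exact: row_of_form_mulX0|by rewrite row_of_form_mulX g0 ?mul0mx // ltnW|].
  by rewrite row_of_form_mulX_low //; exact: (submod0 sL).
move=> g [v Lv ->]; split=> [d dr|]; last by rewrite form_of_rowK.
apply: form_of_row_inj; rewrite linear0 form_row_pihomog (pihomog_ne0 _ (form_of_row_homog v)) //.
by rewrite neq_ltn dr orbT.
Qed.

Lemma form_ideal_degree v : @E r v <-> L v.
Proof.
split=> [/form_ideal_row[_]|Lv]; first by rewrite form_of_rowK.
by apply: mem_span; exists v.
Qed.

Lemma form_ideal_gen d v : (r <= d)%N -> @E d.+1 v -> exists g,
  (forall i, @E d (g i)) /\ v = \sum_i g i *m varmx A d i.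
Proof.
move=> rd; rewrite -{2}(form_of_rowK v) /graded_part.
pose W f := I0 f /\ exists g, (forall i, @E d (g i)) /\ row_of_form d.+1 f = \sum_i g i *m varmx A d i.
move=> If; suff [] : W (form_of_row v) by [].
move: If; apply: (span_min (M := {mpoly A[n.+1]}^o)).
  have [s0 sD sZ] := ideal_submod idI0; have sE := graded_submod idI0 d.
  apply: mpoly_ideal => [|i g [Ig _]].
    split=> [|x y [Ix [g [gE e]]] [Iy [g' [gE' e']]]|c x [Ix [g [gE e]]]].
    - split=> //; exists (fun=> 0); split=> [i|]; first exact: (submod0 sE).
      by rewrite linear0 big1 // => i _; rewrite mul0mx.
    - split; first exact: sD.
      exists (fun i => g i + g' i); split=> [i|]; first exact: (submodD sE).
      by rewrite linearD /= e e' -big_split; apply: eq_bigr => i _; rewrite mulmxDl.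
    - split; first exact: sZ.
      exists (fun i => c *: g i); split=> [i|]; first exact: (submodZ sE).
      by rewrite linearZ_LR /= e scaler_sumr; apply: eq_bigr => i _; rewrite scalemxAl.
  split; first exact: (is_idealMl idI0).
  exists (fun j => if j == i then row_of_form d g else 0); split=> [j|].
    case: eqP => _; last exact: (submod0 sE).
    by apply: graded_row => // ? ?; exact: form_ideal_homog.
  by rewrite row_of_form_mulX (bigD1 i) //= eqxx big1 ?addr0 // => j /negPf->; rewrite mul0mx.
move=> g [u Lu ->]; split; first by apply: mem_span; exists u.
exists (fun=> 0); split=> [i|]; first exact: (submod0 (graded_submod idI0 d)).
rewrite big1 => [|i _]; last by rewrite mul0mx.
apply: form_of_row_inj; rewrite linear0 form_row_pihomog (pihomog_ne0 _ (form_of_row_homog u)) //.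
by rewrite neq_ltn ltnS rd.
Qed.
End Generated.

Lemma locpres_ext (A : comNzRingType) (K : fieldType) (phi : {rmorphism A -> K}) N p
    (L L' : 'rV[A]_N -> Prop) : (forall v, L v <-> L' v) -> locpres phi p L -> locpres phi p L'.
Proof.
move=> LL [C [X [d [d0 XC LC CL]]]]; exists C, X, d; split=> // v; first by move/LL/LC.
by move/CL/LL.
Qed.

Section Gotzmann.
Variables (A : comNzRingType) (n r : nat) (L : 'rV[A]_(nmon n.+1 r) -> Prop).
Hypothesis sL : is_submod L.
Hypothesis noeth : noetherian A.
Hypothesis chA : forall (K : fieldType) (phi : {rmorphism A -> K}), [pchar K] =i pred0.
Variables (a : seq nat) (P : {poly rat}).
Hypotheses (sa : sorted geq a) (za : (size a <= r)%N).
Hypothesis Pa : forall d, (r <= d)%N -> P.[d%:R] = (mac d a)%:R.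
Local Notation I0 := (form_ideal L).
Local Notation E := (@graded_part A n I0).
Hypothesis loc : forall (K : fieldType) (phi : {rmorphism A -> K}), is_residue_field phi ->
  [/\ locpres phi (mac r a) L, codim (fibre phi (@E r.+1)) = mac r.+1 a & mod_prop E phi r.+1].

Lemma form_ideal_family (K : fieldType) (phi : {rmorphism A -> K}) : is_residue_field phi ->
  (forall d, (r <= d)%N -> locpres phi (mac d a) (@E d)) /\
  exists h, forall d, (r <= d)%N ->
    forall v : 'rV_(nmon n.+1 d), (v *m mu (@varmx n.+1 K) d h <= fibre phi (@E d.+1))%MS ->
      (v <= fibre phi (@E d))%MS.
Proof.
move=> res; have [l0 c1 m1] := loc res.
apply: (flat_family noeth _ _ res (chA phi) sa za _ _ c1 m1) => [d|d i v|d rd v|].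
- exact: (graded_submod (form_ideal_ideal L)).
- exact: (gradedX (form_ideal_ideal L)).
- exact: form_ideal_gen.
- by apply: locpres_ext l0 => v; apply: iff_sym; exact: form_ideal_degree.
Qed.

Lemma saturation_form_ideal d : (r <= d)%N -> forall v : 'rV_(nmon n.+1 d),
  graded_part (saturation I0) v <-> @E d v.
Proof.
apply: (saturation_graded (form_ideal_ideal L)) => {}d rd v.
apply: (@sat_global _ _ _ noeth _ _ a) => [e|e i u|K phi res].
- exact: (graded_submod (form_ideal_ideal L)).
- exact: (gradedX (form_ideal_ideal L)).
have [l [h hP]] := form_ideal_family res; split; [exact: l|by apply: l; exact: leqW|].
by exists h; exact: hP.
Qed.

Theorem gotzmann : Hilb P (saturation I0).
Proof.
have cl : closed_subscheme (saturation I0).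
  by apply: saturation_closed; [exact: form_ideal_ideal|move=> *; exact: form_ideal_homog].
have lp (K : fieldType) (phi : {rmorphism A -> K}) : is_residue_field phi ->
    forall d, (r <= d)%N -> locpres phi (mac d a) (@graded_part A n (saturation I0) d).
  move=> res d rd; have [l _] := form_ideal_family res.
  by apply: locpres_ext (l d rd) => v; apply: iff_sym; exact: saturation_form_ideal.
split=> //; first by apply: (@locpres_flat _ _ _ noeth cl r (mac^~ a)) => K phi res d; exact: lp.
move=> K phi res; exists r => d rd; exists (mac d a); last exact: Pa.
have [idS homS _] := cl.
have im : forall w : 'rV_(nmon n.+1 d), ideal_image phi (saturation I0) (form_of_row w) <->
    (w <= fibre phi (@graded_part A n (saturation I0) d))%MS.
  by move=> w; apply: ideal_imageP.
apply/(hilbert_codim _ im); apply: locpres_codim => //; first exact: graded_submod.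
exact: lp.
Qed.

Lemma H0_gotzmann v : H0 (r := r) (saturation I0) v <-> L v.
Proof.
apply: (iff_trans (saturation_form_ideal (leqnn r) v)); exact: form_ideal_degree.
Qed.

End Gotzmann.

Lemma macE d a : mac d a = (\sum_(i < size a) 'C(d - i + nth 0 a i, nth 0 a i))%N.
Proof.
elim: a d => [|x a IH] d /=; first by rewrite big_ord0.
rewrite big_ord_recl /= subn0 IH; congr (_ + _)%N; apply: eq_bigr => i _.
by rewrite /bump /= add1n -subn1 -subnDA add1n.
Qed.

Lemma binom_polyE x i d : (i <= d)%N ->
  (binom_poly (x%:Z - i%:Z) x).[d%:R] = 'C(d - i + x, x)%:R.
Proof.
move=> id; rewrite /binom_poly hornerZ horner_prod.
have -> : \prod_(j < x) ('X + (x%:Z - i%:Z - j%:Z)%:~R%:P).[d%:R] = ((d - i + x) ^_ x)%:R :> rat.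
  rewrite ffact_prod natr_prod; apply: eq_bigr => j _.
  rewrite hornerD hornerX hornerC natrB; last by rewrite (leq_trans (ltnW (ltn_ord j))) // leq_addl.
  by rewrite natrD natrB // !rmorphB /= !pmulrn; ring.
rewrite -bin_ffact natrM mulrC mulfK // Num.Theory.pnatr_eq0 -lt0n.
exact: fact_gt0.
Qed.

Lemma gotzmann_mac P r a d : size a = r ->
  P = \sum_(i < r) binom_poly ((nth 0%N a i)%:Z - i%:Z) (nth 0%N a i) ->
  (r <= d)%N -> P.[d%:R] = (mac d a)%:R.
Proof.
move=> <- -> rd; rewrite horner_sum macE natr_sum; apply: eq_bigr => i _.
by rewrite binom_polyE // (leq_trans (ltnW (ltn_ord i))).
Qed.

Lemma compl_poly_mac n P d m q : P.[d%:R] = m%:R -> (compl_poly n P).[d%:R] = q%:R ->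
  (q + m)%N = nmon n.+1 d.
Proof.
rewrite /compl_poly hornerD hornerN => ->.
rewrite -[n%:Z]subr0 (@binom_polyE n 0 d) // subn0 addnC => e.
apply/eqP; rewrite -(Num.Theory.eqr_nat rat) natrD -e subrK card_monomials.
by [].
Qed.

Section HilbLocpres.
Variables (A : comNzRingType) (n : nat) (P : {poly rat}) (I : {mpoly A[n.+1]} -> Prop).
Hypothesis noeth : noetherian A.
Hypothesis chA : forall (K : fieldType) (phi : {rmorphism A -> K}), [pchar K] =i pred0.
Variable a : seq nat.
Hypothesis sa : sorted geq a.
Hypothesis Pa : forall d, (size a <= d)%N -> P.[d%:R] = (mac d a)%:R.
Hypothesis HI : Hilb P I.
Local Notation E := (@graded_part A n I).

Lemma Hilb_submod d : is_submod (@E d).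
Proof. by case: HI => -[idI _ _] _ _; exact: graded_submod. Qed.

Lemma HilbX d i v : @E d v -> @E d.+1 (v *m varmx A d i).
Proof. by case: HI => -[idI _ _] _ _; exact: gradedX. Qed.

(** Flatness gives the Tor condition and the Hilbert polynomial the codimension, both only in large
    degrees; [descend] brings freeness down to the Gotzmann number. *)
Lemma Hilb_locpres (K : fieldType) (phi : {rmorphism A -> K}) : is_residue_field phi ->
  forall d, (size a <= d)%N -> locpres phi (mac d a) (@E d).
Proof.
move=> res; case: (HI) => clI fl hp; have [idI homI satI] := clI.
have [D0 md] := flat_mod_prop phi noeth clI fl.
have [d0 hd0] := hp K phi res.
apply: (@descend _ _ _ noeth Hilb_submod HilbX _ phi res (chA phi) a sa _ (D0 + d0 + size a)%N).
- move=> d v h; apply: satI => i; exists 1%N; rewrite expr1 -form_of_varmx.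
  exact: h.
- by move=> d dD; apply: md; lia.
move=> d dD; have [|h hf Ph] := hd0 d; first lia.
have im : forall w : 'rV_(nmon n.+1 d), ideal_image phi I (form_of_row w) <->
    (w <= fibre phi (@E d))%MS by move=> w; apply: ideal_imageP.
have /(hilbert_codim _ im) -> := hf.
by apply/eqP; rewrite -(Num.Theory.eqr_nat rat) -Ph Pa //; lia.
Qed.

Lemma Hilb_gen d : (size a <= d)%N -> forall v, @E d.+1 v ->
  exists g, (forall i, @E d (g i)) /\ v = \sum_i g i *m varmx A d i.
Proof.
move=> ad; apply: (gen_global noeth Hilb_submod HilbX chA sa ad) => K phi res.
by split; apply: Hilb_locpres => //; exact: leqW.
Qed.

End HilbLocpres.

Lemma Hilb_inj (A : comNzRingType) n r (I I' : {mpoly A[n.+1]} -> Prop) :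
  closed_subscheme I -> closed_subscheme I' ->
  (forall d, (r <= d)%N -> forall v, @graded_part A n I d.+1 v -> exists g,
    (forall i, @graded_part A n I d (g i)) /\ v = \sum_i g i *m varmx A d i) ->
  (forall v, @graded_part A n I r v -> @graded_part A n I' r v) ->
  forall f, I f -> I' f.
Proof.
move=> [idI homI _] [idI' _ satI'] gen sub f If.
have {}sub d : (r <= d)%N -> forall v, @graded_part A n I d v -> @graded_part A n I' d v.
  elim: d => [|d IH]; first by rewrite leqn0 => /eqP r0; move: sub; rewrite r0.
  rewrite leq_eqVlt => /predU1P[<- //|rd] v /(gen d rd)[g [gI ->]].
  apply: (submod_sum (graded_submod idI' _)) => i _.
  by apply: (gradedX idI'); apply: IH.
(* Multiplication by the r-th power of a variable moves every component of f into degrees at least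
   r, where I is known to lie in I'. *)
apply: satI' => i; exists r.
have [D ->] : exists D, f = \sum_(d < D) pihomog mdeg d f.
  by exists (mmeasure mdeg f); apply: pihomog_partitionE; exact: leqnn.
rewrite mulr_sumr; apply: (is_ideal_sum idI') => d _.
rewrite -form_row_pihomog.
have -> : 'X_i ^+ r * form_of_row (row_of_form d f) =
   form_of_row (row_of_form (r + d) ('X_i ^+ r * form_of_row (row_of_form d f))) :> {mpoly A[_]}.
  rewrite [RHS]row_of_formK //; apply: dhomogM; last exact: form_of_row_homog.
  exact: varX_homog.
apply: sub; first exact: leq_addr.
by apply: graded_row => //; apply: (is_idealMl idI); exact: graded_row.
Qed.

(** * Plucker coordinates and the equations *)

Lemma det_mul_small (R : comNzRingType) q (X : 'M[R]_(q.+1, q)) (Y : 'M_(q, q.+1)) :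
  \det (X *m Y) = 0.
Proof.
have <- : (row_mx 0 X : 'M_(q.+1, 1 + q)) *m col_mx 0 Y = X *m Y.
  by rewrite mul_row_col mul0mx add0r.
rewrite (@det_mulmx _ q.+1) (expand_det_col _ (0 : 'I_(1 + q))) big1 ?mul0r // => i _.
have -> : row_mx 0 X i (0 : 'I_(1 + q)) = 0 :> R; last by rewrite mul0r.
have -> : 0 = lshift q 0 :> 'I_(1 + q) by apply: val_inj.
by rewrite row_mxEl mxE.
Qed.

(** A column operation clears c and leaves the Schur complement of D without denominators. The
    factor [\det D] stays on both sides since it may be a zero divisor. *)
Lemma det_border (R : comNzRingType) q (a : 'M[R]_1) (b : 'M_(1, q)) (c : 'M_(q, 1)) (D : 'M_q) :
  \det (block_mx a b c D) * \det D = (\det D * a 0 0 - (b *m \adj D *m c) 0 0) * \det D.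
Proof.
have := det_mulmx (block_mx a b c D) (block_mx (\det D)%:M 0 (- (\adj D *m c)) 1%:M).
rewrite mulmx_block !mulmx0 !add0r !mulmx1 det_lblock det1 mulr1 det_scalar1 => <-.
rewrite !mulmxN !mulmxA mul_mx_adj mul_scalar_mx !mul_mx_scalar subrr det_ublock.
by rewrite det_mx11 !mxE.
Qed.

Lemma minor_neq0 (K : fieldType) m n q (M : 'M[K]_(m, n)) : (q <= \rank M)%N ->
  exists (f : 'I_q -> 'I_m) (g : 'I_q -> 'I_n), \det (mxsub f g M) != 0.
Proof.
have sel m' n' (M' : 'M[K]_(m', n')) : (q <= \rank M')%N ->
    exists f : 'I_q -> 'I_m', row_free (rowsub f M').
  move=> qr; exists (maxrankfun M' \o widen_ord qr).
  have free := maxrowsub_free M'; apply/row_freeP; have [Z ZE] := row_freeP free.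
  exists (Z *m (\matrix_(i, j) (i == widen_ord qr j)%:R)).
  have -> : rowsub (maxrankfun M' \o widen_ord qr) M' =
      rowsub (widen_ord qr) (rowsub (maxrankfun M') M').
    by apply/matrixP => i j; rewrite !mxE.
  rewrite mulmxA mul_rowsub_mx ZE; apply/matrixP => i j; rewrite !mxE.
  rewrite (bigD1 (widen_ord qr i)) //= !mxE eqxx mul1r big1 ?addr0.
    by rewrite (inj_eq (f := widen_ord qr)) // => x y /(congr1 val)/= /val_inj.
  by move=> l li; rewrite !mxE eq_sym (negPf li) mul0r.
case/sel => f ff; have [|g gf] := sel _ _ (rowsub f M)^T.
  by rewrite mxrank_tr (eqP ff).
exists f, g; rewrite -det_tr -unitfE.
have -> : (mxsub f g M)^T = rowsub g (rowsub f M)^T by apply/matrixP => i j; rewrite !mxE.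
by move: gf; rewrite row_free_unit unitmxE.
Qed.

Section Cramer.
Variables (R : comNzRingType) (p : nat).

Definition set_row (V : 'M[R]_p) l (w : 'rV_p) : 'M[R]_p :=
  \matrix_(i, j) if i == l then w 0 j else V i j.

Lemma det_set_row V l w : \det (set_row V l w) = (w *m \adj V) 0 l.
Proof.
rewrite (expand_det_row _ l) mxE; apply: eq_bigr => j _; rewrite !mxE eqxx; congr (_ * _).
rewrite /cofactor; congr (_ * \det _); apply/matrixP => i i'; rewrite !mxE.
by rewrite eq_sym (negPf (neq_lift _ _)).
Qed.

Variables (N : nat) (C : 'M[R]_(N, p)).
Implicit Types u v t : 'I_p -> 'I_N.

Definition plu u := \det (rowsub u C).

Lemma plu_set u l s : plu [eta u with l |-> s] = (row s C *m \adj (rowsub u C)) 0 l.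
Proof.
rewrite -det_set_row; congr (\det _); apply/matrixP => i j; rewrite !mxE /=.
by case: eqP.
Qed.

(** Cramer's rule writes [plu v] times the row [u a] of C through the rows [v l], with coefficients
    the minors of v with entry l replaced by [u a]. Substituting this in row a of the minor u gives
    the relation. *)
Lemma plu_exchange u v a :
  plu u * plu v = \sum_l plu [eta u with a |-> v l] * plu [eta v with l |-> u a].
Proof.
have -> : plu u = (row (u a) C *m \adj (rowsub u C)) 0 a.
  by rewrite -plu_set; congr (\det _); apply/matrixP => i j; rewrite !mxE /=; case: eqP => [->|].
have e : plu v *: row (u a) C = row (u a) C *m \adj (rowsub v C) *m rowsub v C.
  by rewrite -mulmxA mul_adj_mx mul_mx_scalar.
transitivity ((plu v *: row (u a) C *m \adj (rowsub u C)) 0 a).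
  by rewrite -scalemxAl [RHS]mxE mulrC.
rewrite e -[_ *m \adj (rowsub u C)]mulmxA mxE.
apply: eq_bigr => l _; rewrite !plu_set mulrC; congr (_ * _).
by rewrite -row_mul mul_rowsub_mx !mxE.
Qed.

(* For [t] with [plu t] invertible this is [plu t] times the projection of R^N
   onto the kernel of [C] along the span of the basis vectors indexed by [t]. *)
Definition theta t : 'M[R]_N :=
  (plu t)%:M - C *m \adj (rowsub t C) *m (\matrix_(l, j) (t l == j)%:R).

Lemma theta_ker t : theta t *m C = 0.
Proof.
have e : (\matrix_(l, j) (t l == j)%:R) *m C = rowsub t C.
  apply/matrixP => l j; rewrite !mxE (bigD1 (t l)) //= mxE eqxx mul1r big1 ?addr0 // => i it.
  by rewrite mxE eq_sym (negPf it) mul0r.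
by rewrite mulmxBl -!mulmxA e mul_adj_mx -scalar_mxC subrr.
Qed.

Lemma thetaM t (v : 'rV_N) : v *m C = 0 -> v *m theta t = plu t *: v.
Proof. by move=> vC; rewrite mulmxBr !mulmxA vC !mul0mx subr0 mul_mx_scalar. Qed.

Lemma thetaE t s j :
  theta t s j = plu t *+ (s == j) - \sum_l plu [eta t with l |-> s] * (t l == j)%:R.
Proof.
rewrite !mxE; congr (_ - _); apply: eq_bigr => l _.
by rewrite plu_set -row_mul !mxE.
Qed.

End Cramer.

Section PluckerIndex.
Variables (N p : nat).
Local Notation ix := (plucker_ix N p).

Lemma plucker_ix_sorted (t : p.-tuple 'I_N) : t \in ix -> sorted ltn (map val t).
Proof. by rewrite inE. Qed.

Lemma plucker_ix_inj (t : p.-tuple 'I_N) : t \in ix -> injective (tnth t).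
Proof.
move/plucker_ix_sorted => st; apply/injectiveP; rewrite /injectiveb /dinjectiveb.
rewrite -[enum _]/(enum 'I_p) (_ : [seq tnth t x | x <- enum 'I_p] = t).
  by rewrite -(map_inj_uniq val_inj) (sorted_uniq ltn_trans ltnn).
by rewrite -[RHS]map_tnth_enum.
Qed.

Lemma plucker_ix_eq (t t' : p.-tuple 'I_N) : t \in ix -> t' \in ix ->
  (forall a, tnth t a \in t') -> t = t'.
Proof.
move=> /plucker_ix_sorted st /plucker_ix_sorted st' sub; apply: val_inj => /=.
apply: (inj_map val_inj); apply: (irr_sorted_eq ltn_trans ltnn st st') => x.
have [|x' /tnthP[a ->] //||_ e] := @uniq_min_size _ t t'; rewrite ?size_tuple //.
  by rewrite -(map_inj_uniq val_inj) (sorted_uniq ltn_trans ltnn).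
by apply/mapP/mapP => -[y yt ->]; exists y => //; [rewrite -e|rewrite e].
Qed.

Lemma plucker_ixP (u : 'I_p -> 'I_N) : injective u ->
  exists (i : 'I_#|ix|) (s : 'S_p), forall a, u a = tnth (enum_val i) (s a).
Proof.
move=> ui; pose le : rel 'I_N := relpre val leq.
pose t := [tuple of sort le [tuple u a | a < p]].
have tix : t \in ix.
  rewrite inE ltn_sorted_uniq_leq (map_inj_uniq val_inj) sort_uniq sorted_map.
  apply/andP; split; last by apply: sort_sorted => x y; exact: leq_total.
  by rewrite -[tval _]/(map u (enum 'I_p)) (map_inj_uniq ui) enum_uniq.
have h a : exists b, u a == tnth t b.
  have /tnthP[b ->] : u a \in t; last by exists b.
  by rewrite mem_sort -[tval _]/(map u (enum 'I_p)) map_f ?mem_enum.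
have {h} h a : exists b, u a = tnth t b by have [b /eqP] := h a; exists b.
have [s sE] := fin_all_exists h.
have si : injective s by move=> a b e; apply: ui; rewrite !sE e.
by exists (enum_rank_in tix t), (perm si) => a; rewrite enum_rankK_in // permE.
Qed.

End PluckerIndex.

Section Evaluation.
Variables (k : fieldType) (R : comNzRingType) (psi : {rmorphism k -> R}) (N p : nat).
Variable C : 'M[R]_(N, p).

Definition plucker_eval (g : plucker_poly k N p) : R := (map_mpoly psi g).@[plucker_coords C].

Lemma plucker_eval_monoid : monoid_morphism plucker_eval.
Proof. by split=> [|x y]; rewrite /plucker_eval ?rmorph1 // !rmorphM. Qed.
Lemma plucker_eval_additive : zmod_morphism plucker_eval.
Proof. by move=> x y; rewrite /plucker_eval !rmorphB. Qed.
HB.instance Definition _ := GRing.isZmodMorphism.Build _ _ plucker_eval plucker_eval_additive.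
HB.instance Definition _ := GRing.isMonoidMorphism.Build _ _ plucker_eval plucker_eval_monoid.

Lemma det_eq_rows q (M : 'M[R]_q) i j : i != j -> row i M = row j M -> \det M = 0.
Proof.
move=> ij e; apply: (determinant_alternate ij) => l.
by have := congr1 (fun w : 'rV_q => w 0 l) e; rewrite !mxE.
Qed.

(** The coefficient matrix is a permutation matrix at the index that rearranges u, and has a zero
    row at any other; if u repeats an entry, both sides are 0. *)
Lemma plucker_eval_var (u : 'I_p -> 'I_N) : plucker_eval (plucker_var k u) = plu C u.
Proof.
have -> : plucker_eval (plucker_var k u) =
    \sum_i \det (\matrix_(a < p, b < p) (u a == tnth (enum_val i) b)%:R) * plucker_coords C i.
  rewrite /plucker_eval /plucker_var (rmorph_sum (map_mpoly psi)) /= (rmorph_sum (meval _)); apply: eq_bigr => i _ /=.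
  rewrite map_mpolyZ mevalZ map_mpolyX mevalXU -det_map_mx; congr (\det _ * _).
  by apply/matrixP => a b; rewrite !mxE rmorph_nat.
have [/injectiveP ui|] := boolP (injectiveb u); last first.
  case/injectivePn => a [b ab e]; rewrite big1 => [|i _].
    by rewrite /plu (det_eq_rows ab) // !row_rowsub /= e.
  by rewrite (det_eq_rows ab) ?mul0r //; apply/rowP => j; rewrite !mxE e.
have [i [s us]] := plucker_ixP ui.
rewrite (bigD1 i) //= big1 ?addr0 => [|j ji]; last first.
  have [a ha] : exists a, u a \notin enum_val j.
    apply/existsP; apply: contraNT ji => /existsPn h; apply/eqP/esym/enum_val_inj.
    apply: plucker_ix_eq (enum_valP _) (enum_valP _) _ => a.
    by have := h (s^-1 a)%g; rewrite negbK us permKV.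
  rewrite (expand_det_row _ a) big1 ?mul0r // => b _; rewrite mxE; case: eqP => [e|_].
    by move: ha; rewrite e mem_tnth.
  by rewrite mul0r.
have -> : (\matrix_(a, b) (u a == tnth (enum_val i) b)%:R) = perm_mx s :> 'M[R]_p.
  apply/matrixP => a b; rewrite !mxE us (inj_eq (plucker_ix_inj (enum_valP i))).
  by [].
rewrite -det_mulmx -row_permE; congr (\det _); apply/matrixP => a b; rewrite !mxE.
by rewrite us.
Qed.

Lemma plucker_eval_relation g : plucker_relation g -> plucker_eval g = 0.
Proof.
case=> u [v [a ->]]; rewrite rmorphB rmorphM /= !plucker_eval_var.
rewrite (plu_exchange C u v a) rmorph_sum -sumrB big1 // => l _.
by rewrite rmorphM /= !plucker_eval_var subrr.
Qed.

End Evaluation.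

Lemma plucker_var_homog (k : fieldType) N p (u : 'I_p -> 'I_N) :
  plucker_var k u \is 1.-homog.
Proof. by apply: rpred_sum => i _; apply: rpredZ; rewrite dhomogX /= mdeg1. Qed.

Lemma det_homog (k : fieldType) N q (M : 'M[{mpoly k[N]}]_q) :
  (forall i j, M i j \is 1.-homog) -> \det M \is q.-homog.
Proof.
move=> h; apply: rpred_sum => s _; rewrite -signr_odd mulr_sign.
have hp (F : 'I_q -> {mpoly k[N]}) : (forall i, F i \is 1.-homog) -> \prod_i F i \is q.-homog.
  elim: q F {M h s} => [|q IH] F hF; first by rewrite big_ord0 dhomog1.
  by rewrite big_ord_recl; apply: (dhomogM (d := 1) (hF 0)); apply: IH => i; exact: hF.
by case: ifP => _ //; rewrite ?rpredN; apply: hp.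
Qed.

Definition theta_poly (k : fieldType) N p (t : 'I_p -> 'I_N) : 'M[plucker_poly k N p]_N :=
  \matrix_(s, j) (plucker_var k t *+ (s == j)
    - \sum_l plucker_var k [eta t with l |-> s] * (t l == j)%:R).

Lemma theta_poly_homog k N p (t : 'I_p -> 'I_N) s j : theta_poly k t s j \is 1.-homog.
Proof.
rewrite mxE rpredB ?rpredMn ?plucker_var_homog // rpred_sum // => l _.
by rewrite mulr_natr rpredMn ?plucker_var_homog.
Qed.

Lemma map_theta_poly (k : fieldType) (R : comNzRingType) (psi : {rmorphism k -> R}) N p
    (C : 'M[R]_(N, p)) t : map_mx (plucker_eval psi C) (theta_poly k t) = theta C t.
Proof.
apply/matrixP => s j; rewrite mxE [theta_poly _ _ _ _]mxE thetaE rmorphB rmorphMn /= plucker_eval_var.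
rewrite rmorph_sum; congr (_ - _); apply: eq_bigr => l _.
by rewrite rmorphM /= plucker_eval_var rmorph_nat.
Qed.

(* The rows of theta t span the kernel L of C where the minor plu C t is
   invertible, so rank S_1 L <= q is the vanishing of the (q+1)-minors of all
   the x_i theta_t. *)
Section Minors.
Variables (n r p q : nat).
Local Notation N := (nmon n.+1 r).
Local Notation rows := ('I_n.+1 * ('I_p -> 'I_N) * 'I_N)%type.

Definition shifted_row (R : comNzRingType) (Th : ('I_p -> 'I_N) -> 'M[R]_N) (x : rows) :
    'rV[R]_(nmon n.+1 r.+1) :=
  row x.2 (Th x.1.2) *m varmx R r x.1.1.

Definition shifted_minor (R : comNzRingType) (Th : ('I_p -> 'I_N) -> 'M[R]_N)
    (ix : 'I_q.+1 -> rows) (jx : 'I_q.+1 -> 'I_(nmon n.+1 r.+1)) : R :=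
  \det (\matrix_(x, y) shifted_row Th (ix x) 0 (jx y)).

Definition hilb_eqns (k : fieldType) (g : plucker_poly k N p) :=
  exists ix jx, g = shifted_minor (@theta_poly k N p) ix jx.

Lemma map_shifted_row (R S : comNzRingType) (f : {rmorphism R -> S}) Th Th' x :
  (forall t, map_mx f (Th t) = Th' t) ->
  map_mx f (shifted_row Th x) = shifted_row Th' x.
Proof. by move=> ThE; rewrite map_mxM map_varmx map_row ThE. Qed.

Lemma map_shifted_minor (R S : comNzRingType) (f : {rmorphism R -> S}) Th Th' ix jx :
  (forall t, map_mx f (Th t) = Th' t) ->
  f (shifted_minor Th ix jx) = shifted_minor Th' ix jx.
Proof.
move=> ThE; rewrite -det_map_mx; congr (\det _); apply/matrixP => x y.
by rewrite [RHS]mxE -(map_shifted_row _ ThE) !mxE.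
Qed.

Lemma hilb_eqns_homog (k : fieldType) g : @hilb_eqns k g -> g \is q.+1.-homog.
Proof.
case=> ix [jx ->]; apply: det_homog => x y; rewrite !mxE rpred_sum // => l _.
rewrite [varmx _ _ _ _ _]mxE mulr_natr rpredMn // mxE.
exact: theta_poly_homog.
Qed.

Lemma eval_hilb_eqns (k : fieldType) (R : comNzRingType) (psi : {rmorphism k -> R})
    (C : 'M[R]_(N, p)) ix jx :
  plucker_eval psi C (shifted_minor (@theta_poly k N p) ix jx) = shifted_minor (theta C) ix jx.
Proof. by apply: map_shifted_minor => t; exact: map_theta_poly. Qed.

End Minors.

(** Near each point E is spanned by q rows up to a denominator, so V factors through A^q there, and
    some denominator kills its (q + 1)-minors. *)
Lemma locpres_minors (A : comNzRingType) M q m (E : 'rV[A]_M -> Prop)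
    (V : 'M[A]_(q.+1, M)) (g : 'I_q.+1 -> 'I_M) :
  noetherian A -> is_submod E ->
  (forall (K : fieldType) (phi : {rmorphism A -> K}), is_residue_field phi -> locpres phi m E) ->
  (q + m)%N = M -> (forall i, E (row i V)) -> \det (colsub g V) = 0.
Proof.
move=> noeth sE loc qm EV; set b := \det _.
suff : 1 * b = 0 by rewrite mul1r.
apply: (local_global1 noeth (Q := fun c => c * b = 0)) => [|K phi res].
  split=> [|x y hx hy|c x hx]; first by rewrite mul0r.
    by rewrite mulrDl hx hy addr0.
  by rewrite -[_ *: _]/(c * x) -mulrA hx mulr0.
have lE := loc K phi res.
have [||q' [s [G [Ca [qm' s0 _ h]]]]] := locpres_span res sE sE _ _ lE => //.
  by rewrite (locpres_codim res sE lE).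
have {qm'}qq : q' = q by lia.
subst q'; exists (s ^+ q.+1); last by rewrite rmorphXn expf_neq0.
rewrite -detZ -[RHS](det_mul_small (V *m Ca) (colsub g G)); congr (\det _).
apply/matrixP => i j; have := h _ (EV i).
move/(congr1 (fun w : 'rV_M => w 0 (g j))); rewrite -!row_mul => e.
have -> : (V *m Ca *m colsub g G) i j = (row i (V *m Ca *m G)) 0 (g j).
  by rewrite [LHS]mxE [RHS]mxE [RHS]mxE; apply: eq_bigr => l _; rewrite [colsub _ _ _ _]mxE.
by rewrite -e !mxE.
Qed.

Section MinorsVanish.
Variables (A B : comNzRingType) (f : A) (chi : {rmorphism A -> B}).
Hypothesis loc : is_localization f chi.
Hypothesis noeth : noetherian A.
Variables (n r p q m : nat) (L : 'rV[A]_(nmon n.+1 r) -> Prop).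
Variables (E : 'rV[A]_(nmon n.+1 r.+1) -> Prop).
Hypotheses (sL : is_submod L) (sE : is_submod E).
Hypothesis LE : forall i v, L v -> E (v *m varmx A r i).
Hypothesis locE : forall (K : fieldType) (phi : {rmorphism A -> K}), is_residue_field phi -> locpres phi m E.
Hypothesis qm : (q + m)%N = nmon n.+1 r.+1.
Variable C : 'M[B]_(nmon n.+1 r, p).
Hypothesis LC : forall v, v *m C = 0 -> submod_pullback chi L v.

(** Over the localization the rows of [theta] lie in the pullback of L. Powers of f lift their
    shifts to E, where [locpres_minors] applies, and only change the minor by a unit. *)
Lemma shifted_minor0 (ix : 'I_q.+1 -> 'I_n.+1 * ('I_p -> 'I_(nmon n.+1 r)) * 'I_(nmon n.+1 r)) jx :
  shifted_minor (theta C) ix jx = 0.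
Proof.
have h x : exists mv : nat * 'rV[A]_(nmon n.+1 r.+1),
    E mv.2 /\ map_mx chi mv.2 = chi (f ^+ mv.1) *: shifted_row (theta C) (ix x).
  have [|d [v [Lv e]]] := pullback_denom loc (w := row (ix x).2 (theta C (ix x).1.2)) sL.
    by apply: LC; rewrite -row_mul theta_ker row0.
  exists (d, v *m varmx A r (ix x).1.1); split=> /=; first exact: LE.
  by rewrite map_mxM map_varmx e scalemxAl.
have [mv mvP] := fin_all_exists h.
pose V := \matrix_x (mv x).2.
have V0 : \det (colsub jx V) = 0.
  by apply: (locpres_minors jx noeth sE locE qm) => x; rewrite rowK; case: (mvP x).
pose c : 'rV[B]_q.+1 := \row_x chi (f ^+ (mv x).1).
have : \det (diag_mx c *m \matrix_(x, y) shifted_row (theta C) (ix x) 0 (jx y)) = 0.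
  rewrite -(rmorph0 chi) -V0 -det_map_mx; congr (\det _); apply/matrixP => x y.
  rewrite mul_diag_mx [LHS]mxE [X in _ * X]mxE [RHS]mxE [X in chi X]mxE [X in chi X]mxE.
  have [_ /(congr1 (fun w : 'rV_(_) => w 0 (jx y)))] := mvP x.
  by rewrite mxE => ->; rewrite [in RHS]mxE [c _ _]mxE.
rewrite det_mulmx det_diag.
have -> : \prod_i c 0 i = chi (f ^+ (\sum_i (mv i).1)).
  by rewrite rmorphXn -prodrXr; apply: eq_bigr => i _; rewrite mxE rmorphXn.
have [g gf] := loc_expM loc (\sum_i (mv i).1) => e.
by rewrite /shifted_minor -[LHS]mul1r -gf -mulrA e mulr0.
Qed.

End MinorsVanish.

Section RowsAtPoint.
Variables (A : comNzRingType) (K : fieldType) (phi : {rmorphism A -> K}).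
Hypothesis res : is_residue_field phi.
Variables (m M q : nat) (E : 'rV[A]_M -> Prop) (T : 'M[A]_(m, M)) (e : A).
Hypotheses (sE : is_submod E) (e0 : phi e != 0).
Hypothesis ET : forall i, E (e *: row i T).
Hypothesis TE : forall v, E v -> exists w, e *: v = w *m T.
Hypothesis minors : forall (f : 'I_q.+1 -> 'I_m) (g : 'I_q.+1 -> 'I_M),
  exists2 s, phi s != 0 & s * \det (mxsub f g T) = 0.

Lemma fibre_rows : (fibre phi E :=: map_mx phi T)%MS.
Proof.
apply/eqmxP/andP; split.
  apply/rV_subP => w /(fibreP res sE)[b [v [b0 Ev h]]]; have [u uE] := TE Ev.
  have -> : w = ((phi e * phi b)^-1 *: map_mx phi u) *m map_mx phi T.
    apply: (scalerI (mulf_neq0 e0 b0)); rewrite -scalemxAl scalerA mulfV ?mulf_neq0 //.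
    by rewrite scale1r -map_mxM -uE map_mxZ -h scalerA.
  exact: submxMl.
apply/row_subP => i; rewrite -map_row -(scale1r (map_mx _ _)) -(mulVf e0) -scalerA scalemx_sub //.
by rewrite -map_mxZ; apply: mem_fibre.
Qed.

Lemma fibre_rank_le : (\rank (fibre phi E) <= q)%N.
Proof.
rewrite fibre_rows leqNgt; apply/negP => /minor_neq0[f [g]].
have [s s0 /(congr1 phi)] := minors f g.
rewrite rmorphM rmorph0 => /eqP; rewrite mulf_eq0 (negPf s0) /= => /eqP h.
by rewrite -map_mxsub det_map_mx h eqxx.
Qed.

(* The vanishing bordered minors express every row of T, up to a unit, through
   q fixed rows with coefficients read off its entries. *)
Lemma mod_rows : \rank (fibre phi E) = q -> forall v, E v -> map_mx phi v = 0 ->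
  exists2 s, phi s != 0 & ker_span phi E (s *: v).
Proof.
rewrite fibre_rows => rq v Ev v0.
have [|f [g]] := @minor_neq0 _ _ _ q (map_mx phi T); first by rewrite rq.
rewrite -map_mxsub det_map_mx => D0; set D := mxsub f g T in D0.
(* The index 0 is the bordering row or column; the other q select the minor [D]. *)
pose bord k (h : 'I_q -> 'I_k) i (x : 'I_(1 + q)) := if split x is inr y then h y else i.
have [s s0 sP] : exists2 s, phi s != 0 & forall ij : 'I_m * 'I_M,
    s * \det (mxsub (bord _ f ij.1 : 'I_q.+1 -> _) (bord _ g ij.2 : 'I_q.+1 -> _) T) = 0.
  apply: (common_denom (Q := fun ij s => s * \det (mxsub (bord _ f ij.1 : 'I_q.+1 -> _) (bord _ g ij.2 : 'I_q.+1 -> _) T) = 0)).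
    by move=> ij a b h; rewrite -mulrA h mulr0.
  by move=> ij; apply: minors.
have bordE i j : mxsub (bord _ f i) (bord _ g j) T =
    block_mx (T i j)%:M (row i (colsub g T)) (col j (rowsub f T)) D.
  apply/matrixP => x y; rewrite -(splitK x) -(splitK y); case: (split x) => x'; case: (split y) => y'.
  - by rewrite (block_mxEul (T i j)%:M) !mxE /bord !unsplitK !ord1 eqxx.
  - by rewrite (block_mxEur (T i j)%:M) !mxE /bord !unsplitK.
  - by rewrite (block_mxEdl (T i j)%:M) !mxE /bord !unsplitK.
  by rewrite (block_mxEdr (T i j)%:M) !mxE /bord !unsplitK.
pose s1 := s * \det D.
have s10 : phi s1 != 0 by rewrite rmorphM mulf_neq0.
have key : s1 *: (\det D *: T) = s1 *: (colsub g T *m \adj D *m rowsub f T).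
  apply/matrixP => i j; apply/eqP; rewrite -subr_eq0; apply/eqP.
  have := sP (i, j); rewrite bordE => /(congr1 (fun x => x * \det D)).
  rewrite mul0r -mulrA det_border mulrCA => <-.
  rewrite [in RHS]mxE mulr1n mulrA [RHS]mulrC /s1 !mxE -mulrBr [RHS]mulrA [RHS]mulrC [RHS]mulrA.
  by congr (_ * (_ - _)); apply: eq_bigr => l _; rewrite -row_mul !mxE.
have [w wE] := TE Ev.
exists (s1 * \det D * e * e); first by rewrite !rmorphM !mulf_neq0.
have -> : s1 * \det D * e * e *: v =
    \sum_l ((s1 * e) *: (colsub g v *m \adj D)) 0 l *: (e *: row (f l) T).
  transitivity (e *: ((s1 * e *: (colsub g v *m \adj D)) *m rowsub f T)); last first.
    rewrite mulmx_sum_row scaler_sumr; apply: eq_bigr => l _.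
    by rewrite row_rowsub !scalerA mulrC.
  rewrite mulrC -[LHS]scalerA; congr (_ *: _).
  rewrite -scalerA wE -[_ * _ *: _]scalerA 2!scalemxAr key -scalemxAr -scalemxAl.
  rewrite -[RHS]scalerA; congr (_ *: _); rewrite !mulmxA !scalemxAl; congr (_ *m _ *m _).
  apply/matrixP => i j; rewrite [RHS]mxE [X in _ * X]mxE.
  have -> : e * v i (g j) = (w *m T) i (g j) by rewrite -wE mxE.
  by rewrite !mxE; apply: eq_bigr => l _; rewrite mxE.
apply: (submod_sum (span_submod _)) => l _; apply: mem_span.
exists ((s1 * e *: (colsub g v *m \adj D)) 0 l), (e *: row (f l) T); split=> //.
have -> : phi ((s1 * e *: (colsub g v *m \adj D)) 0 l) =
   map_mx phi (s1 * e *: (colsub g v *m \adj D)) 0 l by rewrite [RHS]mxE.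
rewrite map_mxZ map_mxM map_mxsub v0.
have -> : colsub g (0 : 'rV[K]_M) = 0 by apply/matrixP => i j; rewrite !mxE.
by rewrite mul0mx scaler0 mxE.
Qed.

End RowsAtPoint.

Lemma map_theta (R S : comNzRingType) (f : {rmorphism R -> S}) N p (C : 'M[R]_(N, p)) t :
  map_mx f (theta C t) = theta (map_mx f C) t.
Proof.
rewrite /theta map_mxB !map_mxM map_scalar_mx map_mx_adj /plu -det_map_mx !map_mxsub.
by congr (_ - _ *m _); apply/matrixP => i j; rewrite !mxE rmorph_nat.
Qed.

Lemma plu_neq0 (K : fieldType) N p (C : 'M[K]_(N, p)) : (p <= \rank C)%N ->
  exists t, plu C t != 0.
Proof.
case/minor_neq0 => f [g fg]; exists f; apply: contraNneq fg => C0.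
have -> : mxsub f g C = rowsub f C *m (\matrix_(i, j) (i == g j)%:R).
  apply/matrixP => i j; rewrite !mxE (bigD1 (g j)) //= !mxE eqxx mulr1 big1 ?addr0 // => l lg.
  by rewrite !mxE (negPf lg) mulr0.
by rewrite det_mulmx [\det (rowsub _ _)]C0 mul0r.
Qed.

Section ClosedPoint.
Variables (A : comNzRingType) (K : fieldType) (phi : {rmorphism A -> K}).
Hypothesis res : is_residue_field phi.
Hypothesis ch : [pchar K] =i pred0.
Hypothesis noeth : noetherian A.
Variables (n r q : nat) (a : seq nat).
Hypotheses (sa : sorted geq a) (za : (size a <= r)%N).
Hypothesis qm : (q + mac r.+1 a)%N = nmon n.+1 r.+1.
Local Notation p := (mac r a).
Local Notation N := (nmon n.+1 r).
Variable L : 'rV[A]_N -> Prop.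
Hypothesis sL : is_submod L.
Variables (B : comNzRingType) (f : A) (chi : {rmorphism A -> B}) (C : 'M[A]_(N, p)).
Hypotheses (f0 : phi f != 0) (loc : is_localization f chi).
Hypothesis pres : presents_quot (submod_pullback chi L) (map_mx chi C).
Hypothesis minors : forall (ix : 'I_q.+1 -> 'I_n.+1 * ('I_p -> 'I_N) * 'I_N) jx,
  shifted_minor (theta (map_mx chi C)) ix jx = 0.
Local Notation I0 := (form_ideal L).
Local Notation E := (@graded_part A n I0).

(** The minors bound the rank of the fibre of E in degree r + 1 by q, and Macaulay's bound gives the
    opposite inequality. With the rank exactly q at the point, the vanishing of the minors over A,
    not just on the fibre, gives the Tor condition. *)
Lemma closed_point :
  [/\ locpres phi p L, codim (fibre phi (@E r.+1)) = mac r.+1 a & mod_prop E phi r.+1].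
Proof.
have fm m : phi (f ^+ m) != 0 by rewrite rmorphXn expf_neq0.
have [X [m1 [m2 [m3 [XC CL LC]]]]] := presents_denom loc noeth sL pres.
have lL : locpres phi p L by apply: (locpres_mk sL (fm m1) (fm m2) (fm m3) XC LC CL).
have [|t t0] := @plu_neq0 _ _ _ (map_mx phi C).
  apply: (mxrank_witness_le (P := (phi (f ^+ m1))^-1 *: map_mx phi X) (Q := 1%:M)).
  by rewrite mulmx1 -scalemxAl -map_mxM XC map_scalar_mx scale_scalar_mx mulVf.
have {t0} t0 : phi (plu C t) != 0.
  by rewrite /plu -det_map_mx map_mxsub.
have sE d : is_submod (@E d) by exact: (graded_submod (form_ideal_ideal L)).
have EX d i v : @E d v -> @E d.+1 (v *m varmx A d i) by exact: (gradedX (form_ideal_ideal L)).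
pose ty := ('I_n.+1 * 'I_N)%type.
pose T : 'M[A]_(#|{: ty}|, _) :=
  \matrix_x shifted_row (theta C) ((enum_val x).1, t, (enum_val x).2).
(* [f ^+ m3] makes C kill L, [plu C t] is the factor by which [theta] differs from a projection, and
   [f ^+ m2] brings its rows into L. *)
pose e := f ^+ m2 * (plu C t * f ^+ m3).
have e0 : phi e != 0 by rewrite !rmorphM !mulf_neq0.
have ET x : @E r.+1 (e *: row x T).
  rewrite rowK /e mulrC -scalerA; apply: (submodZ (sE _)).
  rewrite /shifted_row scalemxAl; apply: EX; apply/(form_ideal_degree sL)/CL.
  by rewrite -row_mul theta_ker row0.
have TE v : @E r.+1 v -> exists w, e *: v = w *m T.
  case/(form_ideal_gen (leqnn r)) => g [gE ->].
  exists (f ^+ m2 *: \row_x (f ^+ m3 *: g (enum_val x).1) 0 (enum_val x).2).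
  rewrite /e -scalerA -scalemxAl; congr (_ *: _).
  rewrite mulmx_sum_row scaler_sumr.
  transitivity (\sum_(x : ty) (f ^+ m3 *: g x.1) 0 x.2 *: shifted_row (theta C) (x.1, t, x.2)).
    rewrite -(pair_big xpredT xpredT (fun i s => (f ^+ m3 *: g i) 0 s *: shifted_row (theta C) (i, t, s))) /=.
    apply: eq_bigr => i _.
    have /(thetaM t) h : (f ^+ m3 *: g i) *m C = 0.
      by rewrite -scalemxAl LC //; apply/(form_ideal_degree sL).
    rewrite -scalerA !scalemxAl -h [X in X *m _]mulmx_sum_row mulmx_suml; apply: eq_bigr => s _.
    by rewrite -scalemxAl.
  rewrite (reindex (@enum_val _ {: ty})) /=; last exact/onW_bij/enum_val_bij.
  by apply: eq_bigr => x _; rewrite rowK [in RHS]mxE.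
have mins (u : 'I_q.+1 -> 'I_#|{: ty}|) (v : 'I_q.+1 -> 'I_(nmon n.+1 r.+1)) :
    exists2 s, phi s != 0 & s * \det (mxsub u v T) = 0.
  pose ix x := ((enum_val (u x)).1, t, (enum_val (u x)).2).
  have dE : \det (mxsub u v T) = shifted_minor (theta C) ix v.
    by congr (\det _); apply/matrixP => x y; rewrite mxE [LHS]mxE [RHS]mxE.
  have [_ _ /(_ (\det (mxsub u v T)))[|m fmE]] := loc; last by exists (f ^+ m).
  rewrite dE -(minors ix v); apply: map_shifted_minor => t'; exact: map_theta.
have rk := fibre_rank_le res (sE r.+1) e0 ET TE mins.
have cod : codim (fibre phi (@E r.+1)) = mac r.+1 a.
  apply/eqP; rewrite eqn_leq; apply/andP; split; last first.
    by have := codimE (fibre phi (@E r.+1)); lia.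
  have JS := fibre_S1 sE EX res (fun v => form_ideal_gen (leqnn r) (v := v)).
  apply: (@leq_trans (codim (S1 (@varmx n.+1 K) (fibre phi (@E r))))).
    by case/andP: JS => _ /codimS.
  apply: (macaulay ch (@varmxC _ _) (@varmx_gen _ _) sa za).
  apply: (locpres_codim res (sE r)).
  by apply: locpres_ext lL => v; apply: iff_sym; exact: form_ideal_degree.
split=> // v; apply: (mod_rows res (sE r.+1) e0 ET TE mins).
by have := codimE (fibre phi (@E r.+1)); lia.
Qed.

End ClosedPoint.

(** * The Hilbert functor *)

Section BaseChange.
Variables (A B : comNzRingType) (f : {rmorphism A -> B}).
Variables (n r : nat) (P : {poly rat}) (I : {mpoly A[n.+1]} -> Prop).
Hypotheses (noethA : noetherian A) (noethB : noetherian B).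
Hypothesis chA : forall (K : fieldType) (phi : {rmorphism A -> K}), [pchar K] =i pred0.
Hypothesis chB : forall (K : fieldType) (phi : {rmorphism B -> K}), [pchar K] =i pred0.
Variable a : seq nat.
Hypotheses (sa : sorted geq a) (za : (size a <= r)%N).
Hypothesis Pa : forall d, (size a <= d)%N -> P.[d%:R] = (mac d a)%:R.
Hypothesis HI : Hilb P I.
Local Notation E := (@graded_part A n I).
Local Notation L := (submod_pullback f (@E r)).
Local Notation E' := (@graded_part B n (form_ideal L)).

Lemma form_ideal_pullback d v : (r <= d)%N -> submod_pullback f (@E d) v -> @E' d v.
Proof.
move=> rd; have idL := form_ideal_ideal L.
have base e : r = e -> forall v, submod_pullback f (@E e) v -> @E' e v.
  by case: e / => w Lw; apply: mem_span; exists w.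
elim: d rd v => [|d IH]; first by rewrite leqn0 => /eqP; exact: base.
rewrite leq_eqVlt => /predU1P[|rd v]; first exact: base.
apply: (span_min (W := @E' d.+1)); first exact: graded_submod.
move=> _ [u Eu ->]; have [|g [gE ->]] := Hilb_gen noethA chA sa Pa HI (d := d) _ Eu.
  exact: leq_trans za rd.
rewrite raddf_sum; apply: (submod_sum (graded_submod idL _)) => i _ /=.
rewrite map_mxM map_varmx; apply: (gradedX idL); apply: IH => //.
by apply: mem_span; exists (g i).
Qed.

Lemma pullback_form_ideal v : @E' r.+1 v -> submod_pullback f (@E r.+1) v.
Proof.
have sL : is_submod L by exact: span_submod.
case/(form_ideal_gen (leqnn r)) => g [gE ->].
apply: (submod_sum (span_submod _)) => i _.
have /(form_ideal_degree sL) := gE i.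
apply: (span_min (W := fun w => submod_pullback f (@E r.+1) (w *m varmx B r i))).
  have [s0 sD sZ] : is_submod (submod_pullback f (@E r.+1)) by exact: span_submod.
  split=> [|x y hx hy|b x hx]; first by rewrite mul0mx.
    by rewrite mulmxDl; apply: sD.
  by rewrite -scalemxAl; apply: sZ.
move=> _ [u Eu ->]; rewrite -(map_varmx f) -map_mxM; apply: mem_span.
by exists (u *m varmx A r i) => //; apply: (HilbX HI).
Qed.

(** The point psi lies over the kernel of [psi \o f], and freeness at that point of A, being stated
    by matrices, passes to B. *)
Lemma pullback_locpres (K : fieldType) (psi : {rmorphism B -> K}) d :
  is_residue_field psi -> (size a <= d)%N -> locpres psi (mac d a) (submod_pullback f (@E d)).
Proof.
move=> res ad; have prK := ker_prime (psi \o f : {rmorphism A -> K}).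
have [K' [phi [res' ker]]] := residue_field_exists prK.
apply: (locpres_base (phi := phi)) => [x /ker//|].
exact: (Hilb_locpres noethA chA sa Pa HI).
Qed.

(** In degrees r and r + 1 the ideal generated by L over B agrees with the pullback of I, so it is
    free of the right ranks there, and [gotzmann] applies: its saturation returns L in degree r. The
    image of I lies in this saturation because I is determined by its part in degree r. *)
Lemma Hilb_pullback v :
  H0 (r := r) (subscheme_pullback f I) v <-> submod_pullback f (H0 (r := r) I) v.
Proof.
have sL : is_submod L by exact: span_submod.
have loc (K : fieldType) (psi : {rmorphism B -> K}) : is_residue_field psi ->
  [/\ locpres psi (mac r a) L, codim (fibre psi (@E' r.+1)) = mac r.+1 a & mod_prop E' psi r.+1].
  move=> res; have l1 : locpres psi (mac r.+1 a) (@E' r.+1).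
    apply: locpres_ext (pullback_locpres res (leqW za)) => w.
    by split=> [|/pullback_form_ideal//]; apply: form_ideal_pullback.
  split; first exact: pullback_locpres.
    exact: (locpres_codim res (graded_submod (form_ideal_ideal L) _) l1).
  by move=> w; apply: (locpres_mod _ l1); exact: (graded_submod (form_ideal_ideal L)).
have Pr d : (r <= d)%N -> P.[d%:R] = (mac d a)%:R.
  by move=> rd; apply: Pa; exact: leq_trans za rd.
have [cl _ _] := gotzmann sL noethB chB sa za Pr loc.
have [idS homS satS] := cl.
(* The inclusion is tested over A: the contraction is again homogeneous and saturated, so [Hilb_inj]
   reduces it to degree r. *)
have clI' : closed_subscheme (fun g => saturation (form_ideal L) (map_mpoly f g)).
  split=> [|g d|g h].
  - split=> [|x y hx hy|c x hx]; first by rewrite rmorph0; exact: (is_ideal0 idS).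
      by rewrite rmorphD; exact: (is_idealD idS).
    by rewrite rmorphM; exact: (is_idealMl idS).
  - move/(homS _ d); rewrite -!form_row_pihomog map_row_of_form.
    by rewrite map_form_of_row.
  apply: satS => i; have [m hm] := h i; exists m.
  by move: hm; rewrite rmorphM rmorphXn /= map_mpolyX.
have [clI _ _] := HI.
have sub : forall g, I g -> saturation (form_ideal L) (map_mpoly f g).
  apply: (Hilb_inj (r := r) clI clI') => [d rd|w Iw].
    by apply: (Hilb_gen noethA chA sa Pa HI); exact: leq_trans za rd.
  rewrite /graded_part map_form_of_row; apply/(H0_gotzmann sL noethB chB sa za loc).
  by apply: mem_span; exists w.
split=> [sv|Lv].
  apply/(H0_gotzmann sL noethB chB sa za loc); apply: satS => i.
  have [m hm] := sv i; exists m; move: hm.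
  by apply: (span_min idS) => _ [g Ig ->]; exact: sub.
have idIm : is_ideal (ideal_image f I) by exact: ideal_gen_ideal.
apply: sub_saturation => //; have := graded_submod idIm r.
move=> s; move: Lv; apply: (span_min s) => _ [u Iu ->].
rewrite /graded_part -map_form_of_row; apply: mem_span.
by exists (form_of_row u).
Qed.

End BaseChange.

Lemma residue_pchar0 (k : fieldType) (A : comAlgType k) (K : fieldType) (phi : {rmorphism A -> K}) :
  [pchar k] =i pred0 -> [pchar K] =i pred0.
Proof. by move=> ch q; rewrite (fmorph_pchar (phi \o in_alg A : {rmorphism k -> K})). Qed.

Lemma plucker_eval_ideal (k : fieldType) (R : comNzRingType) (psi : {rmorphism k -> R}) N p
    (C : 'M[R]_(N, p)) (G : plucker_poly k N p -> Prop) :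
  (forall g, G g -> plucker_eval psi C g = 0) ->
  forall g, plucker_ideal_gen G g -> plucker_eval psi C g = 0.
Proof.
move=> G0; apply: (span_min (M := (plucker_poly k N p)^o) (W := fun g => plucker_eval psi C g = 0)).
  split=> [|x y hx hy|c x hx]; first by rewrite rmorph0.
    by rewrite rmorphD /= hx hy addr0.
  by rewrite -[_ *: _]/(c * x) rmorphM /= hx mulr0.
by move=> g [/plucker_eval_relation|/G0].
Qed.

Theorem theorem6p6 (k : fieldType) (n : nat) (P : {poly rat}) (r p qr1 : nat)
    (char0 : [pchar k] =i pred0)
    (hP : exists I : {mpoly k[n.+1]} -> Prop,
            closed_subscheme I /\ hilbert_poly I P)
    (hr : gotzmann_number P r)
    (hp : P.[r%:R] = p%:R)
    (hq : (compl_poly n P).[r.+1%:R] = qr1%:R) :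
  exists G : plucker_poly k #|monomials n.+1 r| p -> Prop,
    (forall g, G g -> g \is qr1.+1.-homog) /\
    represents_Hilb P (plucker_ideal_gen G).
Proof.
have [a [za sa PE]] := hr.
have Pa d : (size a <= d)%N -> P.[d%:R] = (mac d a)%:R.
  by rewrite za; exact: gotzmann_mac.
have {hp} pE : p = mac r a.
  by apply/eqP; rewrite -(Num.Theory.eqr_nat rat) -hp Pa ?za.
have qm : (qr1 + mac r.+1 a)%N = nmon n.+1 r.+1.
  by apply: compl_poly_mac hq; rewrite Pa // za.
subst p; have zr : (size a <= r)%N by rewrite za.
have chA (A : comAlgType k) (K : fieldType) (phi : {rmorphism A -> K}) : [pchar K] =i pred0.
  exact: residue_pchar0 phi char0.
exists (@hilb_eqns n r (mac r a) qr1 k); split; first exact: hilb_eqns_homog.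
split=> [A I noeth HI|A I I' noeth HI HI' e|A L noeth [GrL eqL]|A B f I noethA noethB HI].
- have loc d (K : fieldType) (phi : {rmorphism A -> K}) : is_residue_field phi -> (size a <= d)%N ->
      locpres phi (mac d a) (@graded_part A n I d).
    by move=> res; exact: (Hilb_locpres noeth (chA A) sa Pa HI).
  split; first by apply: locpres_Gr => // [|K phi res]; [exact: (Hilb_submod HI)|exact: loc].
  move=> f B chi C locf [_ pres] g.
  apply: (plucker_eval_ideal (psi := chi \o in_alg A)) => {}g [ix [jx ->]].
  rewrite eval_hilb_eqns.
  apply: (shifted_minor0 locf noeth (Hilb_submod HI r) (Hilb_submod HI r.+1) _ _ qm).
  + by move=> i v; exact: (HilbX HI).
  + by move=> K phi res; apply: loc => //; exact: leqW.
  by move=> v /pres.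
- have [[cl _ _] [cl' _ _]] := (HI, HI').
  by move=> f; split; apply: (Hilb_inj (r := r)) => // [d rd|v];
    first [exact: (e v).1 | exact: (e v).2 | apply: (Hilb_gen noeth (chA A) sa Pa); rewrite ?za].
- have [sL _] := GrL.
  have loc (K : fieldType) (phi : {rmorphism A -> K}) : is_residue_field phi ->
      [/\ locpres phi (mac r a) L,
        codim (fibre phi (@graded_part A n (form_ideal L) r.+1)) = mac r.+1 a
        & mod_prop (@graded_part A n (form_ideal L)) phi r.+1].
    move=> res; have [f [B [chi [C [f0 locf pres]]]]] := Gr_chart phi GrL.
    apply: (closed_point res (chA A K phi) noeth sa zr qm sL f0 locf pres) => ix jx.
    rewrite -(eval_hilb_eqns (chi \o in_alg A)).
    by apply: (eqL _ _ _ _ locf pres); apply: mem_span; right; exists ix, jx.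
  have Pr d : (r <= d)%N -> P.[d%:R] = (mac d a)%:R by rewrite -za; exact: Pa.
  exists (saturation (form_ideal L)).
    exact: (gotzmann sL noeth (chA A) sa zr Pr loc).
  exact: (H0_gotzmann sL noeth (chA A) sa zr loc).
move=> v; exact: (@Hilb_pullback A B (f : {rmorphism A -> B}) _ _ _ _ noethA noethB (chA A) (chA B) a sa zr Pa HI v).
Qed.
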